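(* Let $\Omega\subset\mathbb{R}^3$ be open, bounded and convex with $\mathcal{L}^3(\Omega)=1$. For any $T\in(0,\infty)$ and any $\overline{\alpha}\in\mathcal{P}_c(\mathbb{R}^3)$, there exists an energy-conserving geostrophic solution $\alpha\in C([0,T];\mathcal{P}_c(\mathbb{R}^3))$ with initial measure $\overline{\alpha}$ and a sequence $(\alpha^N)_{N\in\mathbb{N}}$ of continuously differentiable discrete geostrophic solutions on $[0,T]$ such that $\lim_{N\to\infty}\sup_{t\in[0,T]}W_2(\alpha^N_t,\alpha_t)=0$.
   Context: $\mathcal{L}^3$ is Lebesgue measure, $\mathcal{L}^3\llcorner\Omega$ its restriction to $\Omega$. $\mathcal{P}_c(\mathbb{R}^3)$ is the set of compactly supported Borel probability measures on $\mathbb{R}^3$, equipped with the Wasserstein 2-distance $W_2$; $C([0,T];\mathcal{P}_c(\mathbb{R}^3))$ denotes continuous maps w.r.t. $W_2$. For a probability measure $\nu$ with finite second moment, $\mathcal{B}[\nu]$ denotes the unique mean-zero convex function in $H^1(\Omega)$ whose gradient is the optimal transport map from $\mathcal{L}^3\llcorner\Omega$ to $\nu$ for the cost $|x-y|^2$. $J$ is the $3\times 3$ matrix with rows $(0,-1,0),(1,0,0),(0,0,0)$. $\mathcal{Q}^N(\mathbb{R}^3)$ is the set of measures $\sum_{i=1}^N m_i\delta_{z_i}$ with $m_i>0$, $\sum_i m_i=1$, and $z_i\neq z_j$ for $i\neq j$. A map $\alpha\in C([0,T];\mathcal{P}_c(\mathbb{R}^3))$ is a geostrophic solution on $[0,T]$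 with initial measure $\overline{\alpha}$ if for all $\varphi\in C_c^\infty(\mathbb{R}^3\times\mathbb{R})$, $$\int_0^T\!\!\int_{\mathbb{R}^3}\big(\partial_t\varphi(z,t)+Jz\cdot\nabla\varphi(z,t)\big)\,d\alpha_t(z)\,dt-\int_0^T\!\!\int_\Omega Jx\cdot\nabla\varphi\big(\nabla\mathcal{B}[\alpha_t](x),t\big)\,dx\,dt=\int_{\mathbb{R}^3}\varphi(z,T)\,d\alpha_T(z)-\int_{\mathbb{R}^3}\varphi(z,0)\,d\overline{\alpha}(z),$$ where $\nabla\varphi$ is the spatial gradient. It is a continuously differentiable discrete geostrophic solution if moreover there exist $N$, masses $m_i>0$ with $\sum m_i=1$ and a continuously differentiable map $(z_1,\dots,z_N):[0,T]\to\mathbb{R}^{3N}$ with $\alpha_t=\sum_i m_i\delta_{z_i(t)}\in\mathcal{Q}^N(\mathbb{R}^3)$ for all $t$. The geostrophic energy of $\nu\in\mathcal{P}_c(\mathbb{R}^3)$ is $E[\nu]=\int_\Omega\big(\tfrac12((\partial_1\mathcal{B}[\nu](x)-x_1)^2+(\partial_2\mathcal{B}[\nu](x)-x_2)^2)-x_3\partial_3\mathcal{B}[\nu](x)\big)\,dx$; a solution is energy-conserving if $t\mapsto E[\alpha_t]$ is constant. *)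

(* Defs.v *)
From HB Require Import structures.
From mathcomp Require Import all_boot all_order all_algebra.
From mathcomp Require Import all_classical all_reals all_analysis.
Import Order.TTheory GRing.Theory Num.Theory.
Import numFieldNormedType.Exports.

Set Implicit Arguments.
Unset Strict Implicit.
Unset Printing Implicit Defensive.

Local Open Scope classical_set_scope.
Local Open Scope ring_scope.

Notation pt R := (R * R * R)%type.

Section Geostrophic.
Variable R : realType.

Definition sqd (x y : pt R) : R :=
  (x.1.1 - y.1.1) ^+ 2 + (x.1.2 - y.1.2) ^+ 2 + (x.2 - y.2) ^+ 2.

Definition e1 : pt R := (1, 0, 0).
Definition e2 : pt R := (0, 1, 0).
Definition e3 : pt R := (0, 0, 1).

(* Lebesgue measure L^1 on R (the library's lebesgue_measure, transported
   to the canonical measurable structure of R; same sigma-algebra) *)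
Definition leb1 (A : set R) : \bar R := @lebesgue_measure R A.
Lemma leb1_0 : leb1 set0 = 0%E. Proof. exact: measure0. Qed.
Lemma leb1_ge0 A : (0 <= leb1 A)%E. Proof. exact: measure_ge0. Qed.
Lemma leb1_sa : semi_sigma_additive leb1.
Proof. exact: (@measure_semi_sigma_additive _ _ _ (@lebesgue_measure R)). Qed.
HB.instance Definition _ := isMeasure.Build _ _ _ leb1 leb1_0 leb1_ge0 leb1_sa.
Lemma leb1_sf : sigma_finite setT leb1.
Proof. exact: (@sigma_finiteT _ _ _ (@lebesgue_measure R)). Qed.
HB.instance Definition _ := @Measure_isSigmaFinite.Build _ _ _ leb1 leb1_sf.

Definition leb3 : {measure set (pt R) -> \bar R} := ((leb1 \x leb1) \x leb1)%E.

Definition lebOm (Omega : set (pt R)) : set (pt R) -> \bar R :=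
  fun A => leb3 (Omega `&` A).

Definition convex_set3 (A : set (pt R)) : Prop :=
  forall (x y : pt R) (t : R), A x -> A y -> 0 <= t <= 1 ->
    A (t *: x + (1 - t) *: y).

Definition convex_on3 (A : set (pt R)) (f : pt R -> R) : Prop :=
  forall (x y : pt R) (t : R), A x -> A y -> 0 <= t <= 1 ->
    f (t *: x + (1 - t) *: y) <= t * f x + (1 - t) * f y.

Definition compactly_supported (mu : set (pt R) -> \bar R) : Prop :=
  exists K : set (pt R), [/\ compact K, measurable K & mu K = 1%E].

Definition coupling (mu nu : set (pt R) -> \bar R)
    (pi : {measure set (pt R * pt R) -> \bar R}) : Prop :=
  forall A : set (pt R), measurable A ->
    pi (A `*` setT) = mu A /\ pi (setT `*` A) = nu A.

Definition cost (pi : {measure set (pt R * pt R) -> \bar R}) : \bar R :=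
  (\int[pi]_z (sqd z.1 z.2)%:E)%E.

Definition W2 (mu nu : set (pt R) -> \bar R) : R :=
  Num.sqrt (fine (ereal_inf [set cost pi | pi in coupling mu nu])).

Definition is_otmap (Omega : set (pt R)) (nu : set (pt R) -> \bar R)
    (Tm : pt R -> pt R) : Prop :=
  [/\ measurable_fun Omega Tm,
      (forall B : set (pt R), measurable B ->
         leb3 (Omega `&` Tm @^-1` B) = nu B)
    & (forall pi, coupling (lebOm Omega) nu pi ->
         (\int[leb3]_(x in Omega) (sqd x (Tm x))%:E <= cost pi)%E)].

Definition grad3 (f : pt R -> R) (x : pt R) : pt R :=
  ('D_e1 f x, 'D_e2 f x, 'D_e3 f x).

(* phi is a mean-zero convex function in H^1(Omega) whose gradient is
   (a.e. equal to) the optimal transport map from L^3|_Omega to nu *)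
Definition is_brenier (Omega : set (pt R)) (nu : set (pt R) -> \bar R)
    (phi : pt R -> R) : Prop :=
  [/\ convex_on3 Omega phi,
      {ae leb3, forall x, Omega x -> differentiable phi x},
      leb3.-integrable Omega (fun x => (phi x ^+ 2)%:E)
        /\ (forall v, v \in [:: e1; e2; e3] ->
              leb3.-integrable Omega (fun x => ('D_v phi x ^+ 2)%:E)),
      (\int[leb3]_(x in Omega) (phi x)%:E = 0)%E
    & exists Tm, is_otmap Omega nu Tm /\
        {ae leb3, forall x, Omega x -> grad3 phi x = Tm x}].

Definition Bren (Omega : set (pt R)) (nu : set (pt R) -> \bar R) : pt R -> R :=
  xget (fun _ => 0) [set phi | is_brenier Omega nu phi].

Fixpoint iderD (vs : seq (pt R * R)) (f : pt R * R -> R) : pt R * R -> R :=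
  match vs with
  | [::] => f
  | v :: vs' => fun x => 'D_v (iderD vs' f) x
  end.

Definition test_fun (f : pt R * R -> R) : Prop :=
  (forall vs : seq (pt R * R),
     continuous (iderD vs f) /\ forall x v, derivable (iderD vs f) x v)
  /\ exists K : set (pt R * R), compact K /\ forall z, ~ K z -> f z = 0.

Definition dz (v : pt R) (f : pt R * R -> R) (z : pt R) (t : R) : R :=
  'D_((v, 0) : pt R * R) f (z, t).
Definition dt (f : pt R * R -> R) (z : pt R) (t : R) : R :=
  'D_((0, 1) : pt R * R) f (z, t).

(* J z . grad phi(z,t), J = rows (0,-1,0),(1,0,0),(0,0,0) *)
Definition Jdot (f : pt R * R -> R) (w : pt R) (z : pt R) (t : R) : R :=
  - w.1.2 * dz e1 f z t + w.1.1 * dz e2 f z t.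

Definition W2_continuous (T : R) (alpha : R -> probability (pt R) R) : Prop :=
  (forall t, 0 <= t <= T -> compactly_supported (alpha t)) /\
  forall t, 0 <= t <= T -> forall eps : R, 0 < eps ->
    exists2 delta : R, 0 < delta & forall s, 0 <= s <= T ->
      `|s - t| < delta -> W2 (alpha s) (alpha t) < eps.

Definition geo_sol (Omega : set (pt R)) (T : R)
    (alpha : R -> probability (pt R) R) (abar : probability (pt R) R) : Prop :=
  W2_continuous T alpha /\
  forall phi : pt R * R -> R, test_fun phi ->
    \int[leb1]_(t in `[0, T])
        (\int[alpha t]_(z in setT) (dt phi z t + Jdot phi z z t))
    - \int[leb1]_(t in `[0, T])
        (\int[leb3]_(x in Omega)
            Jdot phi x (grad3 (Bren Omega (alpha t)) x) t)
    = \int[alpha T]_(z in setT) phi (z, T)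
      - \int[abar]_(z in setT) phi (z, 0).

Definition energy (Omega : set (pt R)) (nu : set (pt R) -> \bar R) : R :=
  \int[leb3]_(x in Omega)
     (2^-1 * (('D_e1 (Bren Omega nu) x - x.1.1) ^+ 2
              + ('D_e2 (Bren Omega nu) x - x.1.2) ^+ 2)
      - x.2 * 'D_e3 (Bren Omega nu) x).

Definition energy_conserving (Omega : set (pt R)) (T : R)
    (alpha : R -> probability (pt R) R) : Prop :=
  forall s t, 0 <= s <= T -> 0 <= t <= T ->
    energy Omega (alpha s) = energy Omega (alpha t).

Definition discrete_C1_geo_sol (Omega : set (pt R)) (T : R)
    (alpha : R -> probability (pt R) R) : Prop :=
  geo_sol Omega T alpha (alpha 0) /\
  exists (N : nat) (m : 'I_N -> R) (z : 'I_N -> R -> pt R),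
    (forall i, 0 < m i) /\
    \sum_(i < N) m i = 1 /\
    (forall i t, 0 <= t <= T -> derivable (z i) t 1) /\
    (forall i, {within `[0, T], continuous ('D_1 (z i))}) /\
    (forall t, 0 <= t <= T -> forall i j, i != j -> z i t != z j t) /\
    (forall t, 0 <= t <= T -> forall A : set (pt R), measurable A ->
       alpha t A = (\sum_(i < N) (m i)%:E * \d_(z i t) A)%E).

End Geostrophic.

(* Main.v *)
Require Import Defs.
From HB Require Import structures.
From mathcomp Require Import all_boot all_order all_algebra.
From mathcomp Require Import all_classical all_reals all_analysis.
From mathcomp Require Import measurable_realfun.
From mathcomp Require Import ring lra.
Import Order.TTheory GRing.Theory Num.Theory.
Import numFieldNormedType.Exports.
Local Open Scope classical_set_scope.
Local Open Scope ring_scope.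
Set Implicit Arguments.
Unset Strict Implicit.
Unset Printing Implicit Defensive.

(** A Brenier potential of a measure carried by a fixed box extends to a convex
Lipschitz function on the whole space. Such potentials form a compact set, and
on it the duality gap [int phi + phi^*(T) - x.T] vanishes only for [T] the
gradient of [phi]; hence a small gap forces gradients to be close in [L^1].
For discrete measures with fixed masses, moving the atoms by [d] costs a gap of
order [d], so the potentials, and the first moments of the cells, depend
continuously on the atoms. The atoms therefore solve an ODE
[z_i' = J (z_i - b_i / m_i)] with continuous right-hand side, to which Peano's
theorem applies; they never collide because their vertical coordinates are
constant and chosen distinct. The energy differs from a smooth function of the
atoms by the maximal correlation [Q], and optimality of both plans squeezes
[Q(s) - Q(t)] between two expressions with the same first-order term, which
makes the energy constant. Atoms move at a speed bounded independently of their
number, so the potentials are equicontinuous in time; along an ultrafilter they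
converge uniformly in time, and the weak formulation and the energy, which are
continuous functions of the gradients in [L^1], pass to the limit. *)

(** * Integrals and laws *)

(** The radius of the box comes from a growth bound. Divided by its mass, the first moment of a cell
    is the barycentre of a part of [Om], so seeds in the box of radius [B] have velocity coordinates
    at most [B + rho]; Gronwall's lemma gives [M = expR (T + 1) * (B + 2 + rho)], whatever the
    number of seeds. The [2] pays for the net of the support and for separating the heights, the
    extra unit of time for a two-sided derivative at [T]. The compactness argument for stability
    yields no rate: the velocity is only shown to be continuous, hence Peano rather than Picard. The
    distance used throughout is [gdist], the L^1 distance of gradients. A small gap makes it small,
    on the box it bounds the square of [W2] up to the factor [2 * M], and both the weak formulation
    and the energy are continuous for it. The statement reaches potentials only through [Bren], an
    arbitrary choice. Uniqueness of optimal maps, again an instance of a vanishing gap, identifies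
    its gradient with that of the potential constructed by hand. *)

Section ae_integral.
Context d (X : measurableType d) (R : realType).
Variable mu : {measure set X -> \bar R}.
Import HBNNSimple.
Local Open Scope ereal_scope.

(* No measurability is assumed: the integral of a nonnegative function is the
   supremum over the simple functions below it, and these can be cut off on a
   null set. *)
Lemma ge0_ae_le_integralT (f g : X -> \bar R) :
  (forall x, 0 <= f x) -> (forall x, 0 <= g x) ->
  {ae mu, forall x, f x <= g x} -> \int[mu]_x f x <= \int[mu]_x g x.
Proof.
move=> f0 g0 [N [mN N0 fgN]].
rewrite (ge0_integralTE mu f0) (ge0_integralTE mu g0).
apply: ge_ereal_sup => _ [h /= hf <-].
pose h' := proj_nnsfun h (measurableC mN).
have h'E x : h' x = (h x * \1_(~` N) x)%R by rewrite /= mindicE indicE.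
have -> : sintegral mu h = sintegral mu h'.
  rewrite -!integralT_nnsfun; apply: ae_eq_integral => //.
  - exact/measurable_EFinP.
  - exact/measurable_EFinP.
  exists N; split => // x /= hx; apply: contrapT => Nx; apply: hx => _.
  apply: (congr1 EFin); apply/esym/(etrans (h'E x)).
  by rewrite indicE mem_set// mulr1.
apply: ereal_sup_ubound; exists h' => //= x.
apply: (@le_trans _ _ (h x * \1_(~` N) x)%:E).
  by rewrite lee_fin le_eqVlt; apply/orP; left; apply/eqP; exact: h'E.
rewrite indicE.
have [Nx|/negP] := boolP (x \in ~` N); last by rewrite mulr0 => _; exact: g0.
rewrite mulr1; apply: (le_trans (hf x)); move: Nx; rewrite inE => Nx.
by apply: contrapT => nfg; exact/Nx/fgN.
Qed.

(** Applied to the gradient of [Bren], of which one knows only that it agrees almost everywhere with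
    a measurable map. *)
Lemma ae_integralT (f g : X -> \bar R) :
  {ae mu, forall x, f x = g x} -> \int[mu]_x f x = \int[mu]_x g x.
Proof.
move=> fg; rewrite integralE [RHS]integralE; congr (_ - _); apply/eqP; rewrite eq_le;
  by apply/andP; split; apply: ge0_ae_le_integralT => //;
  apply: filterS fg => x fgx; rewrite ?funeposE ?funenegE fgx.
Qed.

Lemma ae_integral (D : set X) (f g : X -> \bar R) :
  {ae mu, forall x, D x -> f x = g x} ->
  \int[mu]_(x in D) f x = \int[mu]_(x in D) g x.
Proof.
move=> fg; rewrite integral_mkcond [RHS]integral_mkcond.
apply: ae_integralT; apply: filterS fg => x fg.
by rewrite !patchE; case: ifPn => //; rewrite inE.
Qed.

Lemma ae_Rintegral (D : set X) (f g : X -> R) :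
  {ae mu, forall x, D x -> f x = g x} ->
  (\int[mu]_(x in D) f x = \int[mu]_(x in D) g x)%R.
Proof.
move=> fg; rewrite /Rintegral; congr fine; apply: ae_integral.
by apply: filterS fg => x /[apply] ->.
Qed.

Lemma integral_mrestr (D : set X) (mD : measurable D) (f : X -> \bar R) :
  measurable_fun setT f -> (forall x, 0 <= f x) ->
  \int[mrestr mu mD]_x f x = \int[mu]_(x in D) f x.
Proof.
move=> mf f0; rewrite (@ge0_negligible_integral _ _ _ _ setT (~` D))//.
- rewrite setTD setCK; apply: eq_measure_integral => A mA AD.
  by rewrite /= /mrestr (setIidl AD).
- exact: measurableC.
- by rewrite /= /mrestr setICl measure0.
Qed.

End ae_integral.

Section law.
Context d (X : measurableType d) d' (Y : measurableType d') (R : realType).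
Variable mu : {measure set X -> \bar R}.
Variables (D : set X) (mD : measurable D).
Local Open Scope ereal_scope.

Lemma law_ge0_integral (g : X -> Y) (nu : {measure set Y -> \bar R})
    (f : Y -> \bar R) :
  measurable_fun setT g ->
  (forall B, measurable B -> nu B = mu (D `&` g @^-1` B)) ->
  measurable_fun setT f -> (forall y, 0 <= f y) ->
  \int[nu]_y f y = \int[mu]_(x in D) f (g x).
Proof.
move=> mg nuE mf f0.
rewrite -(@integral_mrestr _ _ _ mu _ mD (f \o g)); last 2 first.
- exact: (measurableT_comp mf mg).
- by move=> x; exact: f0.
have := ge0_integral_pushforward mg (mrestr mu mD) measurableT mf
  (fun y _ => f0 y).
rewrite preimage_setT => <-.
apply: eq_measure_integral => A mA _.
by rewrite nuE// /pushforward /= /mrestr setIC.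
Qed.

(** The positive and negative parts are transported separately, so that both sides agree even when
    the integral is infinite or undefined. *)
Lemma law_Rintegral (g : X -> Y) (nu : {measure set Y -> \bar R})
    (f : Y -> R) :
  measurable_fun setT g ->
  (forall B, measurable B -> nu B = mu (D `&` g @^-1` B)) ->
  measurable_fun setT f ->
  (\int[nu]_y f y = \int[mu]_(x in D) f (g x))%R.
Proof.
move=> mg nuE mf; rewrite /Rintegral; congr fine.
rewrite integralE [RHS]integralE.
have mfE : measurable_fun setT (EFin \o f) by exact/measurable_EFinP.
have mfp : measurable_fun setT (EFin \o f)^\+ by exact: measurable_funepos.
have mfn : measurable_fun setT (EFin \o f)^\- by exact: measurable_funeneg.
congr (_ - _); rewrite (law_ge0_integral mg nuE)//;
  by apply: eq_integral => x _; rewrite ?funeposE ?funenegE.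
Qed.

End law.

(** * Bounded measurable functions *)

Section bounded_measurable.
Context d (X : measurableType d) (R : realType).
Variable mu : {measure set X -> \bar R}.
Variables (D : set X) (mD : measurable D) (Dfin : (mu D < +oo)%E).
Implicit Types f g : X -> R.

(** On a set of finite measure this class is integrable and closed under products, so every
    integrability condition reduces to membership in it. *)
Definition bmeas f :=
  measurable_fun D f /\ exists C, forall x, D x -> `|f x| <= C.

Lemma bmeas_integrable f : bmeas f -> mu.-integrable D (EFin \o f).
Proof.
move=> [mf [C fC]]; apply: measurable_bounded_integrable => //.
exists C; split; first exact: num_real.
by move=> M CM x Dx; apply: (le_trans (fC _ Dx)); exact: ltW.
Qed.

Lemma bmeas_cst (c : R) : bmeas (fun=> c).
Proof. by split; [exact: measurable_cst|exists `|c|]. Qed.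

Lemma bmeasD f g : bmeas f -> bmeas g -> bmeas (fun x => f x + g x).
Proof.
move=> [mf [C fC]] [mg [C' gC]]; split; first exact: measurable_funD.
exists (C + C') => x Dx; apply: (le_trans (ler_normD _ _)).
by apply: lerD; [exact: fC|exact: gC].
Qed.

Lemma bmeasM f g : bmeas f -> bmeas g -> bmeas (fun x => f x * g x).
Proof.
move=> [mf [C fC]] [mg [C' gC]]; split; first exact: measurable_funM.
exists (C * C') => x Dx; rewrite normrM.
by apply: ler_pM => //; [exact: fC|exact: gC].
Qed.

Lemma bmeasZ (c : R) f : bmeas f -> bmeas (fun x => c * f x).
Proof. by apply: bmeasM; exact: bmeas_cst. Qed.

Lemma bmeasN f : bmeas f -> bmeas (fun x => - f x).
Proof.
move=> bf; have := bmeasZ (-1) bf.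
by congr bmeas; apply/funext => x; rewrite mulN1r.
Qed.

Lemma bmeasB f g : bmeas f -> bmeas g -> bmeas (fun x => f x - g x).
Proof. by move=> bf bg; apply: bmeasD => //; exact: bmeasN. Qed.

Lemma bmeas_norm f : bmeas f -> bmeas (fun x => `|f x|).
Proof.
move=> [mf [C fC]]; split.
  exact: (measurableT_comp (@normr_measurable R setT) mf).
by exists C => x Dx; rewrite normr_id; exact: fC.
Qed.

Lemma bmeas_sum (n : nat) (F : 'I_n -> X -> R) :
  (forall i, bmeas (F i)) -> bmeas (fun x => \sum_(i < n) F i x).
Proof.
elim: n F => [|n IH] F bF.
  by rewrite (_ : (fun _ => _) = fun=> 0);
    [exact: bmeas_cst|apply/funext => x; rewrite big_ord0].
rewrite (_ : (fun _ => _) =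
    fun x => \sum_(i < n) F (widen_ord (leqnSn n) i) x + F ord_max x).
  by apply: bmeasD => //; exact: IH.
by apply/funext => x; rewrite big_ord_recr.
Qed.

Lemma bmeas_intD f g : bmeas f -> bmeas g ->
  \int[mu]_(x in D) (f x + g x) =
  \int[mu]_(x in D) f x + \int[mu]_(x in D) g x.
Proof. by move=> bf bg; rewrite RintegralD//; exact: bmeas_integrable. Qed.

Lemma bmeas_intB f g : bmeas f -> bmeas g ->
  \int[mu]_(x in D) (f x - g x) =
  \int[mu]_(x in D) f x - \int[mu]_(x in D) g x.
Proof. by move=> bf bg; rewrite RintegralB//; exact: bmeas_integrable. Qed.

Lemma bmeas_intZ (c : R) f : bmeas f ->
  \int[mu]_(x in D) (c * f x) = c * \int[mu]_(x in D) f x.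
Proof. by move=> bf; rewrite RintegralZl//; exact: bmeas_integrable. Qed.

Lemma bmeas_int_sum (n : nat) (F : 'I_n -> X -> R) :
  (forall i, bmeas (F i)) ->
  \int[mu]_(x in D) (\sum_(i < n) F i x) =
  \sum_(i < n) \int[mu]_(x in D) F i x.
Proof.
elim: n F => [|n IH] F bF.
  rewrite big_ord0 (_ : (fun _ => _) = fun=> 0).
    by rewrite Rintegral_cst// mul0r.
  by apply/funext => x; rewrite big_ord0.
rewrite big_ord_recr /= -IH// -bmeas_intD//; last exact: bmeas_sum.
by congr Rintegral; apply/funext => x; rewrite big_ord_recr.
Qed.

Lemma bmeas_int_ae_le f g : bmeas f -> bmeas g ->
  {ae mu, forall x, D x -> f x <= g x} ->
  \int[mu]_(x in D) f x <= \int[mu]_(x in D) g x.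
Proof.
move=> bf bg fg; rewrite -subr_ge0 -bmeas_intB//.
(* The difference is nonnegative only almost everywhere; its absolute value is so everywhere and has
   the same integral. *)
rewrite (@ae_Rintegral _ _ _ mu D _ (fun x => `|g x - f x|)).
  by apply: Rintegral_ge0 => x _; exact: normr_ge0.
by apply: filterS fg => x fg Dx; rewrite ger0_norm// subr_ge0 fg.
Qed.

Lemma bmeas_int_le f g : bmeas f -> bmeas g ->
  (forall x, D x -> f x <= g x) ->
  \int[mu]_(x in D) f x <= \int[mu]_(x in D) g x.
Proof. by move=> bf bg fg; apply: bmeas_int_ae_le => //; exact: aeW. Qed.

Lemma bmeas_int_norm f : bmeas f ->
  `|\int[mu]_(x in D) f x| <= \int[mu]_(x in D) `|f x|.
Proof. by move=> bf; apply: le_normr_Rintegral => //; exact: bmeas_integrable. Qed.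

Lemma bmeas_int_dist f g h : bmeas f -> bmeas g -> bmeas h ->
  {ae mu, forall x, D x -> `|f x - g x| <= h x} ->
  `|\int[mu]_(x in D) f x - \int[mu]_(x in D) g x| <= \int[mu]_(x in D) h x.
Proof.
move=> bf bg bh fgh; rewrite -bmeas_intB//.
apply: (le_trans (bmeas_int_norm _)); first exact: bmeasB.
by apply: bmeas_int_ae_le => //; apply: bmeas_norm; exact: bmeasB.
Qed.

Lemma bmeas_int_eq0 f : bmeas f ->
  {ae mu, forall x, D x -> 0 <= f x} ->
  \int[mu]_(x in D) f x <= 0 -> {ae mu, forall x, D x -> f x = 0}.
Proof.
move=> bf f0 If.
have [mf _] := bf.
have mfE : measurable_fun D (EFin \o f) by exact/measurable_EFinP.
have /integrableP[_ fi] := bmeas_integrable bf.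
have : (\int[mu]_(x in D) `|(EFin \o f) x|)%E = 0%E.
  have fin : (\int[mu]_(x in D) `|(EFin \o f) x|)%E \is a fin_num.
    by rewrite ge0_fin_numE// integral_ge0.
  rewrite -(fineK fin); congr EFin; apply/eqP; rewrite eq_le fine_ge0 ?integral_ge0// andbT.
  rewrite -[leLHS]/(\int[mu]_(x in D) `|f x|).
  rewrite (@ae_Rintegral _ _ _ mu D _ f)//.
  by apply: filterS f0 => x f0 Dx; rewrite ger0_norm// f0.
move=> /(ae_eq_integral_abs mu mD mfE).
by apply: filterS => x /[apply] -[].
Qed.

Lemma bmeas_int_cvg (F : nat -> X -> R) f (C : R) :
  (forall n, bmeas (F n)) -> measurable_fun D f ->
  (forall n x, D x -> `|F n x| <= C) ->
  {ae mu, forall x, D x -> F n x @[n --> \oo] --> f x} ->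
  \int[mu]_(x in D) F n x @[n --> \oo] --> \int[mu]_(x in D) f x.
Proof.
move=> bF mf FC Ff.
have [] := @dominated_convergence _ _ _ mu D mD (fun n x => (F n x)%:E)
  (EFin \o f) (fun=> C%:E).
- by move=> n; apply/measurable_EFinP; case: (bF n).
- exact/measurable_EFinP.
- apply: filterS Ff => x Ff Dx; apply/fine_cvgP; split; last exact: Ff.
  exact: nearW.
- exact: (bmeas_integrable (bmeas_cst C)).
- by apply: aeW => x n Dx; rewrite /= lee_fin FC.
move=> fi _ cv.
apply: fine_cvg; rewrite fineK; first exact: cv.
exact: integrable_fin_num.
Qed.

End bounded_measurable.

(** * Three-dimensional space and ultralimits *)

Section space.
Variable R : realType.
Implicit Types x y z : pt R.

(** The l^1 norm is dual to the sup-norm balls [boxed] (see [dot_le]) and, being a sum over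
    coordinates, leaves most estimates to linear arithmetic. *)
Definition n1 x : R := `|x.1.1| + `|x.1.2| + `|x.2|.

Definition dot x y : R := x.1.1 * y.1.1 + x.1.2 * y.1.2 + x.2 * y.2.

Definition boxed (r : R) x := [/\ `|x.1.1| <= r, `|x.1.2| <= r & `|x.2| <= r].

Lemma n1_ge0 x : 0 <= n1 x.
Proof. by rewrite !addr_ge0. Qed.

Lemma n1_sym x y : n1 (x - y) = n1 (y - x).
Proof. by rewrite /n1 /= distrC (distrC x.1.2) (distrC x.2). Qed.

Lemma n1_triangle x y z : n1 (x - z) <= n1 (x - y) + n1 (y - z).
Proof.
rewrite /n1 /=.
have := ler_distD y.1.1 x.1.1 z.1.1.
have := ler_distD y.1.2 x.1.2 z.1.2.
have := ler_distD y.2 x.2 z.2.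
lra.
Qed.

Lemma n1_subrr x : n1 (x - x) = 0.
Proof. by rewrite /n1 subrr /= normr0 !addr0. Qed.

Lemma n1_eq0 x y : n1 (x - y) = 0 -> x = y.
Proof.
rewrite /n1 /= => h.
have h1 := normr_ge0 (x.1.1 - y.1.1).
have h2 := normr_ge0 (x.1.2 - y.1.2).
have h3 := normr_ge0 (x.2 - y.2).
have e1 : `|x.1.1 - y.1.1| = 0 by lra.
have e2 : `|x.1.2 - y.1.2| = 0 by lra.
have e3 : `|x.2 - y.2| = 0 by lra.
move: x y {h h1 h2 h3} e1 e2 e3 => [[x1 x2] x3] [[y1 y2] y3] /=.
by do 3 move=> /normr0_eq0/subr0_eq ->.
Qed.

Lemma n1Z (t : R) x : n1 (t *: x) = `|t| * n1 x.
Proof.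
rewrite /n1 -[(t *: x).1.1]/(t * x.1.1) -[(t *: x).1.2]/(t * x.1.2).
by rewrite -[(t *: x).2]/(t * x.2) !normrM !mulrDr.
Qed.

Lemma boxed_ge0 r x : boxed r x -> 0 <= r.
Proof. by case=> h _ _; exact: le_trans h. Qed.

Lemma boxed_n1 r x : boxed r x -> n1 x <= 3 * r.
Proof. by rewrite /n1 => -[]; lra. Qed.

Lemma boxed_n1B r x y : boxed r x -> boxed r y -> n1 (x - y) <= 6 * r.
Proof.
rewrite /n1 /= => -[x1 x2 x3] [y1 y2 y3].
have := ler_normB x.1.1 y.1.1.
have := ler_normB x.1.2 y.1.2.
have := ler_normB x.2 y.2.
lra.
Qed.

Lemma dotC x y : dot x y = dot y x.
Proof. by rewrite /dot; ring. Qed.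

Lemma dotBr x y z : dot x (y - z) = dot x y - dot x z.
Proof. by rewrite /dot /=; ring. Qed.

Lemma dotBl x y z : dot (x - y) z = dot x z - dot y z.
Proof. by rewrite /dot /=; ring. Qed.

Lemma dotDr x y z : dot x (y + z) = dot x y + dot x z.
Proof. by rewrite /dot /=; ring. Qed.

Lemma dotNr x y : dot x (- y) = - dot x y.
Proof. by rewrite /dot /=; ring. Qed.

Lemma dot0r x : dot x 0 = 0.
Proof. by rewrite /dot /= !mulr0 !addr0. Qed.

Lemma boxed_self x : boxed (n1 x) x.
Proof.
by split; rewrite /n1; [rewrite -addrA lerDl|rewrite addrAC lerDr|rewrite lerDr];
  exact: addr_ge0.
Qed.

Lemma dotZr (t : R) x y : dot x (t *: y) = t * dot x y.
Proof.
rewrite /dot -[(t *: y).1.1]/(t * y.1.1) -[(t *: y).1.2]/(t * y.1.2).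
by rewrite -[(t *: y).2]/(t * y.2); ring.
Qed.

Lemma dot_le r x y : boxed r x -> `|dot x y| <= r * n1 y.
Proof.
move=> [x1 x2 x3]; rewrite /dot /n1 !mulrDr.
apply: (le_trans (ler_normD _ _)); apply: lerD; last first.
  by rewrite normrM ler_wpM2r.
by apply: (le_trans (ler_normD _ _)); apply: lerD; rewrite normrM ler_wpM2r.
Qed.

Lemma sqdE x y : sqd x y = dot x x + dot y y - 2 * dot x y.
Proof. by rewrite /sqd /dot; ring. Qed.

Lemma near_n1 x (e : R) : 0 < e -> \forall y \near x, n1 (x - y) < e.
Proof.
move=> e0; apply/nbhs_ballP; exists (e / 3); first by rewrite /= divr_gt0.
move=> y [[]] /=; rewrite /ball /= => h1 h2 h3.
by rewrite /n1 /=; lra.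
Qed.

Lemma n1_nbhs x (A : set (pt R)) : nbhs x A ->
  exists2 e : R, 0 < e & forall y, n1 (x - y) < e -> A y.
Proof.
move=> /nbhs_ballP[e /= e0 eA]; exists e => // y xy; apply: eA.
move: xy; rewrite /n1 /= => xy.
have h1 := normr_ge0 (x.1.1 - y.1.1).
have h2 := normr_ge0 (x.1.2 - y.1.2).
have h3 := normr_ge0 (x.2 - y.2).
by split; [split|]; rewrite /ball /=; lra.
Qed.

Definition lip (M : R) (f : pt R -> R) :=
  forall x y, `|f x - f y| <= M * n1 (x - y).

Lemma lip_ge0 M f : lip M f -> 0 <= M.
Proof.
move=> /(_ ((1,0),0) 0); rewrite /n1 /= !subr0 !normr0 normr1 !addr0 mulr1.
exact: le_trans.
Qed.

Lemma lip_continuous M f : lip M f -> continuous f.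
Proof.
move=> fM x; have M0 := lip_ge0 fM.
apply/cvgrPdist_lt => e e0.
have d0 : 0 < e / (M + 1) by rewrite divr_gt0// ltr_wpDl.
apply: filterS (near_n1 x d0) => y xy; apply: (le_lt_trans (fM x y)).
move: xy; rewrite ltr_pdivlMr ?ltr_wpDl//.
by have := n1_ge0 (x - y); lra.
Qed.

Lemma ratball_measurable (q : rat * rat * rat) (k : nat) :
  measurable [set x : pt R | [/\ `|x.1.1 - ratr q.1.1| < k.+1%:R^-1,
    `|x.1.2 - ratr q.1.2| < k.+1%:R^-1 & `|x.2 - ratr q.2| < k.+1%:R^-1]].
Proof.
rewrite (_ : [set x | _] = (ball (ratr q.1.1 : R) k.+1%:R^-1 `*`
    ball (ratr q.1.2 : R) k.+1%:R^-1) `*` ball (ratr q.2 : R) k.+1%:R^-1).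
  by apply: measurableX; [apply: measurableX|]; exact: measurable_ball.
apply/seteqP; split => -[[a b] c]; rewrite /ball /= => -[].
  by rewrite distrC (distrC _ (ratr q.1.2)) (distrC _ (ratr q.2)).
by move=> [h1 h2] h3; rewrite distrC (distrC b) (distrC c).
Qed.

(** Boxes with rational centre and radius [k.+1%:R^-1] form a countable base made of measurable
    rectangles. *)
Lemma open_pt_measurable (A : set (pt R)) : open A -> measurable A.
Proof.
move=> oA.
pose B (i : rat * rat * rat * nat) := [set x : pt R |
  [/\ `|x.1.1 - ratr i.1.1.1| < i.2.+1%:R^-1,
      `|x.1.2 - ratr i.1.1.2| < i.2.+1%:R^-1
    & `|x.2 - ratr i.1.2| < i.2.+1%:R^-1]].
pose C i := if `[< B i `<=` A >] then B i else set0.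
have -> : A = \bigcup_i C i.
  apply/seteqP; split => [x Ax|x [i _]]; last first.
    by rewrite /C; case: asboolP => // h /h.
  have [e e0 eA] := n1_nbhs (open_nbhs_nbhs (conj oA Ax)).
  pose k := Num.truncn (6 / e).
  have k0 : 0 < k.+1%:R^-1 :> R by rewrite invr_gt0.
  (* Three coordinates, each compared through the rational centre at the cost of two radii. *)
  have ke : k.+1%:R^-1 < e / 6.
    by rewrite -[e / 6]invrK invf_div ltf_pV2 ?posrE ?divr_gt0// truncnS_gt.
  have app (u : R) : exists q : rat, `|u - ratr q| < k.+1%:R^-1.
    have : u - k.+1%:R^-1 < u + k.+1%:R^-1.
      by rewrite ltrD2l (lt_trans _ k0)// oppr_lt0.
    move=> /rat_in_itvoo[q]; rewrite in_itv /= => /andP[h1 h2].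
    exists q; rewrite ltr_norml; apply/andP; split.
      by move: (k.+1%:R^-1) h1 h2 => v; lra.
    by move: (k.+1%:R^-1) h1 h2 => v; lra.
  have [q1 h1] := app x.1.1; have [q2 h2] := app x.1.2; have [q3 h3] := app x.2.
  exists (q1, q2, q3, k) => //; rewrite /C; case: asboolP => // nB.
  exfalso; apply: nB => y [/= y1 y2 y3]; apply: eA.
  rewrite /n1 /=.
  have := ler_distD (ratr q1) x.1.1 y.1.1.
  have := ler_distD (ratr q2) x.1.2 y.1.2.
  have := ler_distD (ratr q3) x.2 y.2.
  rewrite (distrC (ratr q1)) (distrC (ratr q2)) (distrC (ratr q3)).
  by move: h1 h2 h3 y1 y2 y3 ke; move: (k.+1%:R^-1) => v; lra.
apply: countable_bigcupT_measurable; first exact: countableP.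
by move=> i; rewrite /C; case: asboolP => // _; exact: ratball_measurable.
Qed.

Lemma closed_pt_measurable (A : set (pt R)) : closed A -> measurable A.
Proof.
by move=> cA; rewrite -[A]setCK; apply: measurableC;
  apply: open_pt_measurable; exact: closed_openC.
Qed.

Lemma continuous_pt_measurable (f : pt R -> R) :
  continuous f -> measurable_fun setT f.
Proof.
move=> /continuousP cf; apply: (measurability _ (RGenOpens.measurableE R)).
move=> _ [_ [a [b ->] <-]]; rewrite setTI; apply: open_pt_measurable.
by apply: cf; exact: interval_open.
Qed.

Lemma lip_measurable M f D : measurable D -> lip M f -> measurable_fun D f.
Proof.
move=> mD fM; apply: measurable_funTS => //.
exact: (continuous_pt_measurable (lip_continuous fM)).
Qed.

Lemma measurable_pt11 : measurable_fun setT (fun x : pt R => x.1.1).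
Proof. exact: (measurableT_comp measurable_fst measurable_fst). Qed.

Lemma measurable_pt12 : measurable_fun setT (fun x : pt R => x.1.2).
Proof. exact: (measurableT_comp measurable_snd measurable_fst). Qed.

Lemma measurable_pt2 : measurable_fun setT (fun x : pt R => x.2).
Proof. exact: measurable_snd. Qed.

Lemma measurable_boxed r : measurable [set x : pt R | boxed r x].
Proof.
rewrite (_ : [set x | _] = (`[- r, r] `*` `[- r, r]) `*` `[- r, r]).
  by apply: measurableX; [apply: measurableX|]; exact: measurable_itv.
apply/seteqP; split => -[[a b] c]; rewrite /boxed /= !in_itv /= -!ler_norml.
  by case.
by move=> [[]].
Qed.

Lemma compact_boxed r : compact [set x : pt R | boxed r x].
Proof.
rewrite (_ : [set x | _] = (`[- r, r] `*` `[- r, r]) `*` `[- r, r]).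
  by apply: compact_setX; [apply: compact_setX|]; exact: segment_compact.
apply/seteqP; split => -[[a b] c]; rewrite /boxed /= !in_itv /= -!ler_norml.
  by case.
by move=> [[]].
Qed.

Lemma net1 (r e : R) : 0 < e ->
  exists s : seq R, forall u, `|u| <= r -> exists2 v, v \in s & `|u - v| <= e.
Proof.
move=> e0; pose n := (Num.truncn (2 * r / e)).+1.
exists [seq - r + e * k%:R | k <- iota 0 n] => u ur.
have r0 : 0 <= r by exact: le_trans ur.
have u0 : 0 <= (u + r) / e.
  by rewrite divr_ge0 ?(ltW e0)//; move: ur; rewrite ler_norml => /andP[]; lra.
pose k := Num.truncn ((u + r) / e).
exists (- r + e * k%:R).
  apply/mapP; exists k => //; rewrite mem_iota add0n ltnS.
  apply: le_truncn; rewrite ler_pM2r ?invr_gt0//.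
  by move: ur; rewrite ler_norml => /andP[]; lra.
have /andP[] := truncn_itv u0; rewrite -/k ler_pdivlMr// ltr_pdivrMr// -natr1.
move=> h1 h2; rewrite ler_norml; apply/andP; split; lra.
Qed.

Lemma net3 (r e : R) : 0 < e ->
  exists s : seq (pt R), forall x, boxed r x ->
    exists2 y, y \in s & n1 (x - y) <= e.
Proof.
move=> e0; have [s sP] := net1 r (divr_gt0 e0 (ltr0Sn _ 2)).
exists [seq (p, c) | p <- [seq (a, b) | a <- s, b <- s], c <- s].
move=> x [/sP[a as_ xa] /sP[b bs xb] /sP[c cs xc]].
exists ((a, b), c); last by rewrite /n1 /=; lra.
by apply: allpairs_f => //; exact: allpairs_f.
Qed.

End space.

(** * Limits of bounded sequences along an ultrafilter *)

Section ultralimit.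
Variable R : realType.

Lemma exists_ultra : exists U : set_system nat, UltraFilter U /\ \oo `<=` U.
Proof. exact: ultraFilterLemma. Qed.

Variables (U : set_system nat) (UU : UltraFilter U) (Uoo : \oo `<=` U).

Definition ulim (u : nat -> R) : R := lim (u @ U).

(** The image of an ultrafilter on a compact segment clusters somewhere, and for an ultrafilter a
    cluster point is a limit. One [U] thus serves uncountably many points and times at once, with no
    diagonal extraction. *)
Lemma ulim_near (u : nat -> R) (B e : R) : (forall n, `|u n| <= B) -> 0 < e ->
  U [set n | `|u n - ulim u| <= e].
Proof.
move=> uB e0.
have [p [_ clp]] : `[- B, B] `&` cluster (u @ U) !=set0.
  have UT : U setT by exact: filterT.
  have uUB : (u @ U) (`[- B, B]%classic).
    change (U (u @^-1` `[- B, B]%classic)).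
    by apply: filterS UT => n _; rewrite /preimage /= in_itv /= -ler_norml uB.
  exact: (@segment_compact R (- B) B (u @ U) _ uUB).
have up : u @ U --> p.
  move=> A pA; have [//|UAC] := in_ultra_setVsetC (u @^-1` A) UU.
  have [y [/= yA yA']] := clp (~` A) A UAC pA.
  by [].
have -> : ulim u = p by exact: (cvg_lim _ up).
have /cvgrPdist_le/(_ _ e0) := up.
by apply: filterS => n /=; rewrite distrC.
Qed.

Lemma ultra_ge (k : nat) : U [set n | (k <= n)%N].
Proof. by apply: Uoo; exists k. Qed.

Lemma ultra_seq (T : eqType) (s : seq T) (P : T -> set nat) :
  (forall y, y \in s -> U (P y)) -> U [set n | forall y, y \in s -> P y n].
Proof.
elim: s => [|y s IH] Ps; first exact: (@filterS _ U _ setT _ _ filterT).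
have h1 : U (P y) by apply: Ps; exact: mem_head.
have h2 : U [set n | forall y, y \in s -> P y n].
  by apply: IH => z zs; apply: Ps; rewrite inE zs orbT.
apply: filterS2 h1 h2 => n /= Pn h z; rewrite inE => /predU1P[->//|].
exact: h.
Qed.

Lemma ultra_fin (T : finType) (P : T -> set nat) :
  (forall i, U (P i)) -> U [set n | forall i, P i n].
Proof.
move=> UP; have := @ultra_seq T (enum T) P (fun y _ => UP y).
by apply: filterS => n /= h i; apply: h; rewrite mem_enum.
Qed.

End ultralimit.

(** * Convex functions: directional derivatives *)

Section differentiability_criteria.
Variables (R : realType) (V W : normedModType R).

Lemma derivable_eps (f : V -> W) x v : derivable f x v ->
  forall e : R, 0 < e -> exists2 d, 0 < d & forall a, a != 0 -> `|a| < d ->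
    `|f (a *: v + x) - f x - a *: 'D_v f x| <= e * `|a|.
Proof.
move=> /derivableP df e e0; have {}df := @ex_derive _ _ _ _ _ _ _ df.
have /cvgrPdist_le/(_ _ e0) : (fun h => h^-1 *: ((f \o shift x) (h *: v) - f x)) @ 0^' --> 'D_v f x.
  exact: df.
rewrite near_withinE => /nbhs_ballP[d /= d0 dP].
exists d => // a a0 ad; have := dP a.
rewrite /ball /= sub0r normrN => /(_ ad a0) h.
rewrite -[f _ - f x](scalerKV a0) -scalerBr normrZ mulrC ler_wpM2r//.
by rewrite distrC.
Qed.

Lemma derivable_epsI (f : V -> W) x v l :
  (forall e : R, 0 < e -> exists2 d, 0 < d & forall a, a != 0 -> `|a| < d ->
    `|f (a *: v + x) - f x - a *: l| <= e * `|a|) ->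
  derivable f x v /\ 'D_v f x = l.
Proof.
move=> H.
suff cv : (fun h => h^-1 *: ((f \o shift x) (h *: v) - f x)) @ 0^' --> l.
  by split; [apply/cvg_ex; exists l|exact: (cvg_lim _ cv)].
apply/cvgrPdist_le => e e0; have [d d0 dP] := H e e0.
rewrite near_withinE; apply/nbhs_ballP; exists d => //= a.
rewrite /ball /= sub0r normrN => ad a0; have := dP a a0 ad.
rewrite -ler_pdivrMr ?normr_gt0// mulrC -normfV -normrZ scalerBr scalerK//.
by rewrite distrC.
Qed.

Lemma differentiable_epsI (f : V -> W) x (df : {linear V -> W}) :
  continuous df ->
  (forall e : R, 0 < e -> exists2 d, 0 < d & forall h, `|h| < d ->
    `|f (h + x) - f x - df h| <= e * `|h|) ->
  differentiable f x /\ 'd f x = df :> (V -> W).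
Proof.
move=> cdf H.
have E : f \o shift x = cst (f x) + df +o_ 0 id.
  apply/eqaddoP => e e0; have [d d0 dP] := H e e0.
  apply/nbhs_ballP; exists d => //= h; rewrite -ball_normE /= sub0r normrN => hd.
  by rewrite -[X in `|X|]/(f (h + x) - (f x + df h)) opprD addrA; exact: dP.
have dE := diff_unique cdf E.
by split => //; apply/diff_locallyP; rewrite dE; split.
Qed.

End differentiability_criteria.

Section linear_dot.
Variable R : realType.
Lemma dot_is_linear (p : pt R) : linear (dot p : pt R -> R).
Proof. by move=> t x y; rewrite dotDr dotZr. Qed.
HB.instance Definition _ (p : pt R) :=
  GRing.isLinear.Build R (pt R) R _ (dot p) (dot_is_linear p).
End linear_dot.

Lemma frac01 (R : realFieldType) (a b : R) :
  0 <= a -> 0 < b -> a <= b -> 0 <= a / b <= 1.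
Proof.
move=> a0 b0 ab; apply/andP; split; first by rewrite divr_ge0// ltW.
by rewrite ler_pdivrMr// mul1r.
Qed.

Lemma cvx3_sum_le (R : realFieldType) (A1 A2 A3 B C D1 D2 D3 a b c x y z e : R) :
  A1 <= C + 3 * a * D1 + e * (3 * x) ->
  A2 <= C + 3 * b * D2 + e * (3 * y) ->
  A3 <= C + 3 * c * D3 + e * (3 * z) ->
  B <= 3^-1 * (A1 + A2 + A3) ->
  B - C - (D1 * a + D2 * b + D3 * c) <= e * (x + y + z).
Proof. lra. Qed.

Lemma cvx_mid_le (R : realFieldType) (a b c d e : R) :
  2 * c <= a + b -> b - c - - d <= e -> - e <= a - c - d.
Proof. lra. Qed.

(** * One-sided derivatives of a convex function of one variable *)

Section convex_line.
Variables (R : realType) (g : R -> R).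
Hypothesis gc : forall a b t, 0 <= t <= 1 ->
  g (t * a + (1 - t) * b) <= t * g a + (1 - t) * g b.
Hypothesis g0 : g 0 = 0.

Lemma cvx_shrink t a : 0 <= t <= 1 -> g (t * a) <= t * g a.
Proof. by move=> /(@gc a 0); rewrite g0 !mulr0 !addr0. Qed.

Lemma cvx_slopes h k : 0 < h -> 0 < k -> - g (- k) / k <= g h / h.
Proof.
move=> h0 k0; rewrite ler_pdivrMr// mulrAC ler_pdivlMr//.
have hk0 : 0 < h + k by rewrite addr_gt0.
have t01 : 0 <= k / (h + k) <= 1.
  by apply: frac01 => //; lra.
have := @gc h (- k) _ t01.
have -> : k / (h + k) * h + (1 - k / (h + k)) * - k = 0.
  by field; rewrite gt_eqF.
have -> : k / (h + k) * g h + (1 - k / (h + k)) * g (- k) =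
    (k * g h + h * g (- k)) / (h + k) by field; rewrite gt_eqF.
rewrite g0.
rewrite ler_pdivlMr// mul0r; nra.
Qed.

Let Sp := [set g h / h | h in [set h | 0 < h]].
Let Sm := [set - g (- k) / k | k in [set k | 0 < k]].
(** The right derivative at 0, and below it the left one: slopes of a convex function are monotone,
    so extrema replace limits. *)
Definition dplus := inf Sp.
Definition dminus := sup Sm.

Let Sp_inf : has_inf Sp.
Proof.
split; first by exists (g 1 / 1); exists 1 => //=.
by exists (- g (- 1) / 1) => _ [h /= h0 <-]; exact: cvx_slopes.
Qed.

Let Sm_sup : has_sup Sm.
Proof.
split; first by exists (- g (- 1) / 1); exists 1 => //=.
by exists (g 1 / 1) => _ [h /= h0 <-]; exact: cvx_slopes.
Qed.

Lemma dplus_le h : 0 < h -> dplus * h <= g h.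
Proof.
move=> h0; rewrite -ler_pdivlMr//.
by apply: ge_inf; [case: Sp_inf|exists h].
Qed.

Lemma dminus_ge k : 0 < k -> - g (- k) <= dminus * k.
Proof.
move=> k0; rewrite -ler_pdivrMr//.
by apply: ub_le_sup; [case: Sm_sup|exists k].
Qed.

Lemma dminus_le_dplus : dminus <= dplus.
Proof.
apply: ge_sup; first by case: Sm_sup.
move=> _ [k /= k0 <-]; apply: lb_le_inf; first by case: Sp_inf.
by move=> _ [h /= h0 <-]; exact: cvx_slopes.
Qed.

Lemma subslope q h : dminus <= q -> q <= dplus -> q * h <= g h.
Proof.
move=> mq qp; have [h0|h0|->] := ltgtP h 0; last by rewrite mulr0 g0.
- have k0 : 0 < - h by rewrite oppr_gt0.
  have := dminus_ge k0; rewrite opprK; nra.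
- have := dplus_le h0; nra.
Qed.

Lemma slope_lim l e : dminus = l -> dplus = l -> 0 < e ->
  exists2 d, 0 < d & forall a, a != 0 -> `|a| < d -> `|g a - a * l| <= e * `|a|.
Proof.
move=> ml pl e0.
have [_ [h /= h0 <-] hl] := inf_adherent e0 Sp_inf.
have [_ [k /= k0 <-] kl] := sup_adherent e0 Sm_sup.
rewrite -/dplus pl in hl; rewrite -/dminus ml in kl.
rewrite ltr_pdivrMr// in hl; rewrite ltr_pdivlMr// in kl.
exists (Num.min h k); first by rewrite lt_min h0.
move=> a a0; rewrite lt_min => /andP[ah ak].
have := @subslope l a; rewrite ml pl lexx => /(_ isT isT) la.
rewrite ger0_norm ?subr_ge0 1?mulrC//.
have [apos|aneg|az] := ltgtP a 0; last by rewrite az eqxx in a0.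
- rewrite (ltr0_norm apos) in ak *.
  have t01 : 0 <= - a / k <= 1.
    by apply: frac01 => //; lra.
  have := @cvx_shrink (- a / k) (- k) t01.
  rewrite (_ : - a / k * - k = a); last by field; rewrite gt_eqF.
  move=> ga; have : g a * k <= - a * g (- k).
    by rewrite -ler_pdivlMr// mulrAC.
  nra.
- rewrite (gtr0_norm aneg) in ah *.
  have t01 : 0 <= a / h <= 1.
    by apply: frac01 => //; lra.
  have := @cvx_shrink (a / h) h t01.
  rewrite (_ : a / h * h = a); last by field; rewrite gt_eqF.
  move=> ga; have : g a * h <= a * g h.
    by rewrite -ler_pdivlMr// mulrAC.
  nra.
Qed.

End convex_line.

(** * From partial derivatives of a convex function to its gradient *)

Section convex_space.
Variable R : realType.
Implicit Types (f : pt R -> R) (x v p : pt R).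

Definition cvx f := forall x y (t : R), 0 <= t <= 1 ->
  f (t *: x + (1 - t) *: y) <= t * f x + (1 - t) * f y.

Lemma cvx_line f x v : cvx f -> forall (a b t : R), 0 <= t <= 1 ->
  (fun h => f (h *: v + x) - f x) (t * a + (1 - t) * b) <=
  t * (f (a *: v + x) - f x) + (1 - t) * (f (b *: v + x) - f x).
Proof.
move=> cf a b t t01 /=.
have := cf (a *: v + x) (b *: v + x) t t01.
rewrite (_ : _ + _ = (t * a + (1 - t) * b) *: v + x); first lra.
case: x v => [[x1 x2] x3] [[v1 v2] v3].
by congr (_, _, _); rewrite /= /GRing.scale /=; ring.
Qed.

(** A subgradient along one line. Asking the inequality for every [h] makes it a closed condition on
    [x], hence a measurable one. *)
Definition subslope_at f v x (q : R) :=
  forall h : R, q * h <= f (h *: v + x) - f x.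

Lemma derivable_subslope f x v : cvx f -> derivable f x v ->
  subslope_at f v x ('D_v f x).
Proof.
move=> cf df h; have [->|h0] := eqVneq h 0.
  by rewrite mulr0 scale0r add0r subrr.
apply/ler_addgt0Pr => e e0.
have nh : 0 < `|h| by rewrite normr_gt0.
have [d d0 dP] := derivable_eps df (divr_gt0 e0 nh).
have h20 : 0 < 2 * `|h| by rewrite mulr_gt0.
(* Convexity compares the increment along [h] with the one along [t * h], which is short enough for
   the derivative estimate; dividing by [t] concludes. *)
pose t := Num.min 1 (d / (2 * `|h|)).
have t0 : 0 < t by rewrite lt_min ltr01 divr_gt0.
have t1 : t <= 1 by rewrite ge_min lexx.
have td : t <= d / (2 * `|h|) by rewrite ge_min lexx orbT.
have := @cvx_shrink R (fun h => f (h *: v + x) - f x) (cvx_line x v cf).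
rewrite scale0r add0r subrr => /(_ erefl t h); rewrite (ltW t0) t1 => /(_ isT).
have th0 : t * h != 0 by rewrite mulf_neq0// gt_eqF.
have thd : `|t * h| < d.
  rewrite normrM (gtr0_norm t0).
  by move: td; rewrite ler_pdivlMr//; nra.
have := dP _ th0 thd; rewrite normrM (gtr0_norm t0) mulrCA divfK ?gt_eqF//.
rewrite ler_norml => /andP[+ _].
rewrite -[(t * h) *: 'D_v f x]/((t * h) * 'D_v f x).
set D := 'D_v f x; set A := f _; set B := f (h *: v + x).
move=> h1 h2; rewrite -(ler_pM2l t0); lra.
Qed.

Lemma subslope_derive f x v q : derivable f x v -> subslope_at f v x q ->
  q = 'D_v f x.
Proof.
move=> df sq; apply/eqP; rewrite eq_le; apply/andP; split.
- apply/ler_addgt0Pr => e e0; have [d d0 dP] := derivable_eps df e0.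
  have a0 : 0 < d / 2 by rewrite divr_gt0.
  have ad : `|d / 2| < d by rewrite gtr0_norm//; lra.
  have := dP (d / 2); rewrite gt_eqF// => /(_ isT ad).
  rewrite ler_norml => /andP[_]; have := sq (d / 2); rewrite (gtr0_norm a0).
  rewrite -[(d / 2) *: 'D_v f x]/((d / 2) * 'D_v f x) => h1 h2.
  rewrite -(ler_pM2l a0); lra.
- apply/ler_addgt0Pr => e e0; have [d d0 dP] := derivable_eps df e0.
  have a0 : 0 < d / 2 by rewrite divr_gt0.
  have ad : `|- (d / 2)| < d by rewrite normrN gtr0_norm//; lra.
  have := dP (- (d / 2)); rewrite oppr_eq0 gt_eqF// => /(_ isT ad).
  rewrite ler_norml => /andP[_]; have := sq (- (d / 2)).
  rewrite normrN (gtr0_norm a0).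
  rewrite -[(- (d / 2)) *: 'D_v f x]/((- (d / 2)) * 'D_v f x) => h1 h2.
  rewrite -(ler_pM2l a0); lra.
Qed.

(** Without a derivative the left one is strictly below the right one, and every number in between
    is a supporting slope. Rational slopes make the set of kinks a countable union. *)
Lemma nderivable_subslopes f x v : cvx f -> ~ derivable f x v ->
  exists q1 q2 : rat, [/\ q1 < q2, subslope_at f v x (ratr q1) &
    subslope_at f v x (ratr q2)].
Proof.
move=> cf ndf; pose g h := f (h *: v + x) - f x.
have gc := cvx_line x v cf; have g0 : g 0 = 0.
  by rewrite /g scale0r add0r subrr.
have : dminus g < dplus g.
  rewrite lt_neqAle (@dminus_le_dplus _ g gc g0) andbT; apply/eqP => E.
  apply: ndf; apply: (@derivable_epsI _ _ _ f x v (dplus g) _).1 => e e0.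
  by have [d d0 dP] := @slope_lim _ g gc g0 _ _ E erefl e0; exists d.
move=> /rat_in_itvoo[q1]; rewrite in_itv /= => /andP[mq1 q1p].
have [q2] := rat_in_itvoo q1p; rewrite in_itv /= => /andP[q12 q2p].
exists q1, q2; split; first by rewrite ltr_rat in q12.
- by move=> h; apply: (subslope gc g0); exact: ltW.
- by move=> h; apply: (subslope gc g0); [exact: ltW (lt_trans mq1 q12)|exact: ltW].
Qed.

Lemma cvx_mid f x y : cvx f -> 2 * f x <= f (y + x) + f (- y + x).
Proof.
move=> cf; have := cf (y + x) (- y + x) 2^-1.
rewrite (_ : _ *: _ + _ = x).
  by rewrite invr_ge0 invf_le1// ler1n ler0n => /(_ isT); lra.
case: x y => [[x1 x2] x3] [[y1 y2] y3].
by congr (_, _, _); rewrite /= /GRing.scale /=; lra.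
Qed.

Lemma cvx3 f x a b c : cvx f ->
  f (3^-1 *: (a + b + c) + x) <=
  3^-1 * (f (a + x) + f (b + x) + f (c + x)).
Proof.
move=> cf.
have t1 : 0 <= (3^-1 : R) <= 1 by apply/andP; split; lra.
have t2 : 0 <= (2^-1 : R) <= 1 by apply/andP; split; lra.
have := cf (a + x) (2^-1 *: (b + x) + (1 - 2^-1) *: (c + x)) _ t1.
have := cf (b + x) (c + x) _ t2.
set u := f (_ + _ *: (c + x)).
rewrite (_ : 3^-1 *: _ + _ = 3^-1 *: (a + b + c) + x); first lra.
case: a b c x {u} => [[a1 a2] a3] [[b1 b2] b3] [[c1 c2] c3] [[x1 x2] x3].
by congr (_, _, _); rewrite /= /GRing.scale /=; lra.
Qed.

Lemma pt_split x : x = x.1.1 *: e1 R + x.1.2 *: e2 R + x.2 *: e3 R.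
Proof.
case: x => [[a b] c]; rewrite /e1 /e2 /e3.
by congr (_, _, _); rewrite /= /GRing.scale /=; ring.
Qed.

Lemma norm_le_n1 x : `|x| <= n1 x.
Proof.
rewrite prod_normE prod_normE /n1 !ge_max; apply/andP; split.
  by apply/andP; split; rewrite -addrA ?lerDl ?addr_ge0//
    addrCA lerDl addr_ge0.
by rewrite lerDr addr_ge0.
Qed.

Lemma n1_le_norm x : n1 x <= 3 * `|x|.
Proof.
have : boxed `|x| x by rewrite prod_normE prod_normE; split;
  rewrite !le_max ?lexx ?orbT.
exact: boxed_n1.
Qed.

Definition der3 f x :=
  [/\ derivable f x (e1 R), derivable f x (e2 R) & derivable f x (e3 R)].

(** For convex functions partial derivatives suffice for differentiability. Jensen's inequality over
    the three points at [3 * h_i] on the axes gives the upper estimate; applied to [- h], together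
    with midpoint convexity, it gives the lower one. *)
Lemma der3_eps f x : cvx f -> der3 f x ->
  forall e : R, 0 < e -> exists2 d, 0 < d & forall h, n1 h < d ->
    `|f (h + x) - f x - dot (grad3 f x) h| <= e * n1 h.
Proof.
move=> cf [d1 d2 d3] e e0.
have [r1 r10 r1P] := derivable_eps d1 e0.
have [r2 r20 r2P] := derivable_eps d2 e0.
have [r3 r30 r3P] := derivable_eps d3 e0.
pose d := Num.min (r1 / 3) (Num.min (r2 / 3) (r3 / 3)).
have upper h : n1 h < d -> f (h + x) - f x - dot (grad3 f x) h <= e * n1 h.
  rewrite !lt_min => /and3P[h1 h2 h3].
  have a1 : `|h.1.1| <= n1 h by rewrite /n1 -addrA lerDl addr_ge0.
  have a2 : `|h.1.2| <= n1 h by rewrite /n1 addrAC lerDr addr_ge0.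
  have a3 : `|h.2| <= n1 h by rewrite /n1 lerDr addr_ge0.
  have ub v r (a : R) : (forall a, a != 0 -> `|a| < r ->
      `|f (a *: v + x) - f x - a *: 'D_v f x| <= e * `|a|) ->
      `|a| <= n1 h -> n1 h < r / 3 ->
      f ((3 * a) *: v + x) <= f x + 3 * a * 'D_v f x + e * (3 * `|a|).
    move=> rP ah hr; have [->|a0] := eqVneq a 0.
      by rewrite mulr0 scale0r add0r mul0r normr0 !mulr0 !addr0.
    have := rP (3 * a); rewrite mulf_neq0 ?pnatr_eq0// normrM normr_nat.
    move=> /(_ isT); rewrite ler_norml => H.
    have /H/andP[_] : 3 * `|a| < r.
      by rewrite mulrC -ltr_pdivlMr//; exact: (le_lt_trans ah hr).
    rewrite -[(3 * a) *: 'D_v f x]/((3 * a) * 'D_v f x).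
    by rewrite !lerBlDr [_ + f x]addrC [e * _ + _]addrC addrA.
  have n1h : n1 h = `|h.1.1| + `|h.1.2| + `|h.2| by [].
  have p1 := normr_ge0 h.1.1; have p2 := normr_ge0 h.1.2.
  have p3 := normr_ge0 h.2.
  have u1 := ub _ _ _ r1P a1 h1.
  have u2 := ub _ _ _ r2P a2 h2.
  have u3 := ub _ _ _ r3P a3 h3.
  have := cvx3 x ((3 * h.1.1) *: e1 R) ((3 * h.1.2) *: e2 R)
    ((3 * h.2) *: e3 R) cf.
  rewrite -!scalerA -!scalerDr scalerA mulVf ?pnatr_eq0// scale1r -pt_split.
  rewrite !scalerA n1h /dot /grad3 /=.
  exact: cvx3_sum_le u1 u2 u3.
exists d; first by rewrite !lt_min !divr_gt0.
move=> h hd; rewrite ler_norml upper// andbT.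
have n1N : n1 (- h) = n1 h by rewrite /n1 /= !normrN.
have := upper (- h); rewrite n1N => /(_ hd).
rewrite dotNr => Nh; exact: cvx_mid_le (cvx_mid x h cf) Nh.
Qed.

Lemma der3_subgrad f x : cvx f -> der3 f x ->
  forall y, f x + dot (grad3 f x) (y - x) <= f y.
Proof.
move=> cf df y; apply/ler_addgt0Pr => e e0.
have [yx|n0] := eqVneq (n1 (y - x)) 0.
  by rewrite (n1_eq0 yx) subrr dot0r addr0 lerDl ltW.
have {}n0 : 0 < n1 (y - x) by rewrite lt_neqAle eq_sym n0 n1_ge0.
have [d d0 dP] := der3_eps cf df (divr_gt0 e0 n0).
have n20 : 0 < 2 * n1 (y - x) by rewrite mulr_gt0.
pose t := Num.min 1 (d / (2 * n1 (y - x))).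
have t0 : 0 < t by rewrite lt_min ltr01 divr_gt0.
have t1 : t <= 1 by rewrite ge_min lexx.
have td : t <= d / (2 * n1 (y - x)) by rewrite ge_min lexx orbT.
have := dP (t *: (y - x)); rewrite n1Z (gtr0_norm t0) dotZr.
move=> /(_ _)/wrap[|]; first by move: td; rewrite ler_pdivlMr//; nra.
rewrite mulrCA divfK ?gt_eqF// ler_norml => /andP[+ _].
have := cf y x t; rewrite (ltW t0) t1 => /(_ isT).
rewrite (_ : t *: y + _ = t *: (y - x) + x); last first.
  by rewrite scalerBr scalerBl scale1r addrA addrAC.
set A := f (_ + x); set B := dot _ _ => h1 h2.
rewrite -(ler_pM2l t0); move: h1 h2; clear; lra.
Qed.

Lemma der3_differentiable f x : cvx f -> der3 f x -> differentiable f x.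
Proof.
move=> cf df.
have cd : continuous (dot (grad3 f x)).
  apply: (@lip_continuous _ (n1 (grad3 f x))) => y z; rewrite -dotBr.
  exact: dot_le (boxed_self _).
apply: (@differentiable_epsI _ _ _ f x (dot (grad3 f x)) cd _).1 => e e0.
have [d d0 dP] := der3_eps cf df (divr_gt0 e0 (ltr0Sn _ 2)).
exists (d / 3); first by rewrite divr_gt0.
move=> h hd; have hn := n1_le_norm h.
apply: (le_trans (dP h _)); first by move: hd hn; set n := `|h|; lra.
by rewrite mulrAC ler_pdivrMr// -mulrA ler_pM2l// mulrC.
Qed.

End convex_space.

(** * Almost everywhere differentiability of convex functions *)

Section null_sections.
Context d1 d2 (T1 : measurableType d1) (T2 : measurableType d2) (R : realType).
Variables (m1 : {sigma_finite_measure set T1 -> \bar R}).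
Variables (m2 : {sigma_finite_measure set T2 -> \bar R}).
Local Open Scope ereal_scope.

(** The product measure is by definition the integral of the [x]-sections. The version with
    [y]-sections goes through the uniqueness of the product measure, and there measurability
    enters. *)
Lemma prod_null_xsection (A : set (T1 * T2)) :
  (forall x, m2 (xsection A x) = 0) -> (m1 \x m2) A = 0.
Proof.
move=> A0; rewrite /product_measure1; apply: integral0_eq => x _ /=.
exact: A0.
Qed.

Lemma prod_null_ysection (A : set (T1 * T2)) : measurable A ->
  (forall y, m1 (ysection A y) = 0) -> (m1 \x m2) A = 0.
Proof.
move=> mA A0.
rewrite (@product_measure_unique _ _ _ _ _ m1 m2 (m1 \x^ m2)%E)//.
  rewrite /product_measure2; apply: integral0_eq => x _ /=; exact: A0.
by move=> B C mB mC; exact: product_measure2E.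
Qed.

End null_sections.

(** * Points of nondifferentiability: measurability and nullity *)

Section convex_gradient.
Variable R : realType.
Implicit Types (f : pt R -> R) (x v p : pt R).

Lemma leb1_subsingleton (B : set R) : (forall a b, B a -> B b -> a = b) ->
  leb1 B = 0%E.
Proof.
move=> Bs; have [[a Ba]|/set0P/negP/negPn/eqP ->] := pselect (B !=set0);
  last exact: measure0.
rewrite (_ : B = [set a]); first exact: lebesgue_measure_set1.
by apply/seteqP; split => [b Bb|b -> //]; exact: Bs.
Qed.

Definition leb2 : set (R * R) -> \bar R := (@leb1 R \x @leb1 R)%E.

HB.instance Definition _ := Measure.on leb2.

(* The library's canonical structure for sigma-finite products is shadowed by
   the one for product probabilities. *)
Lemma leb2_sigma_finite : sigma_finite setT leb2.
Proof.
exists (fun n => `[- n%:R, n%:R] `*` `[- n%:R, n%:R])%classic.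
  apply/seteqP; split => // -[a b] _.
  exists (Num.truncn (`|a| + `|b|)).+1 => //=.
  rewrite !in_itv /= -!ler_norml.
  have := truncnS_gt (`|a| + `|b|) => h.
  by split; apply: le_trans (ltW h); rewrite ?lerDl ?lerDr.
move=> n; split; first by apply: measurableX; exact: measurable_itv.
rewrite /leb2 product_measure1E//; try exact: measurable_itv.
have lt : (@leb1 R `[(- n%:R)%R, (n%:R)%R]%classic < +oo)%E.
  by rewrite /leb1 /= lebesgue_measure_itv /=; case: ifPn => _; rewrite ltry.
by rewrite lte_mul_pinfty// ge0_fin_numE.
Qed.

HB.instance Definition _ :=
  @Measure_isSigmaFinite.Build _ _ _ leb2 leb2_sigma_finite.

Lemma leb3E (A : set (pt R)) : leb3 R A = (leb2 \x @leb1 R)%E A.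
Proof. by []. Qed.

(** Fubini: each line of direction [e3] meets [A] in at most one point. The next two lemmas treat
    the other directions, where two coordinates must be exchanged. *)
Lemma leb3_line3 (A : set (pt R)) :
  (forall x h, A x -> A (h *: e3 R + x) -> h = 0) -> leb3 R A = 0%E.
Proof.
move=> As; rewrite leb3E.
apply: (@prod_null_xsection _ _ (R * R)%type R R leb2 (@leb1 R)).
move=> [a b].
apply: leb1_subsingleton => s t; rewrite /xsection /= !inE => As' At.
apply/eqP; rewrite eq_sym -subr_eq0; apply/eqP.
apply: (As _ _ As').
rewrite (_ : _ + _ = ((a, b), t))//.
by congr (_, _, _); rewrite /= /GRing.scale /=; ring.
Qed.

Lemma leb3_line2 (A : set (pt R)) : measurable A ->
  (forall x h, A x -> A (h *: e2 R + x) -> h = 0) -> leb3 R A = 0%E.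
Proof.
move=> mA As; rewrite leb3E.
apply: (@prod_null_ysection _ _ (R * R)%type R R leb2 (@leb1 R)) => // c.
apply: (@prod_null_xsection _ _ R R R (@leb1 R) (@leb1 R)) => a.
apply: leb1_subsingleton => s t.
rewrite /xsection /ysection /= !inE /= !inE => As' At.
apply/eqP; rewrite eq_sym -subr_eq0; apply/eqP.
apply: (As _ _ As').
rewrite (_ : _ + _ = ((a, t), c))//.
by congr (_, _, _); rewrite /= /GRing.scale /=; ring.
Qed.

Lemma leb3_line1 (A : set (pt R)) : measurable A ->
  (forall x h, A x -> A (h *: e1 R + x) -> h = 0) -> leb3 R A = 0%E.
Proof.
move=> mA As; rewrite leb3E.
apply: (@prod_null_ysection _ _ (R * R)%type R R leb2 (@leb1 R)) => // c.
apply: (@prod_null_ysection _ _ R R R (@leb1 R) (@leb1 R)) => [|b].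
  exact: measurable_ysection.
apply: leb1_subsingleton => s t.
rewrite /ysection /= !inE /= !inE => As' At.
apply/eqP; rewrite eq_sym -subr_eq0; apply/eqP.
apply: (As _ _ As').
rewrite (_ : _ + _ = ((t, b), c))//.
by congr (_, _, _); rewrite /= /GRing.scale /=; ring.
Qed.

(** Monotonicity of the subdifferential: between two distinct points of a line the increment would
    be at least that of slope [q2] and at most that of slope [q1], or the other way round for
    negative [h]. *)
Lemma subslopes_line f v (q1 q2 : R) x h : q1 < q2 ->
  subslope_at f v x q1 -> subslope_at f v x q2 ->
  subslope_at f v (h *: v + x) q1 -> subslope_at f v (h *: v + x) q2 -> h = 0.
Proof.
move=> q12 s1 s2 s3 s4.
have := s1 h; have := s2 h; have := s3 (- h); have := s4 (- h).
rewrite scaleNr addrA addNr add0r; move: (f _) (f x) => A B.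
by move: q12; clear => q12 h1 h2 h3 h4; nra.
Qed.

Lemma subslope_measurable M f v q : lip M f ->
  measurable [set x | subslope_at f v x q].
Proof.
move=> fM; apply: closed_pt_measurable.
have -> : [set x | subslope_at f v x q] =
    \bigcap_(h in setT) [set x | q * h <= f (h *: v + x) - f x].
  by apply/seteqP; split => [x sx h _|x sx h]; [exact: sx|exact: sx].
apply: closed_bigI => h _.
pose F x := f (h *: v + x) - f x.
suff /continuous_closedP/(_ [set r | q * h <= r]) : continuous F.
  by apply; exact: closed_ge.
apply: (@lip_continuous _ (2 * M)) => y z.
have := fM (h *: v + y) (h *: v + z); have := fM z y.
rewrite opprD addrACA subrr add0r (n1_sym z y) /F.
move: (f (_ + y)) (f y) (f (_ + z)) (f z) (n1 _) => A B C D n h2 h1.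
have -> : A - B - (C - D) = (A - C) + (D - B) by ring.
by rewrite mulr_natl mulr2n mulrDl; apply: (le_trans (ler_normD _ _)); exact: lerD.
Qed.

Definition nder f v := [set x | ~ derivable f x v].

Lemma nderE f v : cvx f -> nder f v =
  \bigcup_(q : rat * rat) (if q.1 < q.2 then
    [set x | subslope_at f v x (ratr q.1)] `&`
    [set x | subslope_at f v x (ratr q.2)] else set0).
Proof.
move=> cf; apply/seteqP; split => [x /(nderivable_subslopes cf)|x].
  by move=> [q1 [q2 [q12 s1 s2]]]; exists (q1, q2) => //=; rewrite q12.
move=> [[q1 q2] _ /=]; case: ifPn => // q12 [s1 s2] df.
have := subslope_derive df s1; rewrite -(subslope_derive df s2) => /eqP.
by rewrite fmorph_eq lt_eqF.
Qed.

Lemma nder_measurable M f v : cvx f -> lip M f -> measurable (nder f v).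
Proof.
move=> cf fM; rewrite nderE//.
apply: countable_bigcupT_measurable; first exact: countableP.
move=> q; case: ifPn => // _.
by apply: measurableI; exact: subslope_measurable fM.
Qed.

(** The kinks admitting two given rational slopes occur at most once on each line of direction [v];
    there are countably many pairs of slopes. *)
Lemma nder_null M f v : cvx f -> lip M f ->
  (forall A, measurable A -> (forall x h, A x -> A (h *: v + x) -> h = 0) ->
    leb3 R A = 0%E) ->
  leb3 R (nder f v) = 0%E.
Proof.
move=> cf fM null.
have mS q : measurable [set x | subslope_at f v x q].
  exact: subslope_measurable fM.
apply/negligibleP; first exact: nder_measurable fM.
pose F k := if (unpickle k : option (rat * rat)) is Some q then
  (if q.1 < q.2 then [set x | subslope_at f v x (ratr q.1)] `&`
    [set x | subslope_at f v x (ratr q.2)] else set0) else set0.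
have sub : nder f v `<=` \bigcup_k F k.
  rewrite (nderE v cf) => x [q _ qx].
  by exists (pickle q); [|rewrite /F pickleK; exact: qx].
apply: (negligibleS sub).
apply: negligible_bigcup => k; rewrite /F.
case: (unpickle k) => [[q1 q2]|]; last exact: negligible_set0.
case: ifPn => [q12|_]; last exact: negligible_set0.
apply/negligibleP; first exact: measurableI.
apply: null => [|x h [s1 s2] [s3 s4]]; first exact: measurableI.
by apply: (subslopes_line _ s1 s2 s3 s4); rewrite ltr_rat.
Qed.

Lemma ae_der3 M f : cvx f -> lip M f -> {ae leb3 R, forall x, der3 f x}.
Proof.
move=> cf fM.
have ae_der v : leb3 R (nder f v) = 0%E -> {ae leb3 R, forall x, derivable f x v}.
  move=> n0; exists (nder f v); split => //; exact: nder_measurable fM.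
have := ae_der _ (nder_null cf fM leb3_line1).
have := ae_der _ (nder_null cf fM leb3_line2).
have := ae_der _ (nder_null cf fM (fun A _ => @leb3_line3 A)).
by apply: filterS3 => x d3 d2 d1; split.
Qed.

(** This default value keeps [grad3] in the box of the Lipschitz constant at every point, kinks
    included. *)
Lemma nder_derive f x v : ~ derivable f x v -> 'D_v f x = 0.
Proof.
move=> nd; rewrite /derive; apply/xgetPN => l cl; apply: nd.
by apply/cvg_ex; exists l.
Qed.

Lemma derive_le M f x v : cvx f -> lip M f -> `|'D_v f x| <= M * n1 v.
Proof.
move=> cf fM; have M0 := lip_ge0 fM.
have [df|nd] := pselect (derivable f x v); last first.
  by rewrite nder_derive// normr0 mulr_ge0// n1_ge0.
have sl := derivable_subslope cf df.
have := sl 1; have := sl (-1).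
have := fM (1 *: v + x) x; have := fM ((-1) *: v + x) x.
rewrite !addrK !n1Z normrN normr1 mul1r.
move: (f _) (f _) (f _) (M * _) ('D_v f x) => A B C D E.
rewrite !ler_norml => /andP[h1 h2] /andP[h3 h4] h5 h6.
by apply/andP; split; move: h1 h2 h3 h4 h5 h6; clear; lra.
Qed.

Lemma n1_e1 : n1 (e1 R) = 1.
Proof. by rewrite /n1 /= normr1 normr0 !addr0. Qed.

Lemma n1_e2 : n1 (e2 R) = 1.
Proof. by rewrite /n1 /= normr1 normr0 addr0 add0r. Qed.

Lemma n1_e3 : n1 (e3 R) = 1.
Proof. by rewrite /n1 /= normr1 normr0 !add0r. Qed.

Lemma grad3_boxed M f x : cvx f -> lip M f -> boxed M (grad3 f x).
Proof.
move=> cf fM.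
have := derive_le x (e1 R) cf fM; have := derive_le x (e2 R) cf fM.
have := derive_le x (e3 R) cf fM.
by rewrite n1_e1 n1_e2 n1_e3 mulr1 => h3 h2 h1; exact: And3 h1 h2 h3.
Qed.

Lemma derive_measurable M f v : cvx f -> lip M f ->
  measurable_fun setT (fun x => 'D_v f x).
Proof.
move=> cf fM; have mN := nder_measurable v cf fM.
rewrite -(setUv (nder f v)); apply/measurable_funU => //.
  exact: measurableC.
split.
  have h : {in nder f v, cst (0 : R) =1 (fun x => 'D_v f x)}.
    by move=> x; rewrite inE => nd; rewrite nder_derive.
  by apply: (eq_measurable_fun _ h); exact: measurable_cst.
pose g n x := n.+1%:R * (f (n.+1%:R^-1 *: v + x) - f x).
apply: (@measurable_fun_cvg _ _ _ _ g) => [n|x /= /contrapT df].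
  apply: measurable_funTS; apply: measurable_funM; first exact: measurable_cst.
  apply: measurable_funB; last exact: (lip_measurable measurableT fM).
  apply: (@lip_measurable _ M _ _ measurableT) => y z.
  by have := fM (n.+1%:R^-1 *: v + y) (n.+1%:R^-1 *: v + z);
    rewrite opprD addrACA subrr add0r.
apply/cvgrPdist_le => e e0; have [d d0 dP] := derivable_eps df e0.
near=> n.
have n0 : n.+1%:R^-1 != 0 :> R by rewrite invr_eq0 pnatr_eq0.
have nd : `|n.+1%:R^-1| < d :> R.
  by rewrite gtr0_norm//; near: n; exact: near_infty_natSinv_lt (PosNum d0).
rewrite distrC; have := dP _ n0 nd; rewrite /g.
set A := f _ - f x; set D := 'D_v f x.
rewrite -[_ *: D]/(n.+1%:R^-1 * D) [`|_^-1|]gtr0_norm//.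
have -> : A - n.+1%:R^-1 * D = (n.+1%:R * A - D) / n.+1%:R.
  by field; rewrite addrC natr1 pnatr_eq0.
by rewrite normrM [`|_^-1|]gtr0_norm// ler_pM2r// invr_gt0.
Unshelve. all: by end_near. Qed.

Lemma grad3_measurable M f : cvx f -> lip M f ->
  measurable_fun setT (grad3 f).
Proof.
move=> cf fM; apply: measurable_fun_pair.
  by apply: measurable_fun_pair; exact: derive_measurable cf fM.
exact: derive_measurable cf fM.
Qed.

End convex_gradient.

(** * Potentials, duality gap and compactness *)

(** Shrinking [h] by convexity. It is needed because the conjugate, a supremum over [Om], only
    compares [x] with points of [Om]. *)
Lemma local_subslope (R : realType) (f : pt R -> R) v x (q r : R) :
  cvx f -> 0 < r ->
  (forall h, `|h| < r -> q * h <= f (h *: v + x) - f x) ->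
  subslope_at f v x q.
Proof.
move=> cf r0 H h; have [->|h0] := eqVneq h 0.
  by rewrite mulr0 scale0r add0r subrr.
have nh : 0 < `|h| by rewrite normr_gt0.
have h20 : 0 < 2 * `|h| by rewrite mulr_gt0.
pose t := Num.min 1 (r / (2 * `|h|)).
have t0 : 0 < t by rewrite lt_min ltr01 divr_gt0.
have t1 : t <= 1 by rewrite ge_min lexx.
have td : t <= r / (2 * `|h|) by rewrite ge_min lexx orbT.
have := @cvx_shrink R (fun h => f (h *: v + x) - f x) (cvx_line x v cf).
rewrite scale0r add0r subrr => /(_ erefl t h); rewrite (ltW t0) t1 => /(_ isT).
have thd : `|t * h| < r.
  rewrite normrM (gtr0_norm t0).
  by move: td; rewrite ler_pdivlMr//; nra.
move: (H _ thd) => /le_trans /[apply].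
by rewrite mulrCA ler_pM2l.
Qed.

(** The difference quotients of step [a] differ from [D] by [e / 6], and moving two values by
    [a * (e / 12)] moves a quotient by another [e / 6]. *)
Lemma slope_close (R : realType) (a e D D' p0 p1 p2 q0 q1 q2 : R) : 0 < a ->
  `|p1 - p0 - a * D| <= e / 6 * a -> `|p2 - p0 - (- a) * D| <= e / 6 * a ->
  D' * a <= q1 - q0 -> D' * - a <= q2 - q0 ->
  `|q0 - p0| <= a * (e / 12) -> `|q1 - p1| <= a * (e / 12) ->
  `|q2 - p2| <= a * (e / 12) -> `|D - D'| <= e / 3.
Proof.
move=> a0; rewrite !ler_norml => /andP[? ?] /andP[? ?] ? ? /andP[? ?] /andP[? ?] /andP[? ?].
by apply/andP; split; rewrite -(ler_pM2l a0); lra.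
Qed.

Lemma quarters_le (R : realFieldType) (e : R) : 0 < e -> e / 4 + e / 4 <= e.
Proof. by move=> e0; lra. Qed.

Lemma thirds (R : realFieldType) (e : R) : e / 3 + (e / 3 + e / 3) = e.
Proof. by field. Qed.

Section stability.
Variables (R : realType) (Om : set (pt R)) (rho : R).
Hypothesis oOm : open Om.
Hypothesis bOm : forall x, Om x -> boxed rho x.
Hypothesis Om1 : leb3 R Om = 1%E.
Implicit Types (f phi psi : pt R -> R) (x y v : pt R) (T : pt R -> pt R).

Let mOm : measurable Om. Proof. exact: open_pt_measurable. Qed.
Let Omfin : (leb3 R Om < +oo)%E. Proof. by rewrite Om1 ltry. Qed.

Definition IO f : R := \int[leb3 R]_(x in Om) f x.

Lemma Om_nonempty : exists x, Om x.
Proof.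
apply: contrapT => H.
have E : Om = set0.
  by apply/seteqP; split => // x Ox; apply: H; exists x.
by move: Om1; rewrite E measure0 => /eqP; rewrite eq_sym onee_eq0.
Qed.

Lemma rho_ge0 : 0 <= rho.
Proof. by have [x /bOm/boxed_ge0] := Om_nonempty. Qed.

Lemma IO_cst (c : R) : IO (fun=> c) = c.
Proof. by rewrite /IO Rintegral_cst// Om1 mulr1. Qed.

Lemma IOD f g : bmeas Om f -> bmeas Om g ->
  IO (fun x => f x + g x) = IO f + IO g.
Proof. exact: bmeas_intD. Qed.

Lemma IOB f g : bmeas Om f -> bmeas Om g ->
  IO (fun x => f x - g x) = IO f - IO g.
Proof. exact: bmeas_intB. Qed.

Lemma IOZ (c : R) f : bmeas Om f -> IO (fun x => c * f x) = c * IO f.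
Proof. exact: bmeas_intZ. Qed.

Lemma IO_sum n (F : 'I_n -> pt R -> R) : (forall i, bmeas Om (F i)) ->
  IO (fun x => \sum_(i < n) F i x) = \sum_(i < n) IO (F i).
Proof. exact: bmeas_int_sum. Qed.

Lemma IO_ae_le f g : bmeas Om f -> bmeas Om g ->
  {ae leb3 R, forall x, Om x -> f x <= g x} -> IO f <= IO g.
Proof. exact: bmeas_int_ae_le. Qed.

Lemma IO_le f g : bmeas Om f -> bmeas Om g ->
  (forall x, Om x -> f x <= g x) -> IO f <= IO g.
Proof. exact: bmeas_int_le. Qed.

Lemma IO_dist f g h : bmeas Om f -> bmeas Om g -> bmeas Om h ->
  {ae leb3 R, forall x, Om x -> `|f x - g x| <= h x} ->
  `|IO f - IO g| <= IO h.
Proof. exact: bmeas_int_dist. Qed.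

Lemma IO_ge0 f : (forall x, Om x -> 0 <= f x) -> 0 <= IO f.
Proof. exact: Rintegral_ge0. Qed.

Lemma IO_ae_eq f g : {ae leb3 R, forall x, Om x -> f x = g x} -> IO f = IO g.
Proof. exact: ae_Rintegral. Qed.

Lemma lip_bmeas M f : lip M f -> bmeas Om f.
Proof.
move=> fM; split; first exact: lip_measurable fM.
exists (`|f 0| + M * (3 * rho)) => x Ox.
rewrite -[f x](subrK (f 0)) addrC; apply: (le_trans (ler_normD _ _)).
rewrite lerD2l; apply: (le_trans (fM _ _)).
rewrite subr0 ler_wpM2l ?(lip_ge0 fM)//; exact/boxed_n1/bOm.
Qed.

(** The zero mean fixes the additive constant and so bounds the class on [Om]. *)
Definition potential M phi := [/\ cvx phi, lip M phi & IO phi = 0].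

Lemma potential_bound M phi x : potential M phi -> Om x ->
  `|phi x| <= M * (6 * rho).
Proof.
move=> [cf fM I0] Ox; rewrite -[phi x]subr0 -I0 -[phi x]IO_cst.
rewrite -[leRHS]IO_cst; apply: IO_dist.
- exact: bmeas_cst.
- exact: lip_bmeas fM.
- exact: bmeas_cst.
apply: aeW => y Oy; apply: (le_trans (fM _ _)).
by rewrite ler_wpM2l ?(lip_ge0 fM)//; apply: boxed_n1B; exact: bOm.
Qed.

Definition bmap (r : R) T := measurable_fun setT T /\ forall x, boxed r (T x).

Lemma bmeas_bmap r T (h : pt R -> R) (C : R) : bmap r T -> measurable_fun setT h ->
  (forall y, boxed r y -> `|h y| <= C) -> bmeas Om (fun x => h (T x)).
Proof.
move=> [mT bT] mh hC; split; last by exists C => x _; exact: hC.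
by apply: measurable_funTS => //; exact: (measurableT_comp mh mT).
Qed.

Lemma bmeas_bmap_lip r T M (h : pt R -> R) : bmap r T -> lip M h ->
  bmeas Om (fun x => h (T x)).
Proof.
move=> bT hM.
apply: (@bmeas_bmap _ _ _ (`|h 0| + M * (3 * r)) bT).
  exact: lip_measurable hM.
move=> y yr; rewrite -[h y](subrK (h 0)) addrC.
apply: (le_trans (ler_normD _ _)).
rewrite lerD2l; apply: (le_trans (hM _ _)).
by rewrite subr0 ler_wpM2l ?(lip_ge0 hM)//; exact: boxed_n1.
Qed.

Lemma lip_pt11 : lip 1 (fun x : pt R => x.1.1).
Proof. by move=> x y; rewrite mul1r /n1 -addrA lerDl addr_ge0. Qed.

Lemma lip_pt12 : lip 1 (fun x : pt R => x.1.2).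
Proof. by move=> x y; rewrite mul1r /n1 addrAC lerDr addr_ge0. Qed.

Lemma lip_pt2 : lip 1 (fun x : pt R => x.2).
Proof. by move=> x y; rewrite mul1r /n1 lerDr addr_ge0. Qed.

Lemma bmeas_dot r T : bmap r T -> bmeas Om (fun x => dot x (T x)).
Proof.
move=> bT; rewrite /dot.
apply: bmeasD; [apply: bmeasD|]; apply: bmeasM.
- exact: lip_bmeas lip_pt11.
- exact: bmeas_bmap_lip bT lip_pt11.
- exact: lip_bmeas lip_pt12.
- exact: bmeas_bmap_lip bT lip_pt12.
- exact: lip_bmeas lip_pt2.
- exact: bmeas_bmap_lip bT lip_pt2.
Qed.

Lemma bmeas_n1B r T T' : bmap r T -> bmap r T' ->
  bmeas Om (fun x => n1 (T x - T' x)).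
Proof.
move=> bT bT'; rewrite /n1.
apply: bmeasD; [apply: bmeasD|]; apply: bmeas_norm; apply: bmeasB.
- exact: bmeas_bmap_lip bT lip_pt11.
- exact: bmeas_bmap_lip bT' lip_pt11.
- exact: bmeas_bmap_lip bT lip_pt12.
- exact: bmeas_bmap_lip bT' lip_pt12.
- exact: bmeas_bmap_lip bT lip_pt2.
- exact: bmeas_bmap_lip bT' lip_pt2.
Qed.

Lemma bmap_grad3 M phi : cvx phi -> lip M phi -> bmap M (grad3 phi).
Proof.
move=> cf fM; split; first exact: grad3_measurable fM.
by move=> x; exact: grad3_boxed.
Qed.

(** The Legendre transform of the restriction of [phi] to [Om]: as [Om] is bounded it is finite
    everywhere and [rho]-Lipschitz. *)
Definition conjf phi y := sup [set dot x y - phi x | x in Om].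

Let conj_sup M phi y : lip M phi -> has_sup [set dot x y - phi x | x in Om].
Proof.
move=> fM; split; first by have [x Ox] := Om_nonempty; exists (dot x y - phi x); exists x.
have [_ [C fC]] := lip_bmeas fM.
exists (rho * n1 y + C) => _ [x Ox <-]; apply: lerD.
  by apply: (le_trans (ler_norm _)); exact/dot_le/bOm.
by apply: (le_trans (ler_norm _)); rewrite normrN fC.
Qed.

Lemma conj_ge M phi x y : lip M phi -> Om x ->
  dot x y - phi x <= conjf phi y.
Proof.
by move=> fM Ox; apply: ub_le_sup; [case: (conj_sup y fM)|exists x].
Qed.

Lemma conj_le M phi y (c : R) : lip M phi ->
  (forall x, Om x -> dot x y - phi x <= c) -> conjf phi y <= c.
Proof.
move=> fM H; apply: ge_sup; first by case: (conj_sup y fM).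
by move=> _ [x Ox <-]; exact: H.
Qed.

Lemma conj_lip M phi : lip M phi -> lip rho (conjf phi).
Proof.
move=> fM.
have half y z : conjf phi y <= conjf phi z + rho * n1 (y - z).
  apply: (conj_le fM) => x Ox.
  have := conj_ge z fM Ox; have := dot_le (y - z) (bOm Ox).
  by rewrite dotBr => /(le_trans (ler_norm _)); lra.
move=> y z; have := half y z; have := half z y.
by rewrite (n1_sym z) ler_norml lerBlDl lerNl opprB lerBlDl => -> ->.
Qed.

Lemma conj_dist M phi psi y (e : R) : lip M phi -> lip M psi ->
  (forall x, Om x -> `|phi x - psi x| <= e) ->
  `|conjf phi y - conjf psi y| <= e.
Proof.
move=> fM gM fg.
have half f g : lip M f -> lip M g ->
    (forall x, Om x -> `|f x - g x| <= e) -> conjf f y <= conjf g y + e.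
  move=> {}fM {}gM {}fg; apply: (conj_le fM) => x Ox.
  have := conj_ge y gM Ox; have := fg x Ox.
  by rewrite ler_norml => /andP[]; lra.
have := half _ _ fM gM fg.
have := half _ _ gM fM (fun x Ox => eq_ind_r (fun r => r <= e) (fg x Ox) (distrC _ _)).
by rewrite ler_norml lerBlDl lerNl opprB lerBlDl => -> ->.
Qed.

(* The Fenchel-Young deficit: zero exactly where [T x] is a subgradient. *)
Definition gapf phi T x := phi x + conjf phi (T x) - dot x (T x).
Definition gap phi T := IO (gapf phi T).

Lemma gapf_ge0 M phi T x : lip M phi -> Om x -> 0 <= gapf phi T x.
Proof. by move=> fM /(conj_ge (T x) fM); rewrite /gapf; lra. Qed.

Lemma bmeas_gapf M r phi T : lip M phi -> bmap r T -> bmeas Om (gapf phi T).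
Proof.
move=> fM bT; apply: bmeasB; last exact: bmeas_dot bT.
by apply: bmeasD; [exact: lip_bmeas fM|exact: bmeas_bmap_lip bT (conj_lip fM)].
Qed.

Lemma subgrad_grad3 phi x p : cvx phi -> Om x -> der3 phi x ->
  (forall y, Om y -> phi x + dot p (y - x) <= phi y) -> p = grad3 phi x.
Proof.
move=> cf Ox [d1 d2 d3] H.
have [r r0 rP] := n1_nbhs (open_nbhs_nbhs (conj oOm Ox)).
have key v : n1 v = 1 -> derivable phi x v -> dot p v = 'D_v phi x.
  move=> v1 dv; apply: (subslope_derive dv); apply: (local_subslope cf r0) => h hr.
  have Oh : Om (h *: v + x).
    by apply: rP; rewrite n1_sym addrK n1Z v1 mulr1.
  by have := H _ Oh; rewrite addrK dotZr mulrC => h1; rewrite lerBrDl.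
have := key _ (n1_e1 R) d1; have := key _ (n1_e2 R) d2; have := key _ (n1_e3 R) d3.
rewrite /grad3; move: ('D_(e1 R) phi x) ('D_(e2 R) phi x) ('D_(e3 R) phi x) => D1 D2 D3.
rewrite /dot /e1 /e2 /e3 /= !mulr0 !mulr1 !addr0 !add0r => <- <- <-.
by case: p {H key} => [[]].
Qed.

Lemma gap_eq0 M r phi T : cvx phi -> lip M phi -> bmap r T ->
  gap phi T <= 0 -> {ae leb3 R, forall x, Om x -> T x = grad3 phi x}.
Proof.
move=> cf fM bT g0.
have ae0 : {ae leb3 R, forall x, Om x -> gapf phi T x = 0}.
  apply: (bmeas_int_eq0 mOm Omfin (bmeas_gapf fM bT) _ g0).
  by apply: aeW => x Ox; exact: gapf_ge0 fM Ox.
have := ae_der3 cf fM; apply: filterS2 ae0 => x gx dx Ox.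
apply: (subgrad_grad3 cf Ox dx) => y Oy.
have := conj_ge (T x) fM Oy; have := gx Ox; rewrite /gapf (dotC (T x)) dotBl.
by move: (dot _ _) (dot _ _) (conjf _ _) (phi x) (phi y) => a b c d e; lra.
Qed.

Lemma gap_grad3 M phi : cvx phi -> lip M phi -> gap phi (grad3 phi) = 0.
Proof.
move=> cf fM; rewrite -[RHS]IO_cst; apply: IO_ae_eq.
have := ae_der3 cf fM; apply: filterS => x dx Ox.
apply/eqP; rewrite eq_le (gapf_ge0 _ fM Ox) andbT /gapf subr_le0 -lerBrDl.
apply: (conj_le fM) => y Oy.
have := der3_subgrad cf dx y; rewrite dotC; move: (grad3 phi x) => p; rewrite dotBl.
by move: (dot _ _) (dot _ _) (phi x) (phi y) => a b c d; lra.
Qed.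

Definition gdist phi psi := IO (fun x => n1 (grad3 phi x - grad3 psi x)).

Lemma gdist_ge0 phi psi : 0 <= gdist phi psi.
Proof. by apply: IO_ge0 => x _; exact: n1_ge0. Qed.

Lemma gdist_sym phi psi : gdist phi psi = gdist psi phi.
Proof. by congr IO; apply/funext => x; exact: n1_sym. Qed.

Lemma gdist_triangle M phi psi xi :
  potential M phi -> potential M psi -> potential M xi ->
  gdist phi xi <= gdist phi psi + gdist psi xi.
Proof.
move=> [c1 l1 _] [c2 l2 _] [c3 l3 _].
have b1 := bmap_grad3 c1 l1; have b2 := bmap_grad3 c2 l2; have b3 := bmap_grad3 c3 l3.
have b12 := bmeas_n1B b1 b2; have b23 := bmeas_n1B b2 b3.
rewrite /gdist -(IOD b12 b23); apply: IO_le.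
- exact: bmeas_n1B b1 b3.
- exact: (bmeasD b12 b23).
by move=> x _; exact: n1_triangle.
Qed.

Lemma gap_dist M r phi psi T T' (e : R) : lip M phi -> lip M psi ->
  bmap r T -> bmap r T' ->
  (forall x, Om x -> `|phi x - psi x| <= e) ->
  `|gap phi T - gap psi T'| <= 2 * e + 2 * rho * IO (fun x => n1 (T x - T' x)).
Proof.
move=> fM gM bT bT' fg; have bn := bmeas_n1B bT bT'.
rewrite -(IOZ (2 * rho) bn) -[2 * e]IO_cst -IOD; last 2 first.
- exact: bmeas_cst.
- exact: bmeasZ.
apply: IO_dist.
- exact: bmeas_gapf fM bT.
- exact: bmeas_gapf gM bT'.
- by apply: bmeasD; [exact: bmeas_cst|exact: bmeasZ].
apply: aeW => x Ox.
have h1 := fg x Ox; have h2 := conj_dist (T x) fM gM fg.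
have h3 := conj_lip gM (T x) (T' x).
have h4 := dot_le (T x - T' x) (bOm Ox); rewrite dotBr in h4.
rewrite /gapf -mulrA; move: h1 h2 h3 h4.
move: (conjf phi (T x)) (conjf psi (T x)) (conjf psi (T' x)) (dot x (T x)) (dot x (T' x)).
move: (phi x) (psi x) (rho * n1 _) => a b u c1 c2 c3 p q.
rewrite !ler_norml => /andP[? ?] /andP[? ?] /andP[? ?] /andP[? ?].
by apply/andP; split; lra.
Qed.

(** The slope of a convex [psi] lies between its backward and forward difference quotients, and
    these are controlled by uniform closeness. Openness of [Om] provides room for both steps. *)
Lemma grad3_close phi x : cvx phi -> Om x -> der3 phi x ->
  forall e : R, 0 < e -> exists2 eta, 0 < eta & forall psi, cvx psi -> der3 psi x ->
    (forall y, Om y -> `|psi y - phi y| <= eta) ->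
    n1 (grad3 phi x - grad3 psi x) <= e.
Proof.
move=> cf Ox [d1 d2 d3] e e0.
have [r r0 rP] := n1_nbhs (open_nbhs_nbhs (conj oOm Ox)).
have key v : n1 v = 1 -> derivable phi x v ->
    exists2 eta, 0 < eta & forall psi, cvx psi -> derivable psi x v ->
      (forall y, Om y -> `|psi y - phi y| <= eta) ->
      `|'D_v phi x - 'D_v psi x| <= e / 3.
  move=> v1 dv; have e6 : 0 < e / 6 by rewrite divr_gt0.
  have [d d0 dP] := derivable_eps dv e6.
  pose a := Num.min d r / 2.
  have m0 : 0 < Num.min d r by rewrite lt_min d0.
  have a0 : 0 < a by exact: divr_gt0.
  have am : a < Num.min d r by rewrite ltr_pdivrMr// ltr_pMr// ltr1n.
  have ad : a < d by apply: (lt_le_trans am); rewrite ge_min lexx.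
  have ar : a < r by apply: (lt_le_trans am); rewrite ge_min lexx orbT.
  exists (a * (e / 12)); first by rewrite mulr_gt0// divr_gt0.
  move=> psi cg dg close.
  have O1 : Om (a *: v + x) by apply: rP; rewrite n1_sym addrK n1Z v1 mulr1 gtr0_norm.
  have O2 : Om (- a *: v + x).
    by apply: rP; rewrite n1_sym addrK n1Z v1 mulr1 normrN gtr0_norm.
  have s1 := derivable_subslope cg dg a; have s2 := derivable_subslope cg dg (- a).
  have an0 : a != 0 by rewrite gt_eqF.
  have nan0 : - a != 0 by rewrite oppr_eq0.
  have p1 := dP a an0; rewrite (gtr0_norm a0) in p1; have {}p1 := p1 ad.
  have p2 := dP (- a) nan0; rewrite normrN (gtr0_norm a0) in p2; have {}p2 := p2 ad.
  exact: (slope_close a0 p1 p2 s1 s2 (close x Ox) (close _ O1) (close _ O2)).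
have [a1 a10 h1] := key _ (n1_e1 R) d1.
have [a2 a20 h2] := key _ (n1_e2 R) d2.
have [a3 a30 h3] := key _ (n1_e3 R) d3.
exists (Num.min a1 (Num.min a2 a3)); first by rewrite !lt_min a10 a20.
move=> psi cg [g1 g2 g3] close.
rewrite (_ : e = e / 3 + e / 3 + e / 3); last by field.
have c1 y : Om y -> `|psi y - phi y| <= a1.
  by move=> /close; rewrite !le_min => /and3P[].
have c2 y : Om y -> `|psi y - phi y| <= a2.
  by move=> /close; rewrite !le_min => /and3P[].
have c3 y : Om y -> `|psi y - phi y| <= a3.
  by move=> /close; rewrite !le_min => /and3P[].
exact: (lerD (lerD (h1 psi cg g1 c1) (h2 psi cg g2 c2)) (h3 psi cg g3 c3)).
Qed.

(** Along a putative counterexample the gradients converge wherever all functions are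
    differentiable, and they are bounded: dominated convergence applies. *)
Lemma gdist_continuous M phi : potential M phi ->
  forall e : R, 0 < e -> exists2 eta, 0 < eta & forall psi,
    potential M psi -> (forall y, Om y -> `|psi y - phi y| <= eta) ->
    gdist phi psi <= e.
Proof.
move=> [cf fM _] e e0; apply: contrapT => H.
have /choice[psi psiP] : forall n : nat, exists psi, [/\ potential M psi,
    (forall y, Om y -> `|psi y - phi y| <= n.+1%:R^-1) & e < gdist phi psi].
  move=> n; apply: contrapT => Hn; apply: H; exists n.+1%:R^-1 => //.
  by move=> psi Kpsi close; rewrite leNgt; apply/negP => lt; apply: Hn; exists psi.
pose X n x := n1 (grad3 phi x - grad3 (psi n) x).
have bX n : bmeas Om (X n).
  have [[cg gM _] _ _] := psiP n.
  exact: bmeas_n1B (bmap_grad3 cf fM) (bmap_grad3 cg gM).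
have Xcv : {ae leb3 R, forall x, Om x -> X n x @[n --> \oo] --> (0 : R)}.
  have aed : {ae leb3 R, forall x, forall n, der3 (psi n) x}.
    by apply: ae_foralln => n; have [[cg gM _] _ _] := psiP n; exact: ae_der3 gM.
  have := ae_der3 cf fM; apply: filterS2 aed => x dn dx Ox.
  apply/cvgrPdist_le => d d0; have [eta eta0 etaP] := grad3_close cf Ox dx d0.
  near=> n; rewrite sub0r normrN ger0_norm ?n1_ge0//.
  have [[cg _ _] close _] := psiP n; apply: (etaP _ cg (dn n)) => y Oy.
  apply: (le_trans (close y Oy)); apply/ltW.
  by near: n; exact: (near_infty_natSinv_lt (PosNum eta0)).
have cvI := bmeas_int_cvg mOm Omfin bX (measurable_cst (0 : R)) (C := 6 * M).
have {cvI} : IO (X n) @[n --> \oo] --> (0 : R).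
  rewrite -[X in _ --> X](IO_cst 0); apply: cvI => // n x _.
  have [[cg gM _] _ _] := psiP n.
  rewrite ger0_norm ?n1_ge0//.
  by apply: boxed_n1B; exact: grad3_boxed.
move=> /cvgrPdist_lt/(_ e e0)[N _ /(_ N (leqnn N))] /=.
have [_ _] := psiP N; rewrite sub0r normrN ger0_norm ?gdist_ge0//.
by move=> /lt_trans /[apply]; rewrite ltxx.
Unshelve. all: by end_near. Qed.

Section ultra.
Variables (U : set_system nat) (UU : UltraFilter U) (Uoo : \oo `<=` U).

(** Arzela-Ascoli: pointwise limits along [U] inherit convexity and the Lipschitz bound, and a
    finite net makes the convergence uniform on [Om], which preserves the mean. *)
Lemma ulim_potential M (phi : nat -> pt R -> R) :
  (forall n, potential M (phi n)) ->
  potential M (fun x => ulim U (phi^~ x)) /\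
  forall e : R, 0 < e -> U [set n | forall x, Om x ->
    `|phi n x - ulim U (phi^~ x)| <= e].
Proof.
move=> Kphi; pose phi' x := ulim U (phi^~ x).
have [x0 Ox0] := Om_nonempty.
have M0 : 0 <= M by have [_ /lip_ge0] := Kphi 0%N.
have bd x n : `|phi n x| <= M * (6 * rho) + M * n1 (x - x0).
  have [_ fM _] := Kphi n; rewrite -[phi n x](subrK (phi n x0)) addrC.
  apply: (le_trans (ler_normD _ _)); apply: lerD; last exact: fM.
  exact: (potential_bound (Kphi n) Ox0).
have pw x (e : R) : 0 < e -> U [set n | `|phi n x - phi' x| <= e].
  exact: (ulim_near UU (bd x)).
have lipU : lip M phi'.
  move=> x y; apply/ler_addgt0Pr => e e0; have e2 : 0 < e / 2 by exact: divr_gt0.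
  have [n /= [h1 h2]] := filter_ex (filterI (pw x _ e2) (pw y _ e2)).
  have [_ fM _] := Kphi n; have := fM x y; move: h1 h2.
  move: (phi n x) (phi n y) (phi' x) (phi' y) (M * _) => a b c d u.
  rewrite !ler_norml => /andP[? ?] /andP[? ?] /andP[? ?].
  by apply/andP; split; lra.
have unif (e : R) : 0 < e -> U [set n | forall x, Om x -> `|phi n x - phi' x| <= e].
  move=> e0; have M1 : 0 < M + 1 by rewrite ltr_wpDl.
  have d0 : 0 < e / (3 * (M + 1)) by rewrite divr_gt0// mulr_gt0.
  have [s sP] := net3 rho d0; have e3 : 0 < e / 3 by exact: divr_gt0.
  have := ultra_seq UU (P := fun y => [set n | `|phi n y - phi' y| <= e / 3])
    (fun y (_ : y \in s) => pw y _ e3).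
  apply: filterS => n /= h x Ox; have [y ys xy] := sP x (bOm Ox).
  have My : M * n1 (x - y) <= e / 3.
    move: xy; rewrite ler_pdivlMr ?mulr_gt0//.
    by have := n1_ge0 (x - y); move: (n1 _) => u; nra.
  have [_ fM _] := Kphi n; have := fM x y; have := lipU x y; have := h y ys; move: My.
  move: (phi n x) (phi n y) (phi' x) (phi' y) (M * _) => a b c d u h1.
  rewrite !ler_norml => /andP[? ?] /andP[? ?] /andP[? ?].
  by apply/andP; split; lra.
split => //; split => //.
  move=> x y t t01; apply/ler_addgt0Pr => e e0; have e2 : 0 < e / 2 by exact: divr_gt0.
  have [n /= [[h1 h2] h3]] := filter_ex (filterI (filterI (pw x _ e2) (pw y _ e2))
    (pw (t *: x + (1 - t) *: y) _ e2)).
  have [cf _ _] := Kphi n; have := cf x y t t01; move: h1 h2 h3.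
  move: (phi n x) (phi n y) (phi n _) => a b u.
  rewrite -/(phi' x) -/(phi' y) -/(phi' (t *: x + (1 - t) *: y)).
  move: (phi' x) (phi' y) (phi' _) => a' b' u'.
  case/andP: t01 => t0 t1.
  rewrite !ler_norml => /andP[p1 p2] /andP[q1 q2] /andP[? ?] h.
  have := ler_wpM2l t0 p2; have t10 : 0 <= 1 - t by rewrite subr_ge0.
  have := ler_wpM2l t10 q2; lra.
apply/eqP; rewrite -normr_eq0; apply/eqP/le_anti; rewrite normr_ge0 andbT.
apply/ler_addgt0Pr => e e0; rewrite add0r.
have [n /= h] := filter_ex (unif e e0).
have [_ fM I0] := Kphi n.
rewrite -[IO phi']subr0 -I0 distrC -[leRHS]IO_cst; apply: IO_dist.
- exact: lip_bmeas fM.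
- exact: lip_bmeas lipU.
- exact: bmeas_cst.
- by apply: aeW => x Ox; exact: h.
Qed.

End ultra.

(* By compactness of the potentials: a vanishing duality gap forces the
   gradients to agree, so a small gap forces them to be close. *)
Lemma gap_stability M (e : R) : 0 < e -> exists2 delta, 0 < delta &
  forall phi psi, potential M phi -> potential M psi ->
    gap phi (grad3 psi) <= delta -> gdist phi psi <= e.
Proof.
move=> e0; apply: contrapT => H.
have /choice[s sP] : forall n : nat, exists p : (pt R -> R) * (pt R -> R),
    [/\ potential M p.1, potential M p.2,
      gap p.1 (grad3 p.2) <= n.+1%:R^-1 & e < gdist p.1 p.2].
  move=> n; apply: contrapT => Hn; apply: H; exists n.+1%:R^-1 => //.
  move=> phi psi K1 K2 g; rewrite leNgt; apply/negP => lt; apply: Hn.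
  by exists (phi, psi).
have [U [UU Uoo]] := @exists_ultra.
have K1 n : potential M (s n).1 by have [] := sP n.
have K2 n : potential M (s n).2 by have [] := sP n.
have [Kphi uphi] := ulim_potential UU K1.
have [Kpsi upsi] := ulim_potential UU K2.
set phi := fun x => ulim U _ in Kphi uphi.
set psi := fun x => ulim U _ in Kpsi upsi.
have [cphi phiM _] := Kphi; have [cpsi psiM _] := Kpsi.
(* The gap passes to the limit by [gap_dist]. Three errors of [d / 4] occur: the potentials, the
   gradients, and the gap of the pair [s n]. *)
have g0 : gap phi (grad3 psi) <= 0.
  apply/ler_addgt0Pr => d d0; rewrite add0r.
  have rho0 := rho_ge0.
  have c0 : 0 < 4 * (2 * rho + 1) by rewrite mulr_gt0// ltr_wpDl// mulr_ge0.
  have d4 : 0 < d / (4 * (2 * rho + 1)) by rewrite divr_gt0.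
  have d8 : 0 < d / 8 by rewrite divr_gt0.
  have [eta eta0 etaP] := gdist_continuous Kpsi d4.
  have [k kd] : exists k : nat, k.+1%:R^-1 <= d / 4.
    exists (Num.truncn (4 / d)); rewrite -[d / 4]invf_div lef_pV2 ?posrE ?divr_gt0//.
    exact/ltW/truncnS_gt.
  have [n /= [[h1 h2] h3]] := filter_ex (filterI (filterI (uphi _ d8) (upsi _ eta0))
    (ultra_ge Uoo k)).
  have [[cp pM _] [cq qM _] gn _] := sP n.
  have := gap_dist pM phiM (bmap_grad3 cq qM) (bmap_grad3 cpsi psiM) h1.
  rewrite -/(gdist (s n).2 psi) gdist_sym => gd.
  have kn : n.+1%:R^-1 <= k.+1%:R^-1 :> R by rewrite lef_pV2 ?posrE// ler_nat ltnS.
  have rg : 2 * rho * gdist psi (s n).2 <= d / 4.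
    have g1 := etaP _ (K2 n) h2; have g2 := gdist_ge0 psi (s n).2.
    move: g1; rewrite ler_pdivlMr//.
    by move: (gdist _ _) g2 => u u0 hu; nra.
  move: gd gn kd kn rg; rewrite ler_norml => /andP[+ _].
  move: (gap _ _) (gap _ _) (gdist _ _) (n.+1%:R^-1) (k.+1%:R^-1) => a b c u v.
  by move: (2 * rho * c) => w; lra.
have pq0 : gdist phi psi = 0.
  rewrite -[RHS](IO_cst 0); apply: IO_ae_eq.
  have := gap_eq0 cphi phiM (bmap_grad3 cpsi psiM) g0.
  by apply: filterS => x h Ox; rewrite h// n1_subrr.
have e4 : 0 < e / 4 by exact: divr_gt0.
have [a a0 aP] := gdist_continuous Kphi e4.
have [b b0 bP] := gdist_continuous Kpsi e4.
have [n /= [h1 h2]] := filter_ex (filterI (uphi _ a0) (upsi _ b0)).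
have g1 := aP _ (K1 n) h1; have g2 := bP _ (K2 n) h2.
have [_ _ _ lt] := sP n.
have t1 := gdist_triangle (K1 n) Kphi (K2 n).
have t2 := gdist_triangle Kphi Kpsi (K2 n).
rewrite pq0 add0r in t2; rewrite (gdist_sym (s n).1 phi) in t1.
have := lt_le_trans lt (le_trans t1 (lerD g1 (le_trans t2 g2))).
by rewrite ltNge => /negP; apply; exact: quarters_le.
Qed.

End stability.

(** * Brenier potentials *)

Lemma law_exists d (X : measurableType d) d' (Y : measurableType d')
    (R : realType) (mu : {measure set X -> \bar R}) (D : set X) (T : X -> Y) :
  measurable D -> mu D = 1%E -> measurable_fun setT T -> inhabited Y ->
  exists nu : probability Y R, forall B, measurable B ->
    nu B = mu (D `&` T @^-1` B).
Proof.
move=> mD D1 mT [y0].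
pose m : {measure set X -> \bar R} := mrestr mu mD.
pose p := pushforward m T : {measure set Y -> \bar R}.
have pE B : p mT B = mu (D `&` T @^-1` B).
  by rewrite /p /m /= /pushforward /= /mrestr setIC.
have p1 : p mT setT = 1%E by rewrite pE preimage_setT setIT.
(* Normalisation only serves to obtain the type of probabilities: the total mass is already 1. *)
exists (mnormalize (p mT) (dirac y0)) => B mB; rewrite -pE.
have f1 : fine (1%E : \bar R) = 1 by [].
have c0 : ((p mT [set: Y] == 0%E) || (p mT [set: Y] == +oo%E)) = false.
  by rewrite p1 onee_eq0.
transitivity (mnormalize (p mT) (dirac y0 : probability Y R) B); first by [].
by rewrite /mnormalize c0 p1 f1 invr1 mule1.
Qed.

Section optimal_maps.
Variables (R : realType) (Om : set (pt R)) (rho : R).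
Hypothesis oOm : open Om.
Hypothesis bOm : forall x, Om x -> boxed rho x.
Hypothesis Om1 : leb3 R Om = 1%E.
Implicit Types (f phi psi : pt R -> R) (x y v : pt R) (T : pt R -> pt R).

Let mOm : measurable Om. Proof. exact: open_pt_measurable. Qed.
Let Omfin : (leb3 R Om < +oo)%E. Proof. by rewrite Om1 ltry. Qed.

Definition has_law T (nu : set (pt R) -> \bar R) :=
  forall B, measurable B -> nu B = leb3 R (Om `&` T @^-1` B).

Lemma EFin_IO f : bmeas Om f ->
  (\int[leb3 R]_(x in Om) (f x)%:E)%E = (IO Om f)%:E.
Proof.
move=> bf; rewrite /IO /Rintegral fineK//.
exact: (integrable_fin_num mOm (bmeas_integrable mOm Omfin bf)).
Qed.

Lemma measurable_dotself : measurable_fun setT (fun x : pt R => dot x x).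
Proof.
rewrite /dot.
by apply: measurable_funD; [apply: measurable_funD|]; apply: measurable_funM;
  first [exact: measurable_pt11|exact: measurable_pt12|exact: measurable_pt2].
Qed.

Lemma measurable_sqd :
  measurable_fun setT (fun z : pt R * pt R => (sqd z.1 z.2)%:E).
Proof.
apply/measurable_EFinP; rewrite /sqd.
have m1 : measurable_fun setT (fst : pt R * pt R -> pt R) by exact: measurable_fst.
have m2 : measurable_fun setT (snd : pt R * pt R -> pt R) by exact: measurable_snd.
have h (p : pt R -> R) : measurable_fun setT p ->
    measurable_fun setT (fun z : pt R * pt R => (p z.1 - p z.2) ^+ 2).
  move=> mp; apply: measurable_funX; apply: measurable_funB.
    exact: (measurableT_comp mp m1).
  exact: (measurableT_comp mp m2).
apply: measurable_funD; last exact: (h snd measurable_snd).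
apply: measurable_funD; first exact: (h _ (@measurable_pt11 R)).
exact: (h _ (@measurable_pt12 R)).
Qed.

Lemma sqd_ge0 x y : 0 <= sqd x y.
Proof. by rewrite /sqd !addr_ge0// sqr_ge0. Qed.

Lemma coupling_map T T' (nu nu' : set (pt R) -> \bar R) :
  measurable_fun setT T -> measurable_fun setT T' ->
  has_law T nu -> has_law T' nu' ->
  exists2 pi : {measure set (pt R * pt R) -> \bar R}, coupling nu nu' pi &
    cost pi = (\int[leb3 R]_(x in Om) (sqd (T x) (T' x))%:E)%E.
Proof.
move=> mT mT' lT lT'.
have mTT : measurable_fun setT (fun x => (T x, T' x)) by exact: measurable_fun_pair.
have [pi piE] := law_exists mOm Om1 mTT (inhabits (0 : pt R, 0 : pt R)).
exists pi.
  move=> A mA; split.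
    apply: (etrans (piE _ (measurableX mA measurableT))).
    rewrite (lT _ mA); apply: (congr1 (fun B => leb3 R (Om `&` B))).
    by apply/seteqP; split => x //= [].
  apply: (etrans (piE _ (measurableX measurableT mA))).
  rewrite (lT' _ mA); apply: (congr1 (fun B => leb3 R (Om `&` B))).
  by apply/seteqP; split => x //= [].
rewrite /cost (law_ge0_integral mOm mTT piE measurable_sqd)//.
by move=> z; rewrite lee_fin sqd_ge0.
Qed.

Lemma bmeas_sqd r r' T T' : bmap r T -> bmap r' T' ->
  bmeas Om (fun x => sqd (T x) (T' x)).
Proof.
move=> bT bT'; rewrite /sqd.
have h (p : pt R -> R) : lip 1 p -> bmeas Om (fun x => (p (T x) - p (T' x)) ^+ 2).
  move=> lp; have b : bmeas Om (fun x => p (T x) - p (T' x)).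
    by apply: bmeasB; [exact: (bmeas_bmap_lip Om bT lp)|exact: (bmeas_bmap_lip Om bT' lp)].
  exact: (bmeasM b b).
apply: bmeasD; last exact: (h _ (@lip_pt2 R)).
by apply: bmeasD; [exact: (h _ (@lip_pt11 R))|exact: (h _ (@lip_pt12 R))].
Qed.

Lemma bmeas_sqd_id r T : bmap r T -> bmeas Om (fun x => sqd x (T x)).
Proof.
move=> bT; rewrite /sqd.
have h (p : pt R -> R) : lip 1 p -> bmeas Om (fun x => (p x - p (T x)) ^+ 2).
  move=> lp; have b : bmeas Om (fun x => p x - p (T x)).
    by apply: bmeasB; [exact: (lip_bmeas oOm bOm lp)|exact: (bmeas_bmap_lip Om bT lp)].
  exact: (bmeasM b b).
apply: bmeasD; last exact: (h _ (@lip_pt2 R)).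
by apply: bmeasD; [exact: (h _ (@lip_pt11 R))|exact: (h _ (@lip_pt12 R))].
Qed.

Lemma sqd_le_n1 r x y : boxed r x -> boxed r y ->
  sqd x y <= 2 * r * n1 (x - y).
Proof.
rewrite /sqd /n1 /= => -[x1 x2 x3] [y1 y2 y3].
have h (a b : R) : `|a| <= r -> `|b| <= r -> (a - b) ^+ 2 <= 2 * r * `|a - b|.
  move=> ar br; rewrite -[leLHS]ger0_norm ?sqr_ge0// normrX expr2 ler_wpM2r//.
  by apply: (le_trans (ler_normB _ _)); lra.
by rewrite !mulrDr; apply: lerD; [apply: lerD|]; exact: h.
Qed.

(** Images of the same measure are coupled by the joint map, and on a box the squared distance is at
    most [2 * r] times the distance. *)
Lemma W2_le r T T' (nu nu' : set (pt R) -> \bar R) (c : R) :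
  bmap r T -> bmap r T' -> has_law T nu -> has_law T' nu' -> 0 <= c ->
  2 * r * IO Om (fun x => n1 (T x - T' x)) <= c ^+ 2 -> W2 nu nu' <= c.
Proof.
move=> bT bT' lT lT' c0 H.
have [pi cpi piE] := coupling_map bT.1 bT'.1 lT lT'.
rewrite /W2 -[leRHS]ger0_norm// -sqrtr_sqr; apply: ler_wsqrtr.
have infc : (ereal_inf [set cost pi0 | pi0 in coupling nu nu'] <= (c ^+ 2)%:E)%E.
  apply: (@le_trans _ _ (cost pi)); first by apply: ereal_inf_lbound; exists pi.
  rewrite piE EFin_IO; last exact: (bmeas_sqd bT bT').
  rewrite lee_fin; apply: le_trans H; rewrite -IOZ//; last exact: (bmeas_n1B Om bT bT').
  apply: IO_le => //.
  - exact: (bmeas_sqd bT bT').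
  - exact/bmeasZ/(bmeas_n1B Om bT bT').
  - by move=> x _; apply: sqd_le_n1; [exact: bT.2|exact: bT'.2].
have inf0 : (0 <= ereal_inf [set cost pi0 | pi0 in coupling nu nu'])%E.
  apply: le_ereal_inf_tmp => _ [p _ <-]; apply: integral_ge0 => z _.
  by rewrite lee_fin sqd_ge0.
rewrite -[leRHS]/(fine (c ^+ 2)%:E); apply: fine_le => //.
by rewrite ge0_fin_numE//; apply: le_lt_trans infc _; rewrite ltry.
Qed.

Lemma law_IO r T (nu : {measure set (pt R) -> \bar R}) h :
  bmap r T -> has_law T nu -> measurable_fun setT h ->
  \int[nu]_y h y = IO Om (fun x => h (T x)).
Proof. by move=> bT lT mh; exact: (law_Rintegral mOm bT.1 lT mh). Qed.

(** * Optimality and uniqueness of the gradient map *)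

Section potential_map.
Variables (M : R) (phi : pt R -> R) (nu : probability (pt R) R).
Hypothesis Kphi : potential Om M phi.
Hypothesis lphi : has_law (grad3 phi) nu.

Let cphi : cvx phi. Proof. by case: Kphi. Qed.
Let phiM : lip M phi. Proof. by case: Kphi. Qed.
Let G := grad3 phi.
Let bG : bmap M G. Proof. exact: bmap_grad3. Qed.

(** Kantorovich duality: Fenchel-Young reads [a x + b y <= sqd x y], with equality almost everywhere
    on the graph of [G], and the integrals of [a] and [b] depend only on the marginals. *)
Lemma potential_optimal pi : coupling (lebOm Om) nu pi ->
  (\int[leb3 R]_(x in Om) (sqd x (G x))%:E <= cost pi)%E.
Proof.
move=> cpi.
pose Bx := [set y : pt R | boxed M y].
have mBx : measurable Bx by exact: measurable_boxed.
have cl := conj_lip oOm bOm Om1 phiM.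
have bsq : bmeas Om (fun x : pt R => dot x x).
  rewrite /dot; apply: bmeasD; [apply: bmeasD|]; apply: bmeasM;
   first [exact: (lip_bmeas oOm bOm (@lip_pt11 R))|exact: (lip_bmeas oOm bOm (@lip_pt12 R))
     |exact: (lip_bmeas oOm bOm (@lip_pt2 R))].
pose a x := dot x x - 2 * phi x.
have ba : bmeas Om a.
  by apply: bmeasB => //; apply: bmeasZ; exact: (lip_bmeas oOm bOm phiM).
have [C1 aC] := ba.2.
pose b y := dot y y - 2 * conjf Om phi y.
have mb : measurable_fun setT b.
  apply: measurable_funB; first exact: measurable_dotself.
  by apply: measurable_funM => //; exact: (lip_measurable measurableT cl).
have [C2 bC] : exists C2, forall y, Bx y -> `|b y| <= C2.
  exists (M * (3 * M) + 2 * (`|conjf Om phi 0| + rho * (3 * M))) => y By.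
  apply: (le_trans (ler_normB _ _)); apply: lerD.
    apply: (le_trans (dot_le y By)); apply: ler_wpM2l; first exact: (boxed_ge0 By).
    exact: boxed_n1.
  rewrite normrM (gtr0_norm (ltr0Sn _ 1)) ler_pM2l//.
  rewrite -[conjf _ _ y](subrK (conjf Om phi 0)) addrC.
  apply: (le_trans (ler_normD _ _)); rewrite lerD2l.
  apply: (le_trans (cl y 0)); rewrite subr0; apply: ler_wpM2l.
    exact: (rho_ge0 bOm Om1).
  exact: boxed_n1.
(* Shifted by [C] and cut off outside [Om] and the box, [a] and [b] become nonnegative on the whole
   space. Their integrals can then be added as extended reals even if [pi] has infinite cost. *)
pose C := `|C1| + `|C2|.
have aC0 x : Om x -> 0 <= a x + C.
  move=> Ox; have := aC x Ox; rewrite ler_norml => /andP[h _].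
  by have := ler_norm C1; have := normr_ge0 C2; rewrite /C; lra.
have bC0 y : Bx y -> 0 <= b y + C.
  move=> By; have := bC y By; rewrite ler_norml => /andP[h _].
  by have := ler_norm C2; have := normr_ge0 C1; rewrite /C; lra.
have C0 : 0 <= C by rewrite addr_ge0.
pose a' x : R := (a x + C) * \1_Om x.
pose b' y : R := (b y + C) * \1_Bx y.
have a'0 x : 0 <= a' x.
  rewrite /a' indicE; case: (boolP (x \in Om)) => [|_]; last by rewrite mulr0.
  by rewrite inE mulr1; exact: aC0.
have b'0 y : 0 <= b' y.
  rewrite /b' indicE; case: (boolP (y \in Bx)) => [|_]; last by rewrite mulr0.
  by rewrite inE mulr1; exact: bC0.
have ma' : measurable_fun setT a'.
  apply: measurable_funM; last exact: measurable_indic.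
  apply: measurable_funD => //; apply: measurable_funB.
    exact: measurable_dotself.
  by apply: measurable_funM => //; exact: (lip_measurable measurableT phiM).
have mb' : measurable_fun setT b'.
  by apply: measurable_funM; [exact: measurable_funD|exact: measurable_indic].
have ma'E : measurable_fun setT (fun x => (a' x)%:E) by exact/measurable_EFinP.
have mb'E : measurable_fun setT (fun x => (b' x)%:E) by exact/measurable_EFinP.
have m1 : measurable_fun setT (fst : pt R * pt R -> pt R) by exact: measurable_fst.
have m2 : measurable_fun setT (snd : pt R * pt R -> pt R) by exact: measurable_snd.
have ma1 : measurable_fun setT (fun z : pt R * pt R => (a' z.1)%:E).
  exact: (measurableT_comp ma'E m1).
have mb2 : measurable_fun setT (fun z : pt R * pt R => (b' z.2)%:E).
  exact: (measurableT_comp mb'E m2).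
have e1 : (\int[pi]_z (a' z.1)%:E = (IO Om (fun x => a x + C))%:E)%E.
  have H B : measurable B ->
      mrestr (leb3 R) mOm B = pi (setT `&` (fst : pt R * pt R -> pt R) @^-1` B).
    move=> mB; rewrite setTI.
    rewrite (_ : fst @^-1` B = B `*` setT); last by apply/seteqP; split => z //= [].
    have [-> _] := cpi B mB.
    by rewrite /lebOm /= /mrestr setIC.
  rewrite -(law_ge0_integral measurableT m1 H ma'E); last first.
    by move=> x; rewrite lee_fin.
  rewrite integral_mrestr//.
  rewrite -EFin_IO; last by apply: bmeasD => //; exact: bmeas_cst.
  by apply: eq_integral => x Ox; rewrite /a' indicE Ox mulr1.
have e2 : (\int[pi]_z (b' z.2)%:E = (IO Om (fun x => b (G x) + C))%:E)%E.
  have H B : measurable B ->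
      nu B = pi (setT `&` (snd : pt R * pt R -> pt R) @^-1` B).
    move=> mB; rewrite setTI; have [_ <-] := cpi B mB.
    by congr (pi _); apply/seteqP; split => z //= [].
  rewrite -(law_ge0_integral measurableT m2 H mb'E); last first.
    by move=> x; rewrite lee_fin.
  rewrite (law_ge0_integral mOm bG.1 lphi mb'E); last by move=> x; rewrite lee_fin.
  rewrite -EFin_IO; last first.
    apply: bmeasD; last exact: bmeas_cst.
    exact: (bmeas_bmap Om bG mb bC).
  apply: eq_integral => x Ox; rewrite /b' indicE mem_set ?mulr1//.
  exact: bG.2.
have pi1 : pi setT = 1%E.
  by rewrite -setXTT; have [-> _] := cpi setT measurableT; rewrite /lebOm setIT.
have key : (\int[pi]_z ((a' z.1)%:E + (b' z.2)%:E) <= \int[pi]_z ((sqd z.1 z.2)%:E + (2 * C)%:E))%E.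
  apply: ae_ge0_le_integral => //.
  - by move=> z _; rewrite -EFinD lee_fin addr_ge0.
  - exact: emeasurable_funD.
  - by move=> z _; rewrite -EFinD lee_fin addr_ge0// ?sqd_ge0// mulr_ge0.
  - by apply: emeasurable_funD => //; exact: measurable_sqd.
  (* Fenchel-Young and the formulas for [a'] and [b'] hold outside these two sets, which the
     marginals make negligible. *)
  pose A1 := (~` Om) `*` [set: pt R]; pose A2 := [set: pt R] `*` (~` Bx).
  have mA1 : measurable A1 by apply: measurableX => //; exact: measurableC.
  have mA2 : measurable A2 by apply: measurableX => //; exact: measurableC.
  have p1 : pi A1 = 0%E.
    by apply: (etrans (cpi _ (measurableC mOm)).1); rewrite /lebOm setICr measure0.
  have p2 : pi A2 = 0%E.
    apply: (etrans (cpi _ (measurableC mBx)).2).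
    apply: (etrans (lphi (measurableC mBx))).
    rewrite (_ : _ `&` _ = set0) ?measure0//.
    by apply/seteqP; split => // x [_] /=; apply; exact: bG.2.
  exists (A1 `|` A2); split.
  - exact: measurableU.
  - apply/eqP; rewrite eq_le measure_ge0 andbT.
    have le0 : (pi A1 + pi A2 <= 0)%E by rewrite p1 p2 adde0.
    exact: (le_trans (measureU2 _ mA1 mA2) le0).
  move=> [x y] /= H; apply: contrapT => nH; apply: H => _.
  have Ox : Om x by apply: contrapT => nO; apply: nH; left.
  have By : Bx y by apply: contrapT => nB; apply: nH; right.
  rewrite -!EFinD lee_fin /a' /b' !indicE !mem_set// !mulr1 /a /b sqdE.
  have := conj_ge oOm bOm Om1 y phiM Ox; lra.
rewrite ge0_integralD// in key; last 2 first.
- by move=> z _; rewrite lee_fin.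
- by move=> z _; rewrite lee_fin.
rewrite ge0_integralD// in key; last 3 first.
- by move=> z _; rewrite lee_fin sqd_ge0.
- exact: measurable_sqd.
- by move=> z _; rewrite lee_fin mulr_ge0.
rewrite e1 e2 integral_cst// pi1 mule1 -EFinD in key.
rewrite EFin_IO; last exact: (bmeas_sqd_id bG).
have EI : IO Om (fun x => a x + C) + IO Om (fun x => b (G x) + C) =
    IO Om (fun x => sqd x (G x)) + 2 * C.
  have bb : bmeas Om (fun x => b (G x)) by exact: (bmeas_bmap Om bG mb bC).
  have bc := bmeas_cst Om C.
  rewrite (IOD oOm Om1 ba bc) (IOD oOm Om1 bb bc) (IO_cst oOm Om1).
  have <- : IO Om (fun x => a x + b (G x)) = IO Om (fun x => sqd x (G x)).
    apply: IO_ae_eq.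
    have g0 := gap_grad3 oOm bOm Om1 cphi phiM.
    have : {ae leb3 R, forall x, Om x -> gapf Om phi (grad3 phi) x = 0}.
      apply: (bmeas_int_eq0 mOm Omfin).
      - exact: (bmeas_gapf oOm bOm Om1 phiM bG).
      - by apply: aeW => x; exact: (gapf_ge0 oOm bOm Om1 _ phiM).
      - by rewrite -[leLHS]/(gap Om phi (grad3 phi)) g0.
    apply: filterS => x g Ox; have := g Ox; rewrite /gapf -/G sqdE /a /b; lra.
  by rewrite (IOD oOm Om1)//; lra.
rewrite EI EFinD in key.
by move: key; rewrite leeD2rE.
Qed.

Lemma potential_otmap : is_otmap Om nu G.
Proof.
split.
- by apply: measurable_funTS; exact: bG.1.
- by move=> B mB; rewrite lphi.
- exact: potential_optimal.
Qed.

(** [Tm] and [G] have the same law, so the quadratic terms and the conjugate have equal integrals.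
    Being no more expensive than [G], [Tm] has at least its correlation, hence a gap at most 0. *)
Lemma otmap_unique Tm : is_otmap Om nu Tm ->
  {ae leb3 R, forall x, Om x -> Tm x = G x}.
Proof.
move=> [mTm lTm oTm].
pose Bx := [set y : pt R | boxed M y].
have mBx : measurable Bx by exact: measurable_boxed.
have M0 : 0 <= M by exact: (lip_ge0 phiM).
have patchm A : measurable A -> A `<=` Om ->
    measurable_fun setT (fun x => if x \in A then Tm x else 0).
  move=> mA AO; rewrite -(setUv A); apply/measurable_funU => //.
    exact: measurableC.
  split.
    apply: (@eq_measurable_fun _ _ _ _ _ Tm).
      by move=> x /= ->.
    exact: (measurable_funS mOm AO mTm).
  apply: (@eq_measurable_fun _ _ _ _ _ (cst (0 : pt R))); last exact: measurable_cst.
  by move=> x /=; rewrite in_setC => /negbTE ->.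
(* [Tm] is measurable on [Om] only; laws are transported by maps measurable everywhere. *)
pose T2 x := if x \in Om then Tm x else 0.
have mT2 : measurable_fun setT T2 by exact: patchm.
have lT2 : has_law T2 nu.
  move=> B mB; rewrite -(lTm _ mB); apply: (congr1 (leb3 R)).
  by apply/seteqP; split => x [Ox] /=; rewrite /T2 mem_set.
pose A := Om `&` Tm @^-1` Bx.
have mA : measurable A by exact: mTm.
(* A version of [Tm] with all its values in the box; it differs on a null part of [Om], since [nu]
   is carried by the box. *)
pose T' x := if x \in A then Tm x else 0.
have bT' : bmap M T'.
  split; first by apply: patchm => // x [].
  move=> x; rewrite /T'; case: ifPn => [|_]; first by rewrite inE => -[].
  by split; rewrite normr0.
have aeA : {ae leb3 R, forall x, Om x -> A x}.
  exists (Om `&` Tm @^-1` (~` Bx)); split.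
  - by apply: mTm => //; exact: measurableC.
  - rewrite lTm; last exact: measurableC.
    rewrite lphi; last exact: measurableC.
    rewrite (_ : _ `&` _ = set0) ?measure0//.
    by apply/seteqP; split => // x [_] /=; apply; exact: bG.2.
  by move=> x /not_implyP[Ox nA]; split => // Bxx; apply: nA.
have T'Tm : {ae leb3 R, forall x, Om x -> T' x = Tm x}.
  by apply: filterS aeA => x /[apply] Ax; rewrite /T' mem_set.
have IOh h : measurable_fun setT h ->
    IO Om (fun x => h (T' x)) = IO Om (fun x => h (G x)).
  move=> mh; rewrite -(law_IO bG lphi mh) (law_Rintegral mOm mT2 lT2 mh).
  apply: IO_ae_eq; apply: filterS T'Tm => x T'T Ox.
  by rewrite T'T// /T2 mem_set.
have cl := conj_lip oOm bOm Om1 phiM.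
have mcl : measurable_fun setT (conjf Om phi) by exact: (lip_measurable measurableT cl).
have mid : measurable_fun setT (id : pt R -> pt R) by exact: measurable_id.
have lid : has_law id (lebOm Om) by [].
have [pi cpi piE] := coupling_map mid bG.1 lid lphi.
have bsq : bmeas Om (fun x : pt R => dot x x).
  rewrite /dot; apply: bmeasD; [apply: bmeasD|]; apply: bmeasM;
   first [exact: (lip_bmeas oOm bOm (@lip_pt11 R))|exact: (lip_bmeas oOm bOm (@lip_pt12 R))
     |exact: (lip_bmeas oOm bOm (@lip_pt2 R))].
have bself T : bmap M T -> bmeas Om (fun x => dot (T x) (T x)).
  move=> bT; apply: (bmeas_bmap Om bT measurable_dotself (C := M * (3 * M))).
  move=> y By; apply: (le_trans (dot_le y By)); apply: ler_wpM2l => //.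
  exact: boxed_n1.
have IOsqd T : bmap M T -> IO Om (fun x => sqd x (T x)) =
    IO Om (fun x => dot x x) + IO Om (fun x => dot (T x) (T x))
     - 2 * IO Om (fun x => dot x (T x)).
  move=> bT; have bd := bmeas_dot oOm bOm bT; have bs := bself T bT.
  rewrite -(IOZ oOm Om1)// -(IOD oOm Om1)// -(IOB oOm Om1).
  - by congr IO; apply/funext => x; rewrite sqdE.
  - exact: bmeasD.
  - exact: bmeasZ.
have le_cost : IO Om (fun x => sqd x (T' x)) <= IO Om (fun x => sqd x (G x)).
  have := oTm pi cpi; rewrite piE (EFin_IO (bmeas_sqd_id bG)).
  rewrite (_ : (\int[_]_(_ in _) _)%E = (\int[leb3 R]_(x in Om) (sqd x (T' x))%:E)%E).
    by rewrite EFin_IO ?lee_fin//; exact: (bmeas_sqd_id bT').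
  by apply: ae_integral; apply: filterS T'Tm => x T'T Ox; rewrite T'T.
rewrite (IOsqd _ bT') (IOsqd _ bG) (IOh _ measurable_dotself) in le_cost.
have g0 : gap Om phi T' <= 0.
  rewrite -(gap_grad3 oOm bOm Om1 cphi phiM) /gap /gapf.
  have bp := lip_bmeas oOm bOm phiM.
  have b1 := bmeas_bmap_lip Om bT' cl.
  have b2 := bmeas_bmap_lip Om bG cl.
  have b3 := bmeas_dot oOm bOm bT'.
  have b4 := bmeas_dot oOm bOm bG.
  rewrite (IOB oOm Om1)//; last exact: bmeasD.
  rewrite (IOB oOm Om1)//; last exact: bmeasD.
  rewrite (IOD oOm Om1 bp b1) (IOD oOm Om1 bp b2) (IOh _ mcl) lerD2l lerN2.
  by move: le_cost; rewrite lerD2l lerN2 ler_pM2l.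
have := gap_eq0 oOm bOm Om1 cphi phiM bT' g0.
by apply: filterS2 T'Tm => x T'T GT Ox; rewrite -T'T// GT.
Qed.

Lemma potential_brenier : convex_set3 Om -> is_brenier Om nu phi.
Proof.
move=> cOm; split.
- by move=> x y t _ _; exact: cphi.
- have := ae_der3 cphi phiM; apply: filterS => x dx _.
  exact: der3_differentiable.
- split.
    have b := lip_bmeas oOm bOm phiM.
    exact: (bmeas_integrable mOm Omfin (bmeasM b b)).
  move=> v _; have b : bmeas Om (fun x => 'D_v phi x).
    split; first by apply: measurable_funTS; exact: (derive_measurable _ cphi phiM).
    by exists (M * n1 v) => x _; exact: derive_le.
  exact: (bmeas_integrable mOm Omfin (bmeasM b b)).
- rewrite EFin_IO; last exact: (lip_bmeas oOm bOm phiM).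
  by have [_ _ ->] := Kphi.
- exists G; split; first exact: potential_otmap.
  exact: aeW.
Qed.

(** [phi] shows that the choice defining [Bren] succeeds, and uniqueness of optimal maps makes its
    outcome irrelevant for the gradient. *)
Lemma Bren_grad3 : convex_set3 Om ->
  {ae leb3 R, forall x, Om x -> grad3 (Bren Om nu) x = grad3 phi x}.
Proof.
move=> cOm.
have [_ _ _ _ [Tm [oTm TmE]]] : is_brenier Om nu (Bren Om nu).
  by rewrite /Bren; apply: xgetPex; exists phi; exact: potential_brenier.
apply: filterS2 TmE (otmap_unique oTm) => x h1 h2 Ox.
by rewrite h1// h2.
Qed.

End potential_map.

End optimal_maps.

(** * Discrete targets *)

Lemma seq_pos_lower_bound (R : realFieldType) (s : seq R) :
  (forall x, x \in s -> 0 < x) ->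
  exists2 c : R, 0 < c & forall x, x \in s -> c <= x.
Proof.
elim: s => [|y s IH] ps; first by exists 1.
have [|c c0 cs] := IH; first by move=> x xs; apply: ps; rewrite inE xs orbT.
exists (Num.min y c); first by rewrite lt_min c0 ps ?mem_head.
move=> x; rewrite inE => /predU1P[->|/cs cx]; first by rewrite ge_min lexx.
by rewrite ge_min cx orbT.
Qed.

(** * Maxima of finitely many affine functions *)

Section max_affine.
Variables (R : realType) (n : nat) (z : 'I_n.+1 -> pt R).
Implicit Types (w : 'I_n.+1 -> R) (x y : pt R).

(** Its regions of linearity are the cells of the Laguerre diagram of the seeds [z] with weights
    [w]. *)
Definition maff w x : R :=
  let i := [arg max_(i > ord0) (dot x (z i) + w i)%R]%O in dot x (z i) + w i.

Lemma maff_ge w x i : dot x (z i) + w i <= maff w x.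
Proof. by rewrite /maff; case: arg_maxP => // j _; apply. Qed.

Lemma maff_ex w x : exists i, maff w x = dot x (z i) + w i.
Proof. by eexists. Qed.

Lemma maff_cvx w : cvx (maff w).
Proof.
move=> x y t /andP[t0 t1]; have [i ->] := maff_ex w (t *: x + (1 - t) *: y).
rewrite dotC dotDr !dotZr !(dotC (z i)).
have := maff_ge w x i; have := maff_ge w y i.
move: (maff w x) (maff w y) (dot _ _) (dot _ _) => a b c d h1 h2.
have h3 : 0 <= 1 - t by rewrite subr_ge0.
have := ler_wpM2l t0 h2; have := ler_wpM2l h3 h1; lra.
Qed.

Lemma maff_lip M w : (forall i, boxed M (z i)) -> lip M (maff w).
Proof.
move=> bz.
have half x y : maff w x <= maff w y + M * n1 (x - y).
  have [i ->] := maff_ex w x; have := maff_ge w y i.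
  have := dot_le (x - y) (bz i); rewrite dotC dotBl => /(le_trans (ler_norm _)).
  move: (dot x _) (dot y _) (maff _ _) (M * _) => a b c d; lra.
move=> x y; have := half x y; have := half y x.
by rewrite (n1_sym y) ler_norml lerBlDl lerNl opprB lerBlDl => -> ->.
Qed.

Lemma maff_dist w w' (e : R) x : (forall i, `|w i - w' i| <= e) ->
  `|maff w x - maff w' x| <= e.
Proof.
move=> ww'.
have half u u' : (forall i, `|u i - u' i| <= e) -> maff u x <= maff u' x + e.
  move=> uu'; have [i ->] := maff_ex u x; have := maff_ge u' x i.
  have := uu' i; rewrite ler_norml => /andP[_].
  move: (dot x _) (maff _ _) (u i) (u' i) => a b c d; lra.
have h1 := half _ _ ww'.
have h2 : maff w' x <= maff w x + e.
  by apply: half => i; rewrite distrC.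
by move: h1 h2; rewrite ler_norml lerBlDl lerNl opprB lerBlDl => -> ->.
Qed.

Lemma maff_shift w (c : R) x : maff (fun i => w i + c) x = maff w x + c.
Proof.
apply/eqP; rewrite eq_le; apply/andP; split.
  have [i ->] := maff_ex (fun i => w i + c) x.
  by rewrite addrA lerD2r maff_ge.
have [i ->] := maff_ex w x; rewrite -addrA.
exact: (maff_ge (fun i => w i + c) x i).
Qed.

End max_affine.

Lemma gap_budget (R : realFieldType) (p c c' d s s' r : R) : p + c - s = 0 ->
  c' <= c + r -> s' <= d -> s <= s' + r -> p + c' - d <= 2 * r.
Proof. by move=> *; lra. Qed.

Section discrete.
Variables (R : realType) (Om : set (pt R)) (rho : R).
Hypothesis oOm : open Om.
Hypothesis bOm : forall x, Om x -> boxed rho x.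
Hypothesis Om1 : leb3 R Om = 1%E.
Implicit Types (f phi psi : pt R -> R) (x y v p : pt R) (T : pt R -> pt R).

Let mOm : measurable Om. Proof. exact: open_pt_measurable. Qed.
Let Omfin : (leb3 R Om < +oo)%E. Proof. by rewrite Om1 ltry. Qed.
Local Notation IO := (IO Om).

(** The cell of [p] is read off the gradient and not off weights, so that it is defined for every
    potential and seed. *)
Definition chi phi p x : R := \1_[set p] (grad3 phi x).

Lemma chiE phi p x : chi phi p x = (grad3 phi x == p)%:R.
Proof.
rewrite /chi indicE; congr (nat_of_bool _)%:R; apply/idP/eqP; first by rewrite inE.
by move=> ->; rewrite inE.
Qed.

Lemma bmeas_chi M phi p : cvx phi -> lip M phi -> bmeas Om (chi phi p).
Proof.
move=> cf fM; apply: (bmeas_bmap Om (bmap_grad3 cf fM) (C := 1)).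
  apply: measurable_indic.
  rewrite (_ : [set p] = ([set p.1.1] `*` [set p.1.2]) `*` [set p.2]).
    by apply: measurableX; [apply: measurableX|]; exact: measurable_set1.
  case: p => [[p1 p2] p3]; apply/seteqP; split => [_ -> //|].
  by move=> [[x1 x2] x3] /= [[-> ->] ->].
by move=> y _; rewrite indicE; case: (_ \in _); rewrite ?normr1// normr0.
Qed.

Lemma chi_ge0 phi p x : 0 <= chi phi p x.
Proof. by rewrite chiE. Qed.

(* The first moment of the cell of [p], not divided by its mass. *)
Definition bary phi p : pt R :=
  (IO (fun x => chi phi p x * x.1.1), IO (fun x => chi phi p x * x.1.2),
   IO (fun x => chi phi p x * x.2)).

Definition disc n (z : 'I_n -> pt R) (m : 'I_n -> R) (M : R) phi :=
  [/\ potential Om M phi,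
      {ae leb3 R, forall x, Om x -> exists i, grad3 phi x = z i}
    & forall i, IO (chi phi (z i)) = m i].

(** * Semi-discrete transport: cells of prescribed masses *)

Section existence.
Variables (n : nat) (z : 'I_n.+1 -> pt R) (m : 'I_n.+1 -> R) (M : R).
Hypothesis zinj : injective z.
Hypothesis m_gt0 : forall i, 0 < m i.
Hypothesis m_sum : \sum_i m i = 1.
Hypothesis bz : forall i, boxed M (z i).

(* The dual functional of semi-discrete transport: at a minimum the cell of
   [z i] has mass [m i]. *)
Let F w := IO (maff z w) - \sum_i m i * w i.

Let bmaff w : bmeas Om (maff z w).
Proof. exact: (lip_bmeas oOm bOm (maff_lip w bz)). Qed.

Let F_shift w (c : R) : F (fun i => w i + c) = F w.
Proof.
rewrite /F.
have -> : IO (maff z (fun i => w i + c)) = IO (maff z w) + c.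
  rewrite -[X in _ = _ + X](IO_cst oOm Om1) -(IOD oOm Om1)//; last exact: bmeas_cst.
  by congr (IO _); apply/funext => x; exact: maff_shift.
have -> : \sum_i m i * (w i + c) = \sum_i m i * w i + c.
  rewrite (eq_bigr (fun i => m i * w i + m i * c)); last first.
    by move=> i _; rewrite mulrDr.
  by rewrite big_split /= -mulr_suml m_sum mul1r.
by rewrite opprD addrACA subrr addr0.
Qed.

(** Bounds the correlation of a point of [Om] with a seed. *)
Let C := M * (3 * rho).

Let F_ge w : (exists i, w i = 0) -> - C - \sum_i m i * w i <= F w.
Proof.
move=> [i wi0]; rewrite /F lerD2r -[leLHS](IO_cst oOm Om1).
apply: (IO_le oOm Om1) => //; first exact: bmeas_cst.
move=> x Ox; apply: le_trans (maff_ge z w x i); rewrite wi0 addr0.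
have := dot_le x (bz i); rewrite dotC ler_norml => /andP[+ _].
apply: le_trans; rewrite lerN2; apply: ler_wpM2l; first exact: (boxed_ge0 (bz i)).
exact/boxed_n1/bOm.
Qed.

Let F0_le : F (fun=> 0) <= C.
Proof.
rewrite /F big1 ?subr0; last by move=> i _; rewrite mulr0.
rewrite -[leRHS](IO_cst oOm Om1); apply: (IO_le oOm Om1) => //.
  exact: bmeas_cst.
move=> x Ox; have [i ->] := maff_ex z (fun=> 0) x; rewrite addr0 dotC.
apply: (le_trans (ler_norm _)); apply: (le_trans (dot_le x (bz i))).
apply: ler_wpM2l; first exact: (boxed_ge0 (bz i)).
exact/boxed_n1/bOm.
Qed.

(** Only differences of weights matter to [F]. Setting the largest one to 0 is what bounds
    minimising sequences. *)
Let normalize w : exists w', [/\ F w' = F w, forall i, w' i <= 0 &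
  exists i, w' i = 0].
Proof.
pose j := [arg max_(j > ord0) w j]%O.
exists (fun i => w i - w j); split; first exact: F_shift.
  by move=> i; rewrite subr_le0 /j; case: arg_maxP => // k _; apply.
by exists j; rewrite subrr.
Qed.

Let F_lb w : - C <= F w.
Proof.
have [w' [<- w'0 ex0]] := normalize w; apply: le_trans (F_ge ex0).
rewrite lerBrDl addrC -lerBrDl subrr; apply: sumr_le0 => i _.
by rewrite pmulr_rle0// w'0.
Qed.

Let F_min : exists w, forall w', F w <= F w'.
Proof.
pose S := [set F w | w in setT].
have Sinf : has_inf S.
  split; first by exists (F (fun=> 0)), (fun=> 0).
  by exists (- C) => _ [w _ <-]; exact: F_lb.
have /choice[w wP] : forall k : nat, exists w, [/\ F w <= inf S + k.+1%:R^-1,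
    forall i, w i <= 0 & exists i, w i = 0].
  move=> k; have k0 : 0 < k.+1%:R^-1 :> R by [].
  have [_ [w _ <-] wk] := inf_adherent k0 Sinf.
  have [w' [Fw' w'0 ex0]] := normalize w.
  by exists w'; split => //; rewrite Fw' ltW.
have infC : inf S <= C.
  by apply: le_trans F0_le; apply: ge_inf; [case: Sinf|exists (fun=> 0)].
(* For normalised weights [F] is at least [- C] plus the nonnegative terms [- m i * w i], and along
   the sequence it is at most [C + 1]: each term is at most [2 * C + 1], which bounds the weight as
   its mass is positive. *)
pose B := \sum_i (2 * C + 1) / m i.
have C0 : 0 <= C.
  by rewrite /C mulr_ge0 ?(boxed_ge0 (bz ord0))// mulr_ge0// (rho_ge0 bOm Om1).
have wB i k : `|w k i| <= B.
  have [Fk w0 ex0] := wP k.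
  have h1 := F_ge ex0.
  have h2 : m i * - w k i <= - \sum_i m i * w k i.
    rewrite -sumrN (bigD1 i)//= mulrN lerDl; apply: sumr_ge0 => j _.
    by rewrite oppr_ge0 pmulr_rle0.
  have h3 : k.+1%:R^-1 <= 1 :> R by rewrite invf_le1// ler1n.
  have h4 : m i * - w k i <= 2 * C + 1.
    move: h1 h2 Fk infC h3; move: (\sum_i _) (F _) (m i * _) (inf S) (_^-1).
    move=> a b c d e h1 h2 h3 h4 h5; lra.
  rewrite ler0_norm//; apply: (@le_trans _ _ ((2 * C + 1) / m i)).
    by rewrite ler_pdivlMr// mulrC.
  rewrite /B (bigD1 i)//= lerDl; apply: sumr_ge0 => j _.
  by rewrite divr_ge0 ?(ltW (m_gt0 _))// addr_ge0// mulr_ge0.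
have [U [UU Uoo]] := exists_ultra.
pose w' i := ulim U (w^~ i); exists w' => v.
apply/ler_addgt0Pr => e e0; have e4 : 0 < e / 4 by rewrite divr_gt0.
have [k ke] : exists k : nat, k.+1%:R^-1 <= e / 4.
  exists (Num.truncn (4 / e)); rewrite -[e / 4]invf_div lef_pV2 ?posrE ?divr_gt0//.
  exact/ltW/truncnS_gt.
have := ultra_fin UU (fun i => ulim_near UU (wB i) e4).
move=> /(filterI (ultra_ge Uoo k))/filter_ex[l [/= kl wl]].
have [Fl _ _] := wP l.
have h1 : inf S <= F v by apply: ge_inf; [case: Sinf|exists v].
have h2 : l.+1%:R^-1 <= k.+1%:R^-1 :> R by rewrite lef_pV2 ?posrE// ler_nat ltnS.
have h3 : IO (maff z w') <= IO (maff z (w l)) + e / 4.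
  rewrite -[X in _ <= _ + X](IO_cst oOm Om1) -(IOD oOm Om1)//; last exact: bmeas_cst.
  apply: (IO_le oOm Om1) => //; first by apply: bmeasD => //; exact: bmeas_cst.
  move=> x _; have := maff_dist z x wl; rewrite ler_norml => /andP[+ _].
  move: (maff _ _ _) (maff _ _ _) => a b; lra.
have h4 : \sum_i m i * w l i <= \sum_i m i * w' i + e / 4.
  have -> : e / 4 = \sum_i m i * (e / 4) by rewrite -mulr_suml m_sum mul1r.
  rewrite -big_split /=; apply: ler_sum => i _; rewrite -mulrDr ler_pM2l//.
  by have := wl i; rewrite -/(w' i) ler_norml => /andP[_]; lra.
move: Fl h1 h2 h3 h4 ke; rewrite /F.
move: (IO _) (IO _) (\sum_i _) (\sum_i _) (\sum_i _) (IO _) (inf S) (l.+1%:R^-1)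
  (k.+1%:R^-1) => a b c d g h i u w0; lra.
Qed.

(** First-order optimality by a one-sided variation: raising the weight [w i] by [k.+1%:R^-1] cannot
    lower [F], so the set where the [i]-th affine piece is within that distance of the maximum has
    measure at least [m i]. As [k] grows these sets shrink to the cell up to a null set. *)
Lemma disc_exists : exists phi, disc z m M phi.
Proof.
have [w wmin] := F_min.
(* A common shift of the weights gives mean zero and keeps the minimum. *)
pose w' i := w i - IO (maff z w).
pose phi := maff z w'.
have cphi : cvx phi by exact: maff_cvx.
have phiM : lip M phi by exact: maff_lip.
have phiE x : phi x = maff z w x - IO (maff z w) by exact: maff_shift.
have I0 : IO phi = 0.
  have -> : phi = fun x => maff z w x - IO (maff z w) by apply/funext.
  rewrite (IOB oOm Om1)//; last exact: bmeas_cst.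
  by rewrite (IO_cst oOm Om1) subrr.
have w'min (u : 'I_n.+1 -> R) : F w' <= F u by rewrite /w' F_shift.
have grad_cell x i : der3 phi x -> phi x = dot x (z i) + w' i -> grad3 phi x = z i.
  move=> dx xi; apply/esym; apply: (@subgrad_grad3 _ setT openT _ x) => // y _.
  rewrite xi (dotC (z i)) dotBl; have := maff_ge z w' y i; rewrite -/phi -/(phi y).
  by move: (dot _ _) (dot _ _) (phi y) (w' i) => a b c d; lra.
exists phi.
have aez : {ae leb3 R, forall x, Om x -> exists i, grad3 phi x = z i}.
  have := ae_der3 cphi phiM; apply: filterS => x dx _.
  by have [i xi] := maff_ex z w' x; exists i; exact: grad_cell.
have chi_ge i : m i <= IO (chi phi (z i)).
  pose A k x := dot x (z i) + w' i + k.+1%:R^-1 >= phi x.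
  pose a k x : R := (A k x)%:R.
  have ba k : bmeas Om (a k).
    split; last by exists 1 => x _; rewrite /a; case: (A k x); rewrite ?normr1// normr0.
    apply: measurable_funTS.
    have -> : a k = \1_[set x | A k x].
      by apply/funext => x; rewrite indicE /a; congr ((nat_of_bool _)%:R); apply/idP/idP; rewrite inE.
    apply: measurable_indic; apply: closed_pt_measurable.
    have -> : [set x | A k x] = (fun x => dot x (z i) - phi x) @^-1`
        [set r | - (w' i + k.+1%:R^-1) <= r].
      apply/seteqP; split => x; rewrite /A /=;
      move: (dot _ _) (phi x) (k.+1%:R^-1) => b c d; lra.
    have /continuous_closedP : continuous (fun x => dot x (z i) - phi x).
      apply: (@lip_continuous _ (M + M)) => x y.
      have -> : dot x (z i) - phi x - (dot y (z i) - phi y) =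
          (dot x (z i) - dot y (z i)) + (phi y - phi x).
        by move: (dot _ _) (dot _ _) (phi x) (phi y) => b c d e; ring.
      rewrite mulrDl.
      apply: (le_trans (ler_normD _ _)); apply: lerD.
        by rewrite -dotBl dotC; exact: dot_le.
      by rewrite distrC; exact: phiM.
    by apply; exact: closed_ge.
  have mk k : m i <= IO (a k).
    have k0 : 0 < k.+1%:R^-1 :> R by [].
    pose v j := w' j + (j == i)%:R * k.+1%:R^-1.
    have := w'min v; rewrite /F -/phi => h1.
    have h2 : \sum_j m j * v j = \sum_j m j * w' j + m i * k.+1%:R^-1.
      rewrite (eq_bigr (fun j => m j * w' j + m j * ((j == i)%:R * k.+1%:R^-1))); last first.
        by move=> j _; rewrite mulrDr.
      rewrite big_split /=; congr (_ + _); rewrite (bigD1 i)//= eqxx mul1r.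
      by rewrite big1 ?addr0// => j /negbTE ->; rewrite mul0r mulr0.
    have h3 : IO (maff z v) <= IO phi + k.+1%:R^-1 * IO (a k).
      rewrite -(IOZ oOm Om1)// -(IOD oOm Om1)//; last 2 first.
      - exact: bmaff.
      - exact: bmeasZ.
      apply: (IO_le oOm Om1) => //; first by apply: bmeasD; [exact: bmaff|exact: bmeasZ].
      move=> x _; have [j ->] := maff_ex z v x.
      have h4 := maff_ge z w' x j; rewrite -/(phi x) in h4.
      have a0 : 0 <= k.+1%:R^-1 * a k x by rewrite mulr_ge0.
      rewrite /v; case: eqVneq => [ji|_]; last first.
        by rewrite mul0r addr0; apply: (le_trans h4); rewrite lerDl.
      rewrite mul1r; subst j.
      have [Akx|nA] := boolP (A k x).
        by rewrite /a Akx mulr1 addrA lerD2r.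
      move: nA; rewrite /A -ltNge => /ltW; rewrite -addrA => /le_trans; apply.
      by rewrite lerDl.
    rewrite -(ler_pM2l k0).
    move: h1 h2 h3; rewrite mulrC.
    move: (IO _) (IO _) (k.+1%:R^-1 * _) (\sum_j _) (\sum_j _) (_ * m i) => b c d e g h.
    move=> h1 h2 h3; lra.
  pose le_i x : bool := phi x <= dot x (z i) + w' i.
  pose b x : R := (le_i x)%:R.
  have cva x : a k x @[k --> \oo] --> b x.
    rewrite /b /le_i; have [xi|xi] := leP (phi x) (dot x (z i) + w' i).
      have -> : (a^~ x) = fun=> 1.
        by apply/funext => k; rewrite /a /A (le_trans xi)// lerDl.
      exact: cvg_cst.
    apply/cvgrPdist_le => e e0; near=> k.
    have : k.+1%:R^-1 < phi x - (dot x (z i) + w' i).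
      by near: k; apply: (near_infty_natSinv_lt (PosNum _)); rewrite subr_gt0.
    rewrite ltrBrDl => h; rewrite /a (_ : A k x = false) ?subrr ?normr0 ?ltW//.
    by apply/negbTE; rewrite /A -ltNge.
  have mle : measurable_fun Om b.
    by apply: (measurable_fun_cvg (h := a)) => [k|x _]; [case: (ba k)|exact: cva].
  have a1 k x : Om x -> `|a k x| <= 1.
    by move=> _; rewrite /a; case: (A k x); rewrite ?normr1// normr0.
  have cvI := bmeas_int_cvg mOm Omfin ba mle a1 (aeW _ (fun x _ => cva x)).
  have : m i <= IO b.
    rewrite /IO -(cvg_lim (@Rhausdorff R) cvI); apply: limr_ge.
      by apply/cvg_ex; eexists; exact: cvI.
    by apply: nearW => k; exact: mk.
  move=> /le_trans; apply; apply: (IO_ae_le oOm Om1).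
  - by split => //; exists 1 => x _; rewrite /b; case: (le_i x); rewrite ?normr1// normr0.
  - exact: (bmeas_chi _ cphi phiM).
  have := ae_der3 cphi phiM; apply: filterS => x dx _.
  rewrite /b /le_i.
  have [xi|_] := leP (phi x) (dot x (z i) + w' i); last by rewrite /= chi_ge0.
  rewrite chiE (grad_cell x i)//; first by rewrite eqxx.
  by apply/eqP; rewrite eq_le xi maff_ge.
split => //.
have bchi i : bmeas Om (chi phi (z i)) by exact: (bmeas_chi _ cphi phiM).
(* Cells of distinct seeds are disjoint, so the lower bounds [m i], which add up to 1, are
   attained. *)
have sum_le1 : \sum_i IO (chi phi (z i)) <= 1.
  rewrite -(IO_sum oOm Om1)// -[leRHS](IO_cst oOm Om1).
  apply: (IO_le oOm Om1).
  - exact: bmeas_sum.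
  - exact: bmeas_cst.
  move=> x _.
  have [[i xi]|nx] := pselect (exists i, grad3 phi x = z i); last first.
    rewrite big1// => i _; rewrite chiE; case: eqP => // xi.
    by exfalso; apply: nx; exists i.
  rewrite (bigD1 i)//= chiE xi eqxx big1 ?addr0// => j ji.
  by rewrite chiE xi (inj_eq zinj) eq_sym (negbTE ji).
move=> i; apply/eqP; rewrite eq_le chi_ge andbT.
move: sum_le1; rewrite -m_sum (bigD1 i)//= [X in _ <= X](bigD1 i)//=.
have : \sum_(j < n.+1 | j != i) m j <= \sum_(j < n.+1 | j != i) IO (chi phi (z j)).
  by apply: ler_sum => j _; exact: chi_ge.
move: (IO _) (m i) (\sum_(_ < _ | _) _) (\sum_(_ < _ | _) _) => a b c d; lra.
Unshelve. all: by end_near. Qed.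

End existence.

(** * Comparison of discrete potentials with common masses *)

Section calculus.
Variables (n : nat) (m : 'I_n -> R) (M : R).
Hypothesis m_ge0 : forall i, 0 <= m i.
Hypothesis m_sum : \sum_i m i = 1.

Lemma disc_decomp (z : 'I_n -> pt R) phi (F : pt R -> pt R -> R) :
  injective z -> disc z m M phi -> (forall i, bmeas Om (F^~ (z i))) ->
  IO (fun x => F x (grad3 phi x)) = \sum_i IO (fun x => chi phi (z i) x * F x (z i)).
Proof.
move=> zinj [[cphi phiM _] aez _] bF.
rewrite -(IO_sum oOm Om1); last first.
  by move=> i; apply: bmeasM => //; exact: (bmeas_chi _ cphi phiM).
apply: IO_ae_eq; apply: filterS aez => x /[apply] -[i xi].
rewrite (bigD1 i)//= chiE xi eqxx mul1r big1 ?addr0// => j ji.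
by rewrite chiE xi (inj_eq zinj) eq_sym (negbTE ji) mul0r.
Qed.

Lemma disc_int (z : 'I_n -> pt R) phi (h : pt R -> R) :
  injective z -> disc z m M phi ->
  IO (fun x => h (grad3 phi x)) = \sum_i m i * h (z i).
Proof.
move=> zinj dp; rewrite (disc_decomp (F := fun _ y => h y) zinj dp); last first.
  by move=> i; exact: bmeas_cst.
have [[cphi phiM _] _ mE] := dp.
apply: eq_bigr => i _; rewrite -mE [RHS]mulrC -(IOZ oOm Om1); last first.
  exact: (bmeas_chi _ cphi phiM).
by congr (IO _); apply/funext => x; rewrite mulrC.
Qed.

Lemma bary_dot phi p v : cvx phi -> lip M phi ->
  IO (fun x => chi phi p x * dot x v) = dot (bary phi p) v.
Proof.
move=> cphi phiM; have bc := bmeas_chi p cphi phiM.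
have h (q : pt R -> R) (c : R) : lip 1 q ->
    bmeas Om (fun x => chi phi p x * q x * c) /\
    IO (fun x => chi phi p x * q x * c) = IO (fun x => chi phi p x * q x) * c.
  move=> lq; have bq := bmeasM bc (lip_bmeas oOm bOm lq).
  split; first by apply: bmeasM => //; exact: bmeas_cst.
  rewrite [RHS]mulrC -(IOZ oOm Om1)//.
  by congr (IO _); apply/funext => x; rewrite mulrC.
have [b1 i1] := h _ v.1.1 (@lip_pt11 R).
have [b2 i2] := h _ v.1.2 (@lip_pt12 R).
have [b3 i3] := h _ v.2 (@lip_pt2 R).
rewrite {2}/dot /bary /= -i1 -i2 -i3 -(IOD oOm Om1)// -(IOD oOm Om1)//; last exact: bmeasD.
by congr (IO _); apply/funext => x; rewrite /dot; ring.
Qed.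

Lemma bmeas_dotv v : bmeas Om (fun x => dot x v).
Proof.
apply: (lip_bmeas oOm bOm (M := n1 v)) => x y.
by rewrite -dotBl dotC; exact/dot_le/boxed_self.
Qed.

Lemma disc_dot (z : 'I_n -> pt R) phi : injective z -> disc z m M phi ->
  IO (fun x => dot x (grad3 phi x)) = \sum_i dot (bary phi (z i)) (z i).
Proof.
move=> zinj dp; rewrite (disc_decomp (F := fun x y => dot x y) zinj dp); last first.
  by move=> i; exact: bmeas_dotv.
by have [[cphi phiM _] _ _] := dp; apply: eq_bigr => i _; rewrite (bary_dot _ _ cphi phiM).
Qed.

(** Divided by the mass of the cell this places its barycentre in the box of [Om], whence a speed
    bound independent of the masses. *)
Lemma bary_le z0 phi : cvx phi -> lip M phi ->
  boxed (rho * IO (chi phi z0)) (bary phi z0).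
Proof.
move=> cphi phiM; have bc := bmeas_chi z0 cphi phiM.
have h (q : pt R -> R) : lip 1 q -> (forall x, Om x -> `|q x| <= rho) ->
    `|IO (fun x => chi phi z0 x * q x)| <= rho * IO (chi phi z0).
  move=> lq qb; rewrite -[IO (fun x => chi phi z0 x * q x)]subr0 -[X in _ - X](IO_cst oOm Om1).
  rewrite -(IOZ oOm Om1)//; apply: (IO_dist oOm Om1).
  - exact: (bmeasM bc (lip_bmeas oOm bOm lq)).
  - exact: bmeas_cst.
  - exact: bmeasZ.
  apply: aeW => x Ox; rewrite subr0 normrM (ger0_norm (chi_ge0 _ _ _)) mulrC.
  by rewrite ler_wpM2r ?chi_ge0// qb.
split; apply: h; first [exact: lip_pt11|exact: lip_pt12|exact: lip_pt2|by move=> x /bOm[]].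
Qed.

Variables (z z' : 'I_n -> pt R) (phi phi' : pt R -> R).
Hypotheses (zinj : injective z) (zinj' : injective z').
Hypotheses (dz : disc z m M phi) (dz' : disc z' m M phi').

Let cphi : cvx phi. Proof. by case: dz => -[]. Qed.
Let phiM : lip M phi. Proof. by case: dz => -[]. Qed.
Let cphi' : cvx phi'. Proof. by case: dz' => -[]. Qed.
Let phiM' : lip M phi'. Proof. by case: dz' => -[]. Qed.

Let gap_split psi T : cvx psi -> lip M psi -> bmap M T ->
  gap Om psi T = IO psi + IO (fun x => conjf Om psi (T x)) - IO (fun x => dot x (T x)).
Proof.
move=> cp pM by_.
have bp := lip_bmeas oOm bOm pM.
have bc := bmeas_bmap_lip Om by_ (conj_lip oOm bOm Om1 pM).
have bd := bmeas_dot oOm bOm by_.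
by rewrite /gap /gapf (IOB oOm Om1 (bmeasD bp bc) bd) (IOD oOm Om1 bp bc).
Qed.

(* Transporting the cells of the first partition to the second seeds is an
   admissible plan, hence no better than the optimal one. *)
Lemma disc_corr_le : \sum_i dot (bary phi (z i)) (z' i) <=
  IO (fun x => dot x (grad3 phi' x)).
Proof.
have g0 := gap_grad3 oOm bOm Om1 cphi' phiM'.
rewrite (gap_split cphi' phiM' (bmap_grad3 cphi' phiM')) in g0.
have -> : IO (fun x => dot x (grad3 phi' x)) = IO phi' +
    IO (fun x => conjf Om phi' (grad3 phi' x)) by move: g0; lra.
rewrite (disc_int _ zinj' dz').
have bp := lip_bmeas oOm bOm phiM'.
have bc i := bmeas_chi (z i) cphi phiM.
have -> : IO phi' = \sum_i IO (fun x => chi phi (z i) x * phi' x).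
  by rewrite -(disc_decomp (F := fun x _ => phi' x) zinj dz).
rewrite -big_split /=; apply: ler_sum => i _.
have [_ _ mE] := dz; rewrite -(bary_dot _ _ cphi phiM) -(mE i) mulrC -(IOZ oOm Om1)//.
have bcp : bmeas Om (fun x => chi phi (z i) x * phi' x) by exact: bmeasM.
rewrite -(IOD oOm Om1)//; last exact: bmeasZ.
apply: (IO_le oOm Om1).
- by apply: bmeasM => //; exact: bmeas_dotv.
- by apply: bmeasD => //; exact: bmeasZ.
move=> x Ox; rewrite [_ * chi _ _ _]mulrC -mulrDr ler_wpM2l ?chi_ge0//.
by have := conj_ge oOm bOm Om1 (z' i) phiM' Ox; lra.
Qed.

(** Replacing the seeds costs [rho * d] in the conjugate and again in the correlation. Both are
    averages with weights [m i] of total mass 1, so the number of seeds does not enter. *)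
Lemma disc_gap_le (d : R) : (forall i, n1 (z i - z' i) <= d) ->
  gap Om phi (grad3 phi') <= 2 * rho * d.
Proof.
move=> zd; have rho0 := rho_ge0 bOm Om1.
rewrite (gap_split cphi phiM (bmap_grad3 cphi' phiM')).
have g0 := gap_grad3 oOm bOm Om1 cphi phiM.
rewrite (gap_split cphi phiM (bmap_grad3 cphi phiM)) in g0.
have h1 : IO (fun x => conjf Om phi (grad3 phi' x)) <=
    IO (fun x => conjf Om phi (grad3 phi x)) + rho * d.
  rewrite (disc_int (conjf Om phi) zinj' dz') (disc_int (conjf Om phi) zinj dz).
  have -> : rho * d = \sum_i m i * (rho * d) by rewrite -mulr_suml m_sum mul1r.
  rewrite -big_split /=; apply: ler_sum => i _; rewrite -mulrDr ler_wpM2l//.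
  have := conj_lip oOm bOm Om1 phiM (z' i) (z i); rewrite ler_norml => /andP[_].
  have := ler_wpM2l rho0 (zd i); rewrite (n1_sym (z i)).
  move: (conjf _ _ _) (conjf _ _ _) (rho * n1 _) (rho * d) => a b c e; lra.
have h2 := disc_corr_le.
have h3 : \sum_i dot (bary phi (z i)) (z i) <=
    \sum_i dot (bary phi (z i)) (z' i) + rho * d.
  have -> : rho * d = \sum_i m i * (rho * d) by rewrite -mulr_suml m_sum mul1r.
  rewrite -big_split /=; apply: ler_sum => i _.
  have [_ _ mE] := dz.
  have := dot_le (z i - z' i) (bary_le (z i) cphi phiM); rewrite mE dotBr.
  move=> /(le_trans (ler_norm _)) h.
  rewrite -lerBlDl; apply: (le_trans h); rewrite [rho * m i]mulrC -mulrA ler_wpM2l//.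
  exact: ler_wpM2l.
rewrite (disc_dot zinj dz) in g0.
by rewrite -mulrA; exact: (gap_budget g0 h1 h2 h3).
Qed.

(** A Chebyshev estimate: where [x] changes cell the two gradients are at least [s / 2] apart, so
    [2 / s] times their distance bounds the difference of the indicators. The 6 is this 2 times
    three coordinates. *)
Lemma bary_dist (s : R) : 0 < s ->
  (forall i j, i != j -> s <= n1 (z i - z j)) ->
  (forall i, n1 (z i - z' i) <= s / 2) ->
  forall i, n1 (bary phi (z i) - bary phi' (z' i)) <=
    6 * rho / s * gdist Om phi phi'.
Proof.
move=> s0 zs zz' i.
have [[_ _ _] aez _] := dz; have [[_ _ _] aez' _] := dz'.
have bc := bmeas_chi (z i) cphi phiM.
have bc' := bmeas_chi (z' i) cphi' phiM'.
have bn := bmeas_n1B Om (bmap_grad3 cphi phiM) (bmap_grad3 cphi' phiM').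
have rho0 := rho_ge0 bOm Om1.
have aec : {ae leb3 R, forall x, Om x -> `|chi phi (z i) x - chi phi' (z' i) x| <=
    2 / s * n1 (grad3 phi x - grad3 phi' x)}.
  apply: filterS2 aez aez' => x h h' Ox.
  have [a xa] := h Ox; have [b xb] := h' Ox.
  rewrite !chiE xa xb (inj_eq zinj) (inj_eq zinj').
  have [ab|ab] := eqVneq a b.
    by rewrite ab subrr normr0 mulr_ge0 ?n1_ge0// divr_ge0// ltW.
  apply: (@le_trans _ _ 1).
    by case: (a == i); case: (b == i); rewrite ?subrr ?normr0 ?subr0 ?sub0r ?normrN ?normr1.
  rewrite mulrAC ler_pdivlMr// mul1r.
  have := zs a b ab; have := zz' b.
  have := n1_triangle (z a) (z' b) (z b); rewrite (n1_sym (z' b)).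
  move: (n1 _) (n1 _) (n1 _) => u v w; lra.
have h (q : pt R -> R) : lip 1 q -> (forall x, Om x -> `|q x| <= rho) ->
    `|IO (fun x => chi phi (z i) x * q x) - IO (fun x => chi phi' (z' i) x * q x)|
    <= 2 * rho / s * gdist Om phi phi'.
  move=> lq qb; have bq := lip_bmeas oOm bOm lq.
  rewrite /gdist -(IOZ oOm Om1)//; apply: (IO_dist oOm Om1).
  - exact: bmeasM.
  - exact: bmeasM.
  - exact: bmeasZ.
  apply: filterS aec => x hx Ox; rewrite -mulrBl normrM mulrC.
  apply: (le_trans (ler_pM (normr_ge0 _) (normr_ge0 _) (qb x Ox) (hx Ox))).
  by rewrite le_eqVlt; apply/orP; left; apply/eqP; ring.
have h1 := h _ (@lip_pt11 R) (fun x Ox => let: And3 a _ _ := bOm Ox in a).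
have h2 := h _ (@lip_pt12 R) (fun x Ox => let: And3 _ a _ := bOm Ox in a).
have h3 := h _ (@lip_pt2 R) (fun x Ox => let: And3 _ _ a := bOm Ox in a).
rewrite /n1 /bary /=; apply: (le_trans (lerD (lerD h1 h2) h3)).
by rewrite le_eqVlt; apply/orP; left; apply/eqP; ring.
Qed.

End calculus.

Lemma bary_continuous n (m : 'I_n -> R) (M : R) (z : 'I_n -> pt R) phi :
  (forall i, 0 <= m i) -> \sum_i m i = 1 -> injective z -> disc z m M phi ->
  forall e : R, 0 < e -> exists2 eta, 0 < eta & forall z' phi',
    injective z' -> disc z' m M phi' -> (forall i, n1 (z i - z' i) <= eta) ->
    forall i, n1 (bary phi (z i) - bary phi' (z' i)) <= e.
Proof.
move=> m0 m1 zinj dz e e0; have rho0 := rho_ge0 bOm Om1.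
(* The modulus obtained depends on the separation of the seeds [z]; Peano's theorem asks for
   continuity at each configuration only. *)
pose s := [seq n1 (z q.1 - z q.2) | q : 'I_n * 'I_n <- enum {: 'I_n * 'I_n} & q.1 != q.2].
have [x /mapP[[a b]]|c c0 cs] := @seq_pos_lower_bound R s.
  rewrite mem_filter /= => /andP[ab _] ->.
  rewrite lt_neqAle n1_ge0 andbT eq_sym; apply/eqP => /n1_eq0/zinj/eqP.
  by rewrite (negbTE ab).
have zc i j : i != j -> c <= n1 (z i - z j).
  by move=> ij; apply: cs; apply/mapP; exists (i, j) => //; rewrite mem_filter /= ij mem_enum.
pose K := 6 * rho / c + 1.
have K0 : 0 < K by rewrite ltr_wpDl// divr_ge0 ?mulr_ge0// ltW.
have [d d0 dP] := gap_stability oOm bOm Om1 M (divr_gt0 e0 K0).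
have r1 : 0 < 2 * rho + 1 by rewrite ltr_wpDl// mulr_ge0.
exists (Num.min (c / 2) (d / (2 * rho + 1))).
  by rewrite lt_min !divr_gt0.
move=> z' phi' zinj' dz' zz' i.
have zz1 j : n1 (z j - z' j) <= c / 2.
  by apply: (le_trans (zz' j)); rewrite ge_min lexx.
have zz2 j : n1 (z j - z' j) <= d / (2 * rho + 1).
  by apply: (le_trans (zz' j)); rewrite ge_min lexx orbT.
apply: (le_trans (bary_dist zinj zinj' dz dz' c0 zc zz1 i)).
have [K1 _ _] := dz; have [K2 _ _] := dz'.
have gd : gdist Om phi phi' <= e / K.
  apply: (dP _ _ K1 K2).
  apply: (le_trans (disc_gap_le m0 m1 zinj zinj' dz dz' zz2)).
  by rewrite mulrA ler_pdivrMr// mulrC ler_pM2l// lerDl.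
have g0 := gdist_ge0 Om phi phi'.
have : 6 * rho / c <= K by rewrite lerDl.
move=> /(ler_wpM2r g0)/le_trans; apply.
by move: gd; rewrite ler_pdivlMr// mulrC.
Qed.

End discrete.

(** * A Peano theorem *)

Lemma le_small (R : realType) (x y K : R) :
  (forall e, 0 < e -> e <= 1 -> x <= y + K * e) -> x <= y.
Proof.
move=> H; apply/ler_addgt0Pr => e e0.
have K0 : 0 < `|K| + 1 by rewrite ltr_wpDl.
pose d := Num.min 1 (e / (`|K| + 1)).
have d0 : 0 < d by rewrite lt_min ltr01 divr_gt0.
have d1 : d <= 1 by rewrite ge_min lexx.
have de : d <= e / (`|K| + 1) by rewrite ge_min lexx orbT.
apply: (le_trans (H d d0 d1)); rewrite lerD2l.
apply: (@le_trans _ _ (`|K| * d)); first by rewrite ler_wpM2r ?ler_norm// ltW.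
move: de; rewrite ler_pdivlMr// mulrC mulrDl mul1r; apply: le_trans.
by rewrite lerDl ltW.
Qed.

Lemma span_le (R : realFieldType) (a b u d h : R) :
  a <= b -> `|b - u| <= h -> u <= d -> a <= d + h.
Proof. by move=> ab; rewrite ler_norml => /andP[_ bu] ud; lra. Qed.

Section peano.
Variables (R : realType) (I : finType) (F : (I -> R) -> I -> R) (y0 : I -> R).
Variables (B0 rho S : R).
Hypotheses (rho0 : 0 <= rho) (S0 : 0 < S) (B00 : 0 <= B0).
Variable M : R.
Hypothesis ME : M = expR S * (B0 + rho).
Hypothesis y0B : forall i, `|y0 i| <= B0.
Hypothesis growth : forall B y, (forall i, `|y i| <= B) -> B + rho <= M ->
  forall i, `|F y i| <= B + rho.
Hypothesis cont : forall y, (forall i, `|y i| <= M) -> forall e : R, 0 < e ->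
  exists2 eta, 0 < eta & forall y', (forall i, `|y' i| <= M) ->
    (forall i, `|y i - y' i| <= eta) -> forall i, `|F y i - F y' i| <= e.

Fixpoint euler (n k : nat) : I -> R :=
  if k is k'.+1 then fun i => euler n k' i + n.+1%:R^-1 * F (euler n k') i
  else y0.

(** The index of the last node of the Euler scheme before the time [k], for nonnegative [k]. *)
Let step n k := Num.truncn (k * n.+1%:R : R).

Let M0 : 0 <= M. Proof. by rewrite ME mulr_ge0 ?expR_ge0// addr_ge0. Qed.

(** Discrete Gronwall: the bound plus [rho] grows by the factor [1 + h] at each step, hence by at
    most [expR S] in all. This is the origin of [M]. *)
Let euler_bound n k : k%:R * n.+1%:R^-1 <= S ->
  forall i, `|euler n k i| + rho <= M.
Proof.
move=> kS; set h : R := n.+1%:R^-1 in kS.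
have h0 : 0 <= h by rewrite invr_ge0.
pose b j := (1 + h) ^+ j * (B0 + rho) - rho.
have bM j : (j <= k)%N -> b j + rho <= M.
  move=> jk; rewrite /b subrK ME ler_wpM2r ?addr_ge0//.
  apply: (@le_trans _ _ (expR h ^+ j)).
    by rewrite lerXn2r ?nnegrE ?expR_ge0 ?addr_ge0// expR_ge1Dx.
  rewrite -expRM_natl ler_expR (le_trans _ kS)//.
  by rewrite ler_wpM2r// ler_nat.
suff H j : (j <= k)%N -> forall i, `|euler n j i| <= b j.
  by move=> i; rewrite (le_trans _ (bM k _))// lerD2r H.
elim: j => [_ i|j IH jk i]; first by rewrite /b expr0 mul1r addrK y0B.
have /= := growth (IH (ltnW jk)) (bM j (ltnW jk)) i => Fb.
apply: (le_trans (ler_normD _ _)); rewrite normrM (ger0_norm h0).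
apply: (@le_trans _ _ (b j + h * (b j + rho))).
  by apply: lerD; [exact: IH (ltnW jk) i|exact: ler_wpM2l].
by rewrite /b exprS le_eqVlt; apply/orP; left; apply/eqP; ring.
Qed.

Let euler_incr n k l i (c e : R) : (k <= l)%N ->
  (forall j, (k <= j < l)%N -> `|F (euler n j) i - c| <= e) ->
  `|euler n l i - euler n k i - (l - k)%:R * n.+1%:R^-1 * c| <=
    (l - k)%:R * n.+1%:R^-1 * e.
Proof.
move=> kl; set h : R := n.+1%:R^-1; have h0 : 0 <= h by rewrite invr_ge0.
elim: l kl => [|l IH].
  by rewrite leqn0 => /eqP -> _; rewrite subnn !mul0r subrr subr0 normr0.
rewrite leq_eqVlt => /predU1P[-> _|].
  by rewrite subnn !mul0r subrr subr0 normr0.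
rewrite ltnS => kl H; rewrite subSn// -natr1.
have Hl := H l; rewrite kl ltnSn in Hl; have {}Hl := Hl isT.
have -> : euler n l.+1 i - euler n k i - ((l - k)%:R + 1) * h * c =
  (euler n l i - euler n k i - (l - k)%:R * h * c) + h * (F (euler n l) i - c).
  rewrite /= -/h; move: (euler n l i) (euler n k i) (F _ i) => a b d; ring.
rewrite [X in _ <= X]mulrAC mulrDl mul1r mulrDl.
apply: (le_trans (ler_normD _ _)); apply: lerD.
  rewrite mulrAC; apply: IH => // j /andP[kj jl]; apply: H.
  by rewrite kj (ltn_trans jl).
by rewrite normrM (ger0_norm h0) mulrC ler_wpM2r.
Qed.

Let step_le n (t : R) : 0 <= t -> (step n t)%:R * n.+1%:R^-1 <= t.
Proof.
move=> t0; by rewrite ler_pdivrMr// /step truncn_le mulr_ge0.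
Qed.

Let step_gt n (t : R) : t <= (step n t)%:R * n.+1%:R^-1 + n.+1%:R^-1.
Proof.
rewrite -[X in _ + X]mul1r -mulrDl ler_pdivlMr// natr1.
exact/ltW/truncnS_gt.
Qed.

Let step_mono n (s t : R) : s <= t -> (step n s <= step n t)%N.
Proof. by move=> st; apply: le_truncn; rewrite ler_wpM2r. Qed.

Let stepE n (t : R) : 0 <= t <= S -> forall i, `|euler n (step n t) i| + rho <= M.
Proof.
move=> /andP[t0 tS]; apply: euler_bound; exact: le_trans (step_le _ t0) tS.
Qed.

Let step_bound n k (t : R) : 0 <= t <= S -> (k <= step n t)%N ->
  forall i, `|euler n k i| + rho <= M.
Proof.
move=> /andP[t0 tS] kt; apply: euler_bound; apply: (le_trans _ (le_trans (step_le n t0) tS)).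
by rewrite ler_wpM2r ?invr_ge0// ler_nat.
Qed.

Let F_bound y : (forall i, `|y i| + rho <= M) -> forall i, `|F y i| <= M.
Proof.
move=> yM i; have := @growth (M - rho) y; rewrite subrK; apply => // j.
by rewrite lerBrDr.
Qed.

Let norm_le (y : I -> R) : (forall i, `|y i| + rho <= M) -> forall i, `|y i| <= M.
Proof. by move=> yM i; apply: le_trans (yM i); rewrite lerDl. Qed.

Let step_sub n (s t : R) : 0 <= s -> s <= t ->
  `|(step n t - step n s)%:R * n.+1%:R^-1 - (t - s)| <= n.+1%:R^-1.
Proof.
move=> s0 st; rewrite natrB ?step_mono// mulrBl.
have := step_le n s0; have := step_le n (le_trans s0 st).
have := step_gt n s; have := step_gt n t.
set a := (step n t)%:R * _; set b := (step n s)%:R * _.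
move: a b (n.+1%:R^-1) => a b h h1 h2 h3 h4.
by rewrite ler_norml; apply/andP; split; lra.
Qed.

Let euler_lip n (s t : R) i : 0 <= s -> s <= t -> t <= S ->
  `|euler n (step n t) i - euler n (step n s) i| <= M * (t - s + n.+1%:R^-1).
Proof.
move=> s0 st tS.
have := @euler_incr n _ _ i 0 M (step_mono n st); rewrite mulr0 subr0 => /(_ _)/le_trans.
apply.
  move=> j /andP[_ jl]; rewrite subr0; apply: F_bound.
  by apply: (@step_bound _ _ t); [rewrite (le_trans s0)|exact: ltnW].
rewrite mulrC ler_wpM2l//; have := step_sub n s0 st.
by rewrite ler_norml => /andP[_]; rewrite lerBlDl.
Qed.

(** The schemes are read as step functions of time and passed to the limit along an ultrafilter. On
    a short interval around [t] they stay near [z t], so by continuity their increments per unit of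
    time are near [F] at [z t]. *)
Theorem peano : exists z : I -> R -> R,
  [/\ forall i, z i 0 = y0 i,
      forall t, 0 <= t <= S -> forall i, `|z i t| + rho <= M,
      forall i s t, 0 <= s <= S -> 0 <= t <= S -> `|z i s - z i t| <= M * `|s - t|
    & forall i t, 0 <= t < S -> derivable (z i) t 1 /\
        'D_1 (z i) t = F (z^~ t) i].
Proof.
have [U [UU Uoo]] := @exists_ultra.
pose w i (t : R) := ulim U (fun n => euler n (step n t) i).
(* [derivable] is two-sided, so the solution is continued along its tangent to negative times. *)
pose z i (t : R) := if t < 0 then y0 i + t * F y0 i else w i t.
have zE i t : 0 <= t -> z i t = w i t by move=> t0; rewrite /z ltNge t0.
have Uh (e : R) : 0 < e -> U [set n | n.+1%:R^-1 <= e].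
  move=> e0; have [k _ kP] := near_infty_natSinv_lt (PosNum e0).
  by apply: filterS (ultra_ge Uoo k) => n /kP /ltW.
have Uw (e t : R) : 0 < e -> 0 <= t <= S ->
    U [set n | forall i, `|euler n (step n t) i - w i t| <= e].
  move=> e0 tS; apply: (ultra_fin UU) => i; apply: (ulim_near UU _ e0).
  by move=> n; apply: norm_le; exact: stepE.
have z0 i : z i 0 = y0 i.
  rewrite zE//; apply/eqP; rewrite eq_sym -subr_eq0 -normr_le0.
  apply: (@le_small _ _ _ 1) => e e0 _; rewrite add0r mul1r.
  have [|n /= /(_ i)] := filter_ex (Uw e 0 e0 _); first by rewrite lexx ltW.
  by rewrite /step mul0r truncn0.
have wM t : 0 <= t <= S -> forall i, `|w i t| + rho <= M.
  move=> tS i; apply: (@le_small _ _ _ 1) => e e0 _; rewrite mul1r.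
  have [n /= /(_ i) h] := filter_ex (Uw e t e0 tS); have := stepE n tS i.
  have := ler_distD (euler n (step n t) i) (w i t) 0; rewrite !subr0 distrC.
  by move: h; lra.
have lipw i s t : 0 <= s -> s <= t -> t <= S -> `|w i t - w i s| <= M * (t - s).
  move=> s0 st tS; apply: (@le_small _ _ _ (2 + M)) => e e0 _.
  have sS : 0 <= s <= S by rewrite s0 (le_trans st).
  have tS' : 0 <= t <= S by rewrite tS (le_trans s0).
  have [n /= [[/(_ i) h1 /(_ i) h2] h3]] :=
    filter_ex (filterI (filterI (Uw e s e0 sS) (Uw e t e0 tS')) (Uh e e0)).
  have h4 := euler_lip n i s0 st tS.
  have h5 := ler_wpM2l M0 h3.
  have := ler_distD (euler n (step n t) i) (w i t) (w i s).
  have := ler_distD (euler n (step n s) i) (euler n (step n t) i) (w i s).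
  rewrite (distrC (w i t) (euler _ _ _)); move: h1 h2 h4 h5; rewrite !mulrDr.
  by move: (M / _) => f; lra.
have lipz i s t : 0 <= s <= S -> 0 <= t <= S -> `|z i s - z i t| <= M * `|s - t|.
  move=> /andP[s0 sS] /andP[t0 tS]; rewrite !zE//.
  have [st|ts] := leP s t.
    by rewrite distrC (distrC s) (ger0_norm (_ : 0 <= t - s)) ?subr_ge0// lipw.
  by rewrite (ger0_norm (_ : 0 <= s - t)) ?subr_ge0 ?lipw// ltW.
exists z; split => //; first by move=> t tS i; rewrite zE ?wM//; case/andP: tS.
move=> i t /andP[t0 tS]; have tS' : 0 <= t <= S by rewrite t0 ltW.
pose y j := z j t; have yw j : y j = w j t by rewrite /y zE.
have yM j : `|y j| <= M by rewrite yw; exact: (@norm_le (w^~ t) (wM t tS') j).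
apply: derivable_epsI => e e0; have [eta eta0 etaP] := cont yM e0.
pose c := F y i.
have M1 : 0 < M + 1 by rewrite ltr_wpDl.
pose d1 := Num.min (S - t) (eta / 2 / (M + 1)).
have d10 : 0 < d1 by rewrite lt_min subr_gt0 tS !divr_gt0.
(* At positive [t] the interval must stay among nonnegative times; at 0 the tangent takes care of
   the left side. *)
pose d := if t == 0 then d1 else Num.min d1 t.
have d0 : 0 < d by rewrite /d; case: eqVneq => // tn0; rewrite lt_min d10 lt_neqAle eq_sym tn0.
have dd1 : d <= d1 by rewrite /d; case: ifP => // _; rewrite ge_min lexx.
have key p q : 0 <= p -> p <= q -> q <= S -> `|p - t| <= d -> `|q - t| <= d ->
    `|w i q - w i p - (q - p) * c| <= e * (q - p).
  move=> p0 pq qS pt_ qt_.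
  have pS : 0 <= p <= S by rewrite p0 (le_trans pq).
  have qS' : 0 <= q <= S by rewrite qS (le_trans p0).
  apply: (@le_small _ _ _ (2 + `|c| + e)) => e' e'0 e'1.
  pose e2 := Num.min e' (eta / 2 / (M + 1)).
  have e20 : 0 < e2 by rewrite lt_min e'0 !divr_gt0.
  have e2e : e2 <= e' by rewrite ge_min lexx.
  have e2eta : e2 * (M + 1) <= eta / 2 by rewrite -ler_pdivlMr// ge_min lexx orbT.
  have d1eta : d * (M + 1) <= eta / 2.
    by rewrite -ler_pdivlMr// (le_trans dd1)// ge_min lexx orbT.
  have [n /= [[[hp hq] ht] hh]] := filter_ex (filterI (filterI (filterI
    (Uw e2 p e20 pS) (Uw e2 q e20 qS')) (Uw e2 t e20 tS')) (Uh e2 e20)).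
  set h : R := n.+1%:R^-1 in hh.
  have h0 : 0 <= h by rewrite invr_ge0.
  (* Between [p] and [q] the scheme has moved away from its value at [t] by at most [M] times the
     elapsed time, up to one step. *)
  have close j k : (step n p <= k <= step n q)%N -> `|y j - euler n k j| <= eta.
    move=> /andP[pk kq].
    have ek : `|euler n (step n t) j - euler n k j| <= M * (d + h).
      have Fb l : (l <= maxn (step n q) (step n t))%N -> `|F (euler n l) j| <= M.
        rewrite leq_max => /orP[lq|lt]; apply: F_bound; first exact: (step_bound qS').
        exact: (step_bound tS').
      have [kt|tk] := leqP k (step n t).
        have := @euler_incr n _ _ j 0 M kt; rewrite mulr0 subr0 => /(_ _)/le_trans; apply.
          by move=> l /andP[_ lt]; rewrite subr0 Fb// leq_max (ltnW lt) orbT.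
        rewrite mulrC ler_wpM2l// -/h.
        have [pt1|/ltW tp1] := leP p t; last first.
          have := leq_trans (step_mono n tp1) pk; rewrite -subn_eq0 => /eqP ->.
          by rewrite mul0r addr_ge0// ltW.
        have sb := step_sub n p0 pt1; rewrite -/h in sb.
        have st : (step n t - k)%:R * h <= (step n t - step n p)%:R * h.
          by rewrite ler_wpM2r// ler_nat leq_sub2l.
        by apply: (span_le st sb); apply: le_trans pt_; rewrite distrC; exact: ler_norm.
      have := @euler_incr n _ _ j 0 M (ltnW tk); rewrite mulr0 subr0 distrC => /(_ _)/le_trans; apply.
        by move=> l /andP[_ lt]; rewrite subr0 Fb// leq_max (leq_trans (ltnW lt) kq).
      rewrite mulrC ler_wpM2l// -/h.
      have [tq1|/ltW qt1] := leP t q; last first.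
        have := leq_trans kq (step_mono n qt1); rewrite -subn_eq0 => /eqP ->.
        by rewrite mul0r addr_ge0// ltW.
      have sb := step_sub n t0 tq1; rewrite -/h in sb.
      have st : (k - step n t)%:R * h <= (step n q - step n t)%:R * h.
        by rewrite ler_wpM2r// ler_nat leq_sub2r.
      by apply: (span_le st sb); exact: (le_trans (ler_norm _) qt_).
    have := ler_distD (euler n (step n t) j) (y j) (euler n k j).
    have := ht j; rewrite yw (distrC (w j t) (euler n (step n t) j)).
    have := ler_wpM2l M0 hh.
    move: ek d1eta e2eta; rewrite !mulrDr !mulr1 !(mulrC M).
    move: (h * M) d0 e20 => u; lra.
  have := @euler_incr n _ _ i c e (step_mono n pq); rewrite -/h => incr.
  have H j : (step n p <= j < step n q)%N -> `|F (euler n j) i - c| <= e.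
    move=> /andP[pj jq]; rewrite distrC; apply: etaP => l.
      by apply: (@norm_le (euler n j)); apply: (step_bound qS'); exact: ltnW.
    by apply: close; rewrite pj ltnW.
  have {}incr := incr H; have := step_sub n p0 pq; rewrite -/h.
  set N := (_ - _)%:R * h in incr * => hN.
  have N0 : 0 <= N by rewrite mulr_ge0.
  have h1 : `|w i q - w i p - (q - p) * c| <=
      `|euler n (step n q) i - w i q| + `|euler n (step n p) i - w i p| +
      `|euler n (step n q) i - euler n (step n p) i - N * c| + `|N - (q - p)| * `|c|.
    have -> : w i q - w i p - (q - p) * c =
        (w i q - euler n (step n q) i) + (euler n (step n p) i - w i p) +
        (euler n (step n q) i - euler n (step n p) i - N * c) + (N - (q - p)) * c.
      by move: (w i q) (w i p) (euler _ _ _) (euler _ _ _) => a1 a2 a3 a4; ring.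
    rewrite -normrM (distrC _ (w i q)).
    apply: (le_trans (ler_normD _ _)); rewrite lerD2r.
    by apply: (le_trans (ler_normD _ _)); rewrite lerD2r ler_normD.
  have h2 := ler_wpM2r (normr_ge0 c) hN.
  have h3 := ler_wpM2r (normr_ge0 c) (le_trans hh e2e).
  have h4 : N <= q - p + e'.
    exact: (span_le (lexx N) (le_trans hN (le_trans hh e2e)) (lexx _)).
  have h5 := ler_wpM2r (ltW e0) h4.
  move: h1 h2 h3 h5 incr (hp i) (hq i) e2e; rewrite !mulrDl (mulrC e (q - p)) (mulrC e e') (mulrC `|c| e').
  move: (h * _) => u; lra.
exists d => // a a0 ad; rewrite scaler1 -[a *: F _ i]/(a * c).
have [t1|t1] := ltP (a + t) 0.
  have t00 : t = 0.
    apply/eqP; apply: contraT => tn0; move: ad t1; rewrite /d (negbTE tn0) lt_min => /andP[_].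
    by rewrite ltr_norml => /andP[]; lra.
  rewrite /z t1 t00 ltxx -[w i 0]zE// z0 addr0 /c.
  have -> : y = y0 by apply/funext => j; rewrite /y t00 z0.
  by rewrite [_ + _ - y0 i]addrC addKr subrr normr0 mulr_ge0// ltW.
have atS : a + t <= S.
  by move: (lt_le_trans ad dd1); rewrite lt_min => /andP[+ _]; rewrite ltr_norml; lra.
rewrite !zE//; have [a1|a1] := leP 0 a.
  have := key t (a + t) t0; rewrite lerDr subrr normr0 addrK => /(_ a1 atS (ltW d0) (ltW ad)).
  by rewrite (ger0_norm a1).
have := key (a + t) t t1; rewrite gerDr subrr normr0 addrK opprD addrCA subrr addr0.
move=> /(_ (ltW a1) (ltW tS) (ltW ad) (ltW d0)).
rewrite (ltr0_norm a1) -normrN; congr (`|_| <= _); ring.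
Qed.

End peano.

(** * Existence of discrete flows *)

Section within_interval.
Variables (R : realType) (T : R).

Lemma within_eps (V : normedModType R) (f : R -> V) :
  {within `[0, T], continuous f} <->
  (forall t, 0 <= t <= T -> forall e, 0 < e -> exists2 d, 0 < d &
    forall s, 0 <= s <= T -> `|t - s| < d -> `|f t - f s| <= e).
Proof.
rewrite subspace_continuousP; split=> H t tT.
  move=> e e0; have /H/cvgrPdist_le/(_ e e0) : (`[0, T]%classic : set R) t by rewrite /= in_itv.
  rewrite near_withinE => /nbhs_ballP[d /= d0 dP]; exists d => // s sT ts.
  by apply: dP => //; rewrite /= in_itv.
have {}tT : 0 <= t <= T by move: tT; rewrite /= in_itv.
apply/cvgrPdist_le => e e0; have [d d0 dP] := H t tT e e0.
rewrite near_withinE; apply/nbhs_ballP; exists d => // s ts.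
by rewrite /= in_itv /= => sT; exact: dP.
Qed.

Lemma within_n1 (f : R -> pt R) :
  {within `[0, T], continuous f} <->
  (forall t, 0 <= t <= T -> forall e : R, 0 < e -> exists2 d, 0 < d &
    forall s, 0 <= s <= T -> `|t - s| < d -> n1 (f t - f s) <= e).
Proof.
rewrite within_eps; split=> H t tT e e0.
  have [d d0 dP] := H t tT (e / 3) (divr_gt0 e0 (ltr0n _ 3)).
  exists d => // s sT st; apply: (le_trans (n1_le_norm _)).
  by rewrite mulrC -ler_pdivlMr// dP.
have [d d0 dP] := H t tT e e0; exists d => // s sT st.
exact: le_trans (norm_le_n1 _) (dP s sT st).
Qed.

Lemma cont_pt11 : continuous (fun x : pt R => x.1.1).
Proof. by move=> x; apply: (lip_continuous (@lip_pt11 R)). Qed.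

Lemma cont_pt12 : continuous (fun x : pt R => x.1.2).
Proof. by move=> x; apply: (lip_continuous (@lip_pt12 R)). Qed.

Lemma cont_pt2 : continuous (fun x : pt R => x.2).
Proof. by move=> x; apply: (lip_continuous (@lip_pt2 R)). Qed.

End within_interval.

Section flow.
Variables (R : realType) (Om : set (pt R)) (rho : R).
Hypothesis oOm : open Om.
Hypothesis bOm : forall x, Om x -> boxed rho x.
Hypothesis Om1 : leb3 R Om = 1%E.

(* The velocity [J (p - b / m)] of a seed [p] of mass [m], where [b] is the
   first moment of its cell. *)
Definition vel n (m : 'I_n -> R) (phi : pt R -> R) (p : pt R) (i : 'I_n) : pt R :=
  (- (p.1.2 - (bary Om phi p).1.2 / m i), p.1.1 - (bary Om phi p).1.1 / m i, 0).

(** The factor 2 in the Lipschitz bound counts the two coordinates that move, each at speed at most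
    [M]. *)
Definition flow n (m : 'I_n -> R) (M T : R) (z : 'I_n -> R -> pt R)
    (Phi : R -> pt R -> R) :=
  [/\ forall t, 0 <= t <= T -> disc Om (z^~ t) m M (Phi t) /\ injective (z^~ t),
      forall t i, 0 <= t <= T -> boxed M (z i t),
      forall i s t, 0 <= s <= T -> 0 <= t <= T ->
        n1 (z i s - z i t) <= 2 * M * `|s - t|,
      forall i t, 0 <= t <= T -> derivable (z i) t 1 /\
        'D_1 (z i) t = vel m (Phi t) (z i t) i
    & forall i, {within `[0, T], continuous (fun t => bary Om (Phi t) (z i t))}].

Variables (n : nat) (m : 'I_n.+1 -> R) (z0 : 'I_n.+1 -> pt R) (B0 T M : R).
Hypotheses (m0 : forall i, 0 < m i) (m1 : \sum_i m i = 1).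
Hypotheses (z0B : forall i, boxed B0 (z0 i)) (z0inj : injective (fun i => (z0 i).2)).
Hypotheses (T0 : 0 < T) (ME : M = expR (T + 1) * (B0 + rho)).

(* The vertical coordinates do not move: being distinct initially, they keep
   the seeds apart. The unknowns are the horizontal ones. *)
Let I : finType := ('I_n.+1 * bool)%type.
Let rho0 : 0 <= rho := rho_ge0 bOm Om1.
Let B00 : 0 <= B0 := boxed_ge0 (z0B ord0).

Let Z (y : I -> R) i : pt R := (y (i, false), y (i, true), (z0 i).2).

Let Z_inj y : injective (Z y).
Proof. by move=> i j [_ _]; exact: z0inj. Qed.

Let B0M : B0 + rho <= M.
Proof.
by rewrite ME ler_peMl ?addr_ge0// -[leLHS]expR0 ler_expR addr_ge0// ltW.
Qed.

Let Z_boxed y : (forall i, `|y i| <= M) -> forall i, boxed M (Z y i).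
Proof.
move=> yM i; split => //=; have [_ _ h] := z0B i.
by apply: (le_trans h); apply: le_trans B0M; rewrite lerDl.
Qed.

(** An arbitrary choice of potential. Continuity of its cells in [y] comes from [bary_continuous],
    which compares any two admissible potentials. *)
Let P y : pt R -> R := xget (fun=> 0) [set phi | disc Om (Z y) m M phi].

Let P_disc y : (forall i, `|y i| <= M) -> disc Om (Z y) m M (P y).
Proof.
move=> yM; have [phi phiP] := disc_exists oOm bOm Om1 (@Z_inj y) m0 m1 (Z_boxed yM).
exact: (@xgetPex _ (fun=> 0) [set phi | disc Om (Z y) m M phi] (ex_intro _ phi phiP)).
Qed.

Let F (y : I -> R) (k : I) : R :=
  let v := vel m (P y) (Z y k.1) k.1 in if k.2 then v.1.2 else v.1.1.

Let bary_b y i : (forall i, `|y i| <= M) -> boxed (rho * m i) (bary Om (P y) (Z y i)).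
Proof.
move=> yM; have [[cp pM _] _ mE] := P_disc yM; rewrite -[in rho * _]mE.
exact: (bary_le oOm bOm Om1 _ cp pM).
Qed.

Let growth B y : (forall i, `|y i| <= B) -> B + rho <= M -> forall i, `|F y i| <= B + rho.
Proof.
move=> yB BM; have yM i : `|y i| <= M.
  by apply: (le_trans (yB i)); apply: le_trans BM; rewrite lerDl.
have div (u : R) i : `|u| <= rho * m i -> `|u / m i| <= rho.
  by move=> h; rewrite normrM normfV (gtr0_norm (m0 i)) ler_pdivrMr.
move=> [i b]; have [/div h1 /div h2 _] := bary_b i yM.
by case: b; rewrite /F /vel /= ?normrN; apply: (le_trans (ler_normB _ _)); apply: lerD.
Qed.

Let mlow : exists2 c : R, 0 < c & forall i, c <= m i.
Proof.
have [x /mapP[i _ -> //]|c c0 cm] := @seq_pos_lower_bound R [seq m i | i <- enum 'I_n.+1].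
by exists c => // i; apply: cm; apply: map_f; rewrite mem_enum.
Qed.

Let n1Z_le (y y' : I -> R) (e : R) : (forall k, `|y k - y' k| <= e) ->
  forall i, n1 (Z y i - Z y' i) <= 2 * e.
Proof.
move=> h i; rewrite /n1 /= subrr normr0 addr0.
by have := h (i, false); have := h (i, true); lra.
Qed.

Let bary_cont y : (forall i, `|y i| <= M) -> forall e : R, 0 < e ->
  exists2 eta, 0 < eta & forall y', (forall i, `|y' i| <= M) ->
    (forall i, `|y i - y' i| <= eta) ->
    forall i, n1 (bary Om (P y) (Z y i) - bary Om (P y') (Z y' i)) <= e.
Proof.
move=> yM e e0.
have [eta eta0 etaP] := bary_continuous oOm bOm Om1 (fun i => ltW (m0 i)) m1
  (@Z_inj y) (P_disc yM) e0.
exists (eta / 2); first exact: divr_gt0.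
move=> y' yM' yy'; apply: etaP; [exact: Z_inj|exact: P_disc|].
by move=> i; have := n1Z_le yy' i; lra.
Qed.

Let cont y : (forall i, `|y i| <= M) -> forall e : R, 0 < e ->
  exists2 eta, 0 < eta & forall y', (forall i, `|y' i| <= M) ->
    (forall i, `|y i - y' i| <= eta) -> forall i, `|F y i - F y' i| <= e.
Proof.
move=> yM e e0; have [c c0 cm] := mlow.
have e2 : 0 < e / 2 by exact: divr_gt0.
have [eta eta0 etaP] := bary_cont yM (mulr_gt0 e2 c0).
exists (Num.min eta (e / 2)); first by rewrite lt_min eta0.
move=> y' yM' yy'.
have yy1 k : `|y k - y' k| <= eta by apply: (le_trans (yy' k)); rewrite ge_min lexx.
have yy2 k : `|y k - y' k| <= e / 2 by apply: (le_trans (yy' k)); rewrite ge_min lexx orbT.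
have div (u v : R) i : `|u - v| <= e / 2 * c -> `|u / m i - v / m i| <= e / 2.
  move=> h; rewrite -mulrBl normrM normfV (gtr0_norm (m0 i)) ler_pdivrMr//.
  by apply: (le_trans h); rewrite ler_pM2l.
have arith (a b a' b' : R) : `|a - a'| <= e / 2 -> `|b - b'| <= e / 2 ->
    `|a - b - (a' - b')| <= e.
  move=> h1 h2; rewrite (_ : _ - _ = (a - a') - (b - b')); last by ring.
  by apply: (le_trans (ler_normB _ _)); lra.
move=> [i b].
have [h1 h2 _] := boxed_self (bary Om (P y) (Z y i) - bary Om (P y') (Z y' i)).
have /div{}h1 := le_trans h1 (etaP y' yM' yy1 i).
have /div{}h2 := le_trans h2 (etaP y' yM' yy1 i).
case: b; rewrite /F /vel /=; first by apply: arith => //; exact: h1.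
by rewrite -opprD normrN; apply: arith => //; exact: h2.
Qed.

Theorem flow_exists : exists z Phi, flow m M T z Phi /\ forall i, z i 0 = z0 i.
Proof.
(* Solving up to [T + 1] yields two-sided derivatives at [T]. *)
have S0 : 0 < T + 1 by rewrite addr_gt0.
pose y0 (k : I) : R := if k.2 then (z0 k.1).1.2 else (z0 k.1).1.1.
have y0B k : `|y0 k| <= B0.
  by rewrite /y0; case: k => i [] /=; have [] := z0B i.
have [y [y00 yM ylip yder]] := peano rho0 S0 B00 ME y0B growth cont.
have TS t : 0 <= t <= T -> 0 <= t <= T + 1.
  by move=> /andP[-> tT]; rewrite (le_trans tT)// lerDl.
have TS' t : 0 <= t <= T -> 0 <= t < T + 1.
  by move=> /andP[-> tT]; rewrite (le_lt_trans tT)// ltrDl.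
have yM' t : 0 <= t <= T -> forall k, `|y k t| <= M.
  by move=> /TS tT k; apply: le_trans (yM t tT k); rewrite lerDl.
pose z i t := Z (y^~ t) i.
have zlip i s t : 0 <= s <= T -> 0 <= t <= T -> n1 (z i s - z i t) <= 2 * M * `|s - t|.
  move=> sT tT; rewrite -mulrA; apply: n1Z_le => k; apply: ylip; exact: TS.
exists z, (fun t => P (y^~ t)); split; last first.
  move=> i; rewrite /z /Z !y00 /y0 /=; by case: (z0 i) => [[]].
split.
- by move=> t tT; split; [apply: P_disc; exact: yM'|exact: Z_inj].
- by move=> t i tT; apply: Z_boxed; exact: yM'.
- exact: zlip.
- move=> i t tT.
  have [d1 v1] := yder (i, false) t (TS' t tT).
  have [d2 v2] := yder (i, true) t (TS' t tT).
  apply: derivable_epsI => e e0; have e2 : 0 < e / 2 by exact: divr_gt0.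
  have [a a0 aP] := derivable_eps d1 e2.
  have [b b0 bP] := derivable_eps d2 e2.
  exists (Num.min a b); first by rewrite lt_min a0.
  move=> h h0; rewrite lt_min => /andP[ha hb].
  have := aP h h0 ha; have := bP h h0 hb; rewrite v1 v2 => h2 h1.
  apply: (le_trans (norm_le_n1 _)).
  rewrite /n1 -[X in `|X| + _ + _]/(y (i, false) (h *: 1 + t) - y (i, false) t - h *: F (y^~ t) (i, false)).
  rewrite -[X in _ + `|X| + _]/(y (i, true) (h *: 1 + t) - y (i, true) t - h *: F (y^~ t) (i, true)).
  rewrite -[X in _ + _ + `|X|]/((z0 i).2 - (z0 i).2 - h * 0) mulr0 subrr subr0 normr0 addr0.
  by move: (`|_|) (`|_|) h1 h2 => u v; lra.
- move=> i; apply/within_n1 => t tT e e0.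
  have [eta eta0 etaP] := bary_cont (yM' t tT) e0.
  have M1 : 0 < M + 1.
    by rewrite ltr_wpDl// (le_trans _ B0M)// addr_ge0.
  exists (eta / (M + 1)); first exact: divr_gt0.
  move=> s sT ts; apply: etaP; first exact: yM'.
  move=> k; apply: (le_trans (ylip _ _ _ (TS _ tT) (TS _ sT))).
  move: ts; rewrite ltr_pdivlMr// => /ltW; apply: le_trans.
  by rewrite mulrC ler_wpM2l// lerDl.
Qed.

End flow.

(** * Test functions *)

Section test_functions.
Variable R : realType.
Implicit Types (f : pt R * R -> R) (p q : pt R * R).

Definition nt p q : R := n1 (p.1 - q.1) + `|p.2 - q.2|.

Lemma nt_ge0 p q : 0 <= nt p q.
Proof. by rewrite addr_ge0// n1_ge0. Qed.

Lemma nt_sym p q : nt p q = nt q p.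
Proof. by rewrite /nt n1_sym distrC. Qed.

Lemma nt_triangle p q r : nt p r <= nt p q + nt q r.
Proof.
rewrite /nt addrACA; apply: lerD; first exact: n1_triangle.
exact: ler_distD.
Qed.

Lemma nt_nbhs (P : set (pt R * R)) p : nbhs p P ->
  exists2 d : R, 0 < d & forall q, nt p q < d -> P q.
Proof.
move=> /nbhs_ballP[d /= d0 dP]; exists d => // q pq; apply: dP.
have h := n1_ge0 (p.1 - q.1); have [h1 h2 h3] := boxed_self (p.1 - q.1).
have h0 := normr_ge0 (p.2 - q.2).
have n1d : n1 (p.1 - q.1) < d by move: pq; rewrite /nt; lra.
split; last by rewrite /ball /=; move: pq; rewrite /nt; lra.
by split; [split|]; rewrite /ball /=; apply: le_lt_trans n1d.
Qed.

Lemma cont_nt (g : pt R * R -> R) p (e : R) : continuous g -> 0 < e ->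
  exists2 d : R, 0 < d & forall q, nt p q < d -> `|g p - g q| <= e.
Proof.
move=> cg e0; apply: nt_nbhs.
by have /cvgrPdist_le/(_ e e0) := cg p.
Qed.

Lemma mean_value (V : normedModType R) (f : V -> R) (x v : V) (h : R) :
  (forall y, derivable f y v) ->
  exists2 c : R, `|c| <= `|h| & f (h *: v + x) - f x = h * 'D_v f (c *: v + x).
Proof.
move=> df; pose g (s : R) := f (s *: v + x).
have dg (s : R) : derivable g s 1 /\ 'D_1 g s = 'D_v f (s *: v + x).
  apply: derivable_epsI => e e0; have [d d0 dP] := derivable_eps (df (s *: v + x)) e0.
  exists d => // a a0 ad; have := dP a a0 ad.
  by rewrite /g -[a *: 1]/(a * 1) mulr1 scalerDl addrA.
have ig (s : R) : is_derive s 1 g ('D_v f (s *: v + x)).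
  by have [ds es] := dg s; split.
have cg (a b : R) : {within `[a, b], continuous g}.
  apply: continuous_subspaceT => s; apply: differentiable_continuous.
  exact/derivable1_diffP/(dg s).1.
have g0 : g 0 = f x by rewrite /g scale0r add0r.
have [h0|h0] := leP 0 h.
  have [c + gc] := @MVT_segment R g (fun s => 'D_v f (s *: v + x)) 0 h h0 (fun s _ => ig s) (cg 0 h).
  rewrite in_itv /= => /andP[c0 ch]; exists c; first by rewrite !ger0_norm.
  by rewrite -g0 -/(g h) gc subr0 mulrC.
have [c + gc] := @MVT_segment R g (fun s => 'D_v f (s *: v + x)) h 0 (ltW h0) (fun s _ => ig s) (cg h 0).
rewrite in_itv /= => /andP[hc c0]; exists c; first by rewrite ler0_norm// ltr0_norm// lerN2.
by rewrite -g0 -/(g h) -opprB gc sub0r mulrN opprK mulrC.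
Qed.

Lemma test_derivable f p v : test_fun f -> derivable f p v.
Proof. by move=> [/(_ [::])[_]]; exact. Qed.

Lemma test_cont f : test_fun f -> continuous f.
Proof. by move=> [/(_ [::])[]]. Qed.

Lemma test_Dcont f v : test_fun f -> continuous ('D_v f).
Proof. by move=> [/(_ [:: v])[]]. Qed.

(** The total differential of [f] at [p] applied to [(u, s)], spelled out since test functions come
    with directional derivatives only. *)
Definition lin f p (u : pt R) (s : R) : R :=
  u.1.1 * dz (e1 R) f p.1 p.2 + u.1.2 * dz (e2 R) f p.1 p.2 +
  u.2 * dz (e3 R) f p.1 p.2 + s * dt f p.1 p.2.

Lemma test_step f p v (e : R) : test_fun f -> 0 < e ->
  exists2 d : R, 0 < d & forall q (h : R), (forall c : R, `|c| <= `|h| -> nt p (c *: v + q) < d) ->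
    `|f (h *: v + q) - f q - h * 'D_v f p| <= e * `|h|.
Proof.
move=> tf e0; have [d d0 dP] := cont_nt p (test_Dcont (v:=v) tf) e0.
exists d => // q h qd.
have [c ch ->] := mean_value q h (fun y => @test_derivable f y v tf).
by rewrite -mulrBr normrM mulrC ler_wpM2r// distrC dP// qd.
Qed.

(** One walks from [p] to [q] parallel to the four axes; each segment is handled by the mean value
    theorem and the continuity of the partial derivative. *)
Lemma test_expand f p (e : R) : test_fun f -> 0 < e ->
  exists2 d : R, 0 < d & forall q, nt p q < d ->
    `|f q - f p - lin f p (q.1 - p.1) (q.2 - p.2)| <= e * nt p q.
Proof.
move=> tf e0.
have [d1 d10 h1] := test_step p (e1 R, 0) tf e0.
have [d2 d20 h2] := test_step p (e2 R, 0) tf e0.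
have [d3 d30 h3] := test_step p (e3 R, 0) tf e0.
have [d4 d40 h4] := test_step p (0, 1) tf e0.
exists (Num.min (Num.min d1 d2) (Num.min d3 d4)).
  by rewrite !lt_min d10 d20 d30.
move=> q; move: p q h1 h2 h3 h4 => [[[a b] c] t] [[[a' b'] c'] t'] h1 h2 h3 h4.
rewrite !lt_min => /andP[/andP[k1 k2] /andP[k3 k4]].
have E1 (k x y z s : R) : k *: ((e1 R, 0) : pt R * R) + (x, y, z, s) = (k + x, y, z, s).
  by rewrite -[LHS]/(k * 1 + x, k * 0 + y, k * 0 + z, k * 0 + s) mulr1 !mulr0 !add0r.
have E2 (k x y z s : R) : k *: ((e2 R, 0) : pt R * R) + (x, y, z, s) = (x, k + y, z, s).
  by rewrite -[LHS]/(k * 0 + x, k * 1 + y, k * 0 + z, k * 0 + s) mulr1 !mulr0 !add0r.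
have E3 (k x y z s : R) : k *: ((e3 R, 0) : pt R * R) + (x, y, z, s) = (x, y, k + z, s).
  by rewrite -[LHS]/(k * 0 + x, k * 0 + y, k * 1 + z, k * 0 + s) mulr1 !mulr0 !add0r.
have E4 (k x y z s : R) : k *: ((0, 1) : pt R * R) + (x, y, z, s) = (x, y, z, k + s).
  by rewrite -[LHS]/(k * 0 + x, k * 0 + y, k * 0 + z, k * 1 + s) mulr1 !mulr0 !add0r.
have := h1 (a, b, c, t) (a' - a); rewrite E1 subrK => {}h1.
have := h2 (a', b, c, t) (b' - b); rewrite E2 subrK => {}h2.
have := h3 (a', b', c, t) (c' - c); rewrite E3 subrK => {}h3.
have := h4 (a', b', c', t) (t' - t); rewrite E4 subrK => {}h4.
move: k1 k2 k3 k4; rewrite /nt /n1 /= => k1 k2 k3 k4.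
have D (x k : R) : `|x - (k + x)| = `|k| by rewrite opprD addrCA subrr addr0 normrN.
have {}h1 : `|f (a', b, c, t) - f (a, b, c, t) - (a' - a) * 'D_(e1 R, 0) f (a, b, c, t)| <= e * `|a' - a|.
  apply: h1 => k kh; rewrite E1 /nt /n1 /= D !subrr normr0.
  by rewrite (distrC a') in kh; apply: le_lt_trans k1; rewrite !lerD.
have {}h2 : `|f (a', b', c, t) - f (a', b, c, t) - (b' - b) * 'D_(e2 R, 0) f (a, b, c, t)| <= e * `|b' - b|.
  apply: h2 => k kh; rewrite E2 /nt /n1 /= D !subrr normr0.
  by rewrite (distrC b') in kh; apply: le_lt_trans k2; rewrite !lerD.
have {}h3 : `|f (a', b', c', t) - f (a', b', c, t) - (c' - c) * 'D_(e3 R, 0) f (a, b, c, t)| <= e * `|c' - c|.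
  apply: h3 => k kh; rewrite E3 /nt /n1 /= D !subrr normr0.
  by rewrite (distrC c') in kh; apply: le_lt_trans k3; rewrite !lerD.
have {}h4 : `|f (a', b', c', t') - f (a', b', c', t) - (t' - t) * 'D_(0, 1) f (a, b, c, t)| <= e * `|t' - t|.
  apply: h4 => k kh; rewrite E4 /nt /n1 /= D.
  by rewrite (distrC t') in kh; apply: le_lt_trans k4; rewrite !lerD.
rewrite /lin /dz /dt /= (distrC a) (distrC b) (distrC c) (distrC t).
move: ('D_(e1 R, 0) f _) ('D_(e2 R, 0) f _) ('D_(e3 R, 0) f _) ('D_(0, 1) f _) h1 h2 h3 h4.
move=> D1 D2 D3 D4; move: (D1 : R) (D2 : R) (D3 : R) (D4 : R) => {D1 D2 D3 D4} D1 D2 D3 D4.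
move: (f (a, b, c, t)) (f (a', b, c, t)) (f (a', b', c, t)) (f (a', b', c', t))
  (f (a', b', c', t')) => f0 f1 f2 f3 f4 h1 h2 h3 h4.
rewrite [X in `|X|](_ : _ = (f1 - f0 - (a' - a) * D1) + (f2 - f1 - (b' - b) * D2)
  + (f3 - f2 - (c' - c) * D3) + (f4 - f3 - (t' - t) * D4)); last by ring.
rewrite !mulrDr; apply: (le_trans (ler_normD _ _)); apply: lerD => //.
apply: (le_trans (ler_normD _ _)); apply: lerD => //.
by apply: (le_trans (ler_normD _ _)); apply: lerD.
Qed.

Lemma lin_sub f p (u v : pt R) (s a : R) :
  lin f p u s - a * lin f p v 1 = lin f p (u - a *: v) (s - a).
Proof.
rewrite /lin -[(u - a *: v).1.1]/(u.1.1 - a * v.1.1).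
rewrite -[(u - a *: v).1.2]/(u.1.2 - a * v.1.2) -[(u - a *: v).2]/(u.2 - a * v.2).
move: (dz _ _ _ _) (dz _ _ _ _) (dz _ _ _ _) (dt _ _ _) => D1 D2 D3 D4.
move: (D1 : R) (D2 : R) (D3 : R) (D4 : R) => {D1 D2 D3 D4} D1 D2 D3 D4.
by move: (u.1.1) (u.1.2) (u.2) (v.1.1) (v.1.2) (v.2) => a1 a2 a3 b1 b2 b3; ring.
Qed.

Lemma lin_le f p : exists2 c : R, 0 <= c & forall u, `|lin f p u 0| <= c * n1 u.
Proof.
rewrite /lin; move: (dz (e1 R) _ _ _) (dz (e2 R) _ _ _) (dz (e3 R) _ _ _) (dt _ _ _) => D1 D2 D3 D4.
move: (D1 : R) (D2 : R) (D3 : R) (D4 : R) => {D1 D2 D3 D4} D1 D2 D3 D4.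
exists (`|D1| + `|D2| + `|D3|); first by rewrite !addr_ge0.
move=> u; rewrite mul0r addr0; have [u1 u2 u3] := boxed_self u.
rewrite !mulrDl; apply: (le_trans (ler_normD _ _)); apply: lerD; last first.
  by rewrite normrM mulrC ler_wpM2l.
apply: (le_trans (ler_normD _ _)); apply: lerD.
  by rewrite normrM mulrC ler_wpM2l.
by rewrite normrM mulrC ler_wpM2l.
Qed.

Lemma test_chain f (z : R -> pt R) (t : R) : test_fun f -> derivable z t 1 ->
  derivable (fun s : R => f (z s, s)) t 1 /\
  'D_1 (fun s : R => f (z s, s)) t = lin f (z t, t) ('D_1 z t) 1.
Proof.
move=> tf dz_; set v := 'D_1 z t; apply: derivable_epsI => e e0.
pose p := (z t, t); have [c c0 cP] := lin_le f p.
pose K := n1 v + 2; have K0 : 0 < K by rewrite ltr_wpDl// n1_ge0.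
have c1 : 0 < c + 1 by rewrite ltr_wpDl.
have eK : 0 < e / 2 / K by rewrite !divr_gt0.
have [d1 d10 h1] := test_expand p tf eK.
pose e' := Num.min 1 (e / 2 / (c + 1)).
have e'0 : 0 < e' by rewrite lt_min ltr01 !divr_gt0.
have e'1 : e' <= 1 by rewrite ge_min lexx.
have e'2 : e' * (c + 1) <= e / 2 by rewrite -ler_pdivlMr// ge_min lexx orbT.
have [d2 d20 h2] := derivable_eps dz_ (divr_gt0 e'0 (ltr0n _ 3)).
exists (Num.min d2 (d1 / K)); first by rewrite lt_min d20 divr_gt0.
move=> a a0; rewrite lt_min ltr_pdivlMr// => /andP[ad2 ad1].
have := h2 a a0 ad2; rewrite scaler1 -/v => {}h2.
pose q := (z (a + t), a + t).
have hu : n1 (z (a + t) - z t - a *: v) <= e' * `|a|.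
  apply: (le_trans (n1_le_norm _)); rewrite mulrC -ler_pdivlMr//.
  by rewrite mulrAC.
have pq : nt p q <= K * `|a|.
  rewrite /nt /= opprD addrCA subrr addr0 normrN n1_sym.
  have := n1_triangle (z (a + t) - z t) (a *: v) 0; rewrite !subr0 n1Z.
  have := ler_wpM2r (normr_ge0 a) e'1; rewrite /K.
  by move: hu; lra.
have := h1 q; rewrite -/p => {}h1.
have {}h1 := h1 (le_lt_trans pq _); rewrite mulrC in ad1; have {}h1 := h1 ad1.
rewrite -[a *: lin _ _ _ _]/(a * lin f p v 1).
rewrite [X in `|X|](_ : _ = (f q - f p - lin f p (q.1 - p.1) (q.2 - p.2)) +
  (lin f p (q.1 - p.1) (q.2 - p.2) - a * lin f p v 1)); last first.
  by rewrite addrA subrK.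
rewrite lin_sub [_ - _ - a](_ : _ = 0); last by rewrite /= addrK subrr.
apply: (le_trans (ler_normD _ _)).
have h3 : e / 2 / K * nt p q <= e / 2 * `|a|.
  have := ler_wpM2l (ltW eK) pq; rewrite mulrA divfK ?gt_eqF//; exact: le_trans.
have h4 := le_trans (cP _) (ler_wpM2l c0 hu).
have h5 := ler_wpM2r (normr_ge0 a) e'2.
have h6 : 0 <= e' * `|a| by rewrite mulr_ge0// ltW.
apply: (le_trans (lerD (le_trans h1 h3) h4)).
by move: (`|a|) h5 h6 => x; lra.
Qed.

(** Uniform continuity in a form that survives integration: composed with gradients it becomes a
    bound by their L^1 distance. *)
Lemma modulus (M T : R) (g : pt R * R -> R) (e : R) : continuous g -> 0 < e ->
  exists2 C : R, 0 <= C & forall x y s t, boxed M x -> boxed M y ->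
    0 <= s <= T -> 0 <= t <= T ->
    `|g (x, s) - g (y, t)| <= e + C * nt (x, s) (y, t).
Proof.
move=> cg e0; apply: contrapT => nC.
have H k : exists w : (pt R * R) * (pt R * R), [/\ boxed M w.1.1, boxed M w.2.1,
    0 <= w.1.2 <= T, 0 <= w.2.2 <= T &
    e + k%:R * nt w.1 w.2 < `|g w.1 - g w.2|].
  apply: contrapT => nw; apply: nC; exists k%:R => // x y s t bx by_ sT tT.
  rewrite leNgt; apply/negP => lt; apply: nw.
  by exists ((x, s), (y, t)).
have /choice[w wP] := H.
have [U [UU Uoo]] := @exists_ultra.
pose M' := `|M| + `|T|.
have bd (b : R) : `|b| <= M \/ 0 <= b <= T -> `|b| <= M'.
  rewrite /M'; have := ler_norm M; have := ler_norm T; have := normr_ge0 M; have := normr_ge0 T.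
  move=> h1 h2 h3 h4 [h|/andP[b0 bT]]; last by rewrite ger0_norm//; lra.
  lra.
pose co (j : 'I_4) (p : pt R * R) : R :=
  if val j == 0%N then p.1.1.1 else if val j == 1%N then p.1.1.2 else
  if val j == 2%N then p.1.2 else p.2.
have cob j k b : `|co j (if b then (w k).1 else (w k).2)| <= M'.
  have [[x1 x2 x3] [y1 y2 y3] s t _] := wP k.
  by rewrite /co; case: b; (case: ifP => _; [|case: ifP => _; [|case: ifP => _]]);
    apply: bd; by [left|right].
pose u b j := ulim U (fun k => co j (if b then (w k).1 else (w k).2)).
have Uu d : 0 < d -> U [set k | forall b j,
    `|co j (if b then (w k).1 else (w k).2) - u b j| <= d].
  move=> d0; apply: (ultra_fin UU) => b; apply: (ultra_fin UU) => j.
  exact: (ulim_near UU (fun k => cob j k b) d0).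
pose P b : pt R * R := ((u b 0, u b 1), u b 2%:R, u b 3%:R).
have near b d : 0 < d -> U [set k | nt (P b) (if b then (w k).1 else (w k).2) < d].
  move=> d0; have d5 : 0 < d / 5 by rewrite divr_gt0.
  apply: filterS (Uu _ d5) => k /= /(_ b) h.
  have := h 0; have := h 1; have := h 2%:R; have := h 3%:R.
  rewrite /co /= /nt /n1 /= => h1 h2 h3 h4.
  rewrite (distrC (u b 0)) (distrC (u b 1)) (distrC (u b 2%:R)) (distrC (u b 3%:R)).
  by lra.
have gP b : U [set k | `|g (P b) - g (if b then (w k).1 else (w k).2)| <= e / 4].
  have [d d0 dP] := cont_nt (P b) cg (divr_gt0 e0 (ltr0n _ 4)).
  by apply: filterS (near b d d0) => k /dP.
(* Near the two limit points the increments of [g] are bounded by [G]. Since they exceed [k%:R]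
   times the distance, the distance vanishes in the limit and the two points coincide. *)
pose G := `|g (P true)| + `|g (P false)| + e.
have G0 : 0 < G by rewrite ltr_wpDl// addr_ge0.
have PE : P true = P false.
  suff h : nt (P true) (P false) <= 0.
    have h1 := n1_ge0 ((P true).1 - (P false).1); have h2 := normr_ge0 ((P true).2 - (P false).2).
    have {}h1 : n1 ((P true).1 - (P false).1) = 0 by move: h; rewrite /nt; lra.
    have {}h2 : `|(P true).2 - (P false).2| = 0 by move: h h2; rewrite /nt h1; lra.
    rewrite [P true]surjective_pairing [P false]surjective_pairing (n1_eq0 h1).
    by move/normr0_eq0/subr0_eq: h2 => ->.
  apply: (@le_small _ _ _ 3) => d d0 _.
  have [k /= [[[h1 h2] [h3 h4]] h5]] := filter_ex (filterI (filterI (filterI (near true d d0)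
    (near false d d0)) (filterI (gP true) (gP false))) (ultra_ge Uoo (Num.truncn (G / d)).+1)).
  have [_ _ _ _ lt] := wP k.
  have kd : G <= k%:R * d.
    rewrite -ler_pdivrMr//; apply: le_trans (ltW (truncnS_gt _)) _.
    by rewrite ler_nat.
  have k0 : 0 < k%:R :> R by rewrite ltr0n (leq_trans _ h5).
  have ww : nt (w k).1 (w k).2 <= d.
    rewrite -(ler_pM2l k0); apply: le_trans kd; rewrite /G.
    have := ler_distD (g (P true)) (g (w k).1) (g (w k).2).
    have := ler_distD (g (P false)) (g (P true)) (g (w k).2).
    have := ler_normB (g (P true)) (g (P false)).
    rewrite (distrC (g (w k).1) (g (P true))).
    move: h3 h4 lt e0; lra.
  have := nt_triangle (P true) (w k).1 (P false).
  have := nt_triangle (w k).1 (w k).2 (P false).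
  rewrite (nt_sym (w k).2 (P false)).
  move: h1 h2 ww; lra.
have [k /= [h1 h2]] := filter_ex (filterI (gP true) (gP false)).
have [_ _ _ _ lt] := wP k; rewrite PE in h1.
have := ler_distD (g (P false)) (g (w k).1) (g (w k).2).
rewrite (distrC (g (w k).1) (g (P false))).
have : 0 <= k%:R * nt (w k).1 (w k).2 by rewrite mulr_ge0// nt_ge0.
move: h1 h2 lt e0; lra.
Qed.

End test_functions.

(** * Trajectories of potentials *)

(** The statement integrates on the canonical measurable structure of [R], the fundamental theorem
    of calculus on that of [lebesgue_measure]; the identity transports one law to the other. *)
Lemma leb1_int (R : realType) (a b : R) (g : R -> R) :
  {within `[a, b], continuous g} ->
  \int[@leb1 R]_(t in `[a, b]) g t = \int[@lebesgue_measure R]_(t in `[a, b]) g t.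
Proof.
move=> cg.
have mg : measurable_fun (`[a, b]%classic : set R) g.
  exact: (@subspace_continuous_measurable_fun R `[a, b]%classic g (measurable_itv _) cg).
have mgT : measurable_fun setT (g \_ `[a, b] : R -> R).
  exact/(measurable_restrictT _ (measurable_itv _)).
rewrite Rintegral_mkcond [RHS]Rintegral_mkcond.
apply: (@law_Rintegral _ (measurableTypeR R) _ R R (@lebesgue_measure R) setT measurableT idfun (@leb1 R)) => //.
- by move=> _ B mB; rewrite setTI.
- by move=> B mB; rewrite setTI.
Qed.

Lemma abs4 (R : realType) (a1 a2 a3 a4 b1 b2 b3 b4 c x1 x2 x3 x4 : R) :
  `|a1 - b1| <= x1 -> `|a2 - b2| <= x2 -> `|a3 - b3| <= x3 -> `|a4 - b4| <= x4 ->
  `|a1 - a2 - a3 - a4 + c - (b1 - b2 - b3 - b4 + c)| <= x1 + x2 + x3 + x4.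
Proof.
rewrite !ler_norml => /andP[? ?] /andP[? ?] /andP[? ?] /andP[? ?].
by apply/andP; split; lra.
Qed.

Section actions.
Variables (R : realType) (Om : set (pt R)) (rho : R).
Hypothesis oOm : open Om.
Hypothesis bOm : forall x, Om x -> boxed rho x.
Hypothesis Om1 : leb3 R Om = 1%E.
Implicit Types (q phi psi : pt R -> R) (a : pt R * R -> R).

(** The common shape of the terms of the weak formulation and of the energy that involve the
    potential: a weight in the physical variable times a continuous function of gradient and
    time. *)
Definition act q a phi (t : R) : R := IO Om (fun x => q x * a (grad3 phi x, t)).

Lemma cont_pair a (t : R) : continuous a -> continuous (fun y => a (y, t)).
Proof.
move=> ca y; apply/cvgrPdist_le => e e0; have [d d0 dP] := cont_nt (y, t) ca e0.
apply: filterS (near_n1 y d0) => y' yd; apply: dP.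
by rewrite /nt /= subrr normr0 addr0.
Qed.

Lemma bmeas_act q a phi M (t : R) : bmeas Om q -> continuous a -> 0 <= t ->
  cvx phi -> lip M phi -> bmeas Om (fun x => q x * a (grad3 phi x, t)).
Proof.
move=> bq ca t0 cp pM; have [C C0 CP] := modulus M t ca (@ltr01 R).
have M0 := lip_ge0 pM; have b0 : boxed M (0 : pt R) by split; rewrite normr0.
apply: bmeasM => //; apply: (bmeas_bmap Om (bmap_grad3 cp pM) (h := fun y => a (y, t))
  (C := `|a (0, t)| + (1 + C * (3 * M)))).
  exact: (continuous_pt_measurable (cont_pair (t := t) ca)).
move=> y by_; have tt : 0 <= t <= t by rewrite t0 lexx.
rewrite -[a (y, t)](subrK (a (0, t))) addrC.
apply: (le_trans (ler_normD _ _)); rewrite lerD2l.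
apply: (le_trans (CP _ _ _ _ by_ b0 tt tt)).
rewrite lerD2l ler_wpM2l// /nt /= subrr normr0 addr0 subr0; exact: boxed_n1.
Qed.

Lemma act_modulus q (K : R) a (M T e : R) : bmeas Om q ->
  (forall x, Om x -> `|q x| <= K) -> continuous a -> 0 < e ->
  exists2 C : R, 0 <= C & forall phi psi s t,
    potential Om M phi -> potential Om M psi -> 0 <= s <= T -> 0 <= t <= T ->
    `|act q a phi s - act q a psi t| <= K * (e + C * (gdist Om phi psi + `|s - t|)).
Proof.
move=> bq qK ca e0; have [C C0 CP] := modulus M T ca e0.
exists C => // phi psi s t [cp pM _] [cp' pM' _] sT tT.
have bp := bmap_grad3 cp pM; have bp' := bmap_grad3 cp' pM'.
have bn := bmeas_n1B Om bp bp'.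
have -> : K * (e + C * (gdist Om phi psi + `|s - t|)) =
    IO Om (fun x => K * (e + C * (n1 (grad3 phi x - grad3 psi x) + `|s - t|))).
  have b1 : bmeas Om (fun x => n1 (grad3 phi x - grad3 psi x) + `|s - t|).
    by apply: bmeasD => //; exact: bmeas_cst.
  have b2 := bmeasZ C b1.
  rewrite (IOZ oOm Om1 K (bmeasD (bmeas_cst Om e) b2)) (IOD oOm Om1 (bmeas_cst Om e) b2).
  rewrite (IOZ oOm Om1 C b1) (IOD oOm Om1 bn (bmeas_cst Om `|s - t|)).
  by rewrite !(IO_cst oOm Om1).
have [s0 t0] : 0 <= s /\ 0 <= t by case/andP: sT => ->; case/andP: tT => ->.
apply: (IO_dist oOm Om1).
- exact: bmeas_act pM.
- exact: bmeas_act pM'.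
- apply: bmeasZ; apply: bmeasD; first exact: bmeas_cst.
  by apply: bmeasZ; apply: bmeasD => //; exact: bmeas_cst.
apply: aeW => x Ox; rewrite -mulrBr normrM.
have K0 : 0 <= K by exact: le_trans (qK x Ox).
apply: ler_pM => //; first exact: qK.
by apply: CP => //; [exact: bp.2|exact: bp'.2].
Qed.

Definition ptraj (M T : R) (Phi : R -> pt R -> R) :=
  (forall t, 0 <= t <= T -> potential Om M (Phi t)) /\
  forall e : R, 0 < e -> exists2 d : R, 0 < d & forall s t, 0 <= s <= T -> 0 <= t <= T ->
    `|s - t| <= d -> gdist Om (Phi s) (Phi t) <= e.

Lemma act_cont q a M T Phi : bmeas Om q -> continuous a -> ptraj M T Phi ->
  {within `[0, T], continuous (fun t => act q a (Phi t) t)}.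
Proof.
move=> bq ca [KP eP]; apply/within_eps => t tT e e0.
have [K0 qK0] := bq.2; pose K := `|K0| + 1.
have qK x : Om x -> `|q x| <= K.
  by move=> /qK0 h; apply: (le_trans h); rewrite (le_trans (ler_norm _))// lerDl.
have Kp : 0 < K by rewrite ltr_wpDl.
have eK : 0 < e / K / 3 by rewrite !divr_gt0.
have [C C0 CP] := act_modulus M T bq qK ca eK.
have C1 : 0 < C + 1 by rewrite ltr_wpDl.
have eC : 0 < e / K / 3 / (C + 1) by rewrite divr_gt0.
have [d d0 dP] := eP _ eC.
exists (Num.min d (e / K / 3 / (C + 1))); first by rewrite lt_min d0.
move=> s sT; rewrite lt_min => /andP[/ltW sd /ltW sC].
apply: (le_trans (CP _ _ _ _ (KP t tT) (KP s sT) tT sT)).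
rewrite mulrC -ler_pdivlMr//.
have h1 := dP t s tT sT sd.
have h2 := ler_wpM2l C0 (lerD h1 sC).
have h3 : C * (e / K / 3 / (C + 1)) <= e / K / 3.
  by rewrite mulrA ler_pdivrMr// mulrC ler_pM2l// lerDl.
by move: h2 h3; rewrite [C * (_ + e / K / 3 / (C + 1))]mulrDr; lra.
Qed.

Lemma traj_law M T Phi : ptraj M T Phi -> exists alpha : R -> probability (pt R) R,
  forall t, 0 <= t <= T -> has_law Om (grad3 (Phi t)) (alpha t).
Proof.
move=> [KP _].
have H t : exists nu : probability (pt R) R, 0 <= t <= T -> has_law Om (grad3 (Phi t)) nu.
  have [tT|tT] := boolP (0 <= t <= T).
    have [cp pM _] := KP t tT.
    have [nu nuP] := law_exists (open_pt_measurable oOm) Om1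
      (grad3_measurable cp pM) (inhabits (0 : pt R)).
    by exists nu => _.
  have [nu _] := law_exists (open_pt_measurable oOm) Om1
    (@measurable_id _ (pt R) setT) (inhabits (0 : pt R)).
  by exists nu => /idPn.
by have /choice[alpha alphaP] := H; exists alpha.
Qed.

(** * Weak formulation and energy along a trajectory of potentials *)

Section trajectory.
Variables (M T : R) (Phi : R -> pt R -> R) (alpha : R -> probability (pt R) R).
Hypotheses (T0 : 0 < T) (trj : ptraj M T Phi).
Hypothesis lawP : forall t, 0 <= t <= T -> has_law Om (grad3 (Phi t)) (alpha t).
Hypothesis cOm : convex_set3 Om.

Let KP t : 0 <= t <= T -> potential Om M (Phi t). Proof. exact: trj.1. Qed.
Let bG t : 0 <= t <= T -> bmap M (grad3 (Phi t)).
Proof. by move=> /KP[cp pM _]; exact: bmap_grad3. Qed.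

Lemma gdist_W2 (phi psi : pt R -> R) (nu nu' : probability (pt R) R) (e : R) :
  potential Om M phi -> potential Om M psi -> has_law Om (grad3 phi) nu ->
  has_law Om (grad3 psi) nu' -> 0 < e ->
  gdist Om phi psi <= e ^+ 2 / (2 * M + 1) -> W2 nu nu' <= e.
Proof.
move=> [cp pM _] [cp' pM' _] l1 l2 e0 gd; have M0 := lip_ge0 pM.
apply: (W2_le oOm Om1 (bmap_grad3 cp pM) (bmap_grad3 cp' pM') l1 l2 (ltW e0)).
have M1 : 0 < 2 * M + 1 by rewrite ltr_wpDl// mulr_ge0.
move: gd; rewrite ler_pdivlMr// => /(le_trans _); apply.
by rewrite mulrC ler_wpM2l ?(gdist_ge0 Om)// lerDl.
Qed.

Lemma traj_W2 : W2_continuous T alpha.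
Proof.
have M0 : 0 <= M.
  have z0 : 0 <= (0 : R) <= T by rewrite lexx ltW.
  by have [_ /lip_ge0] := KP z0.
split=> t tT.
  exists [set x | boxed M x]; split; [exact: compact_boxed|exact: measurable_boxed|].
  rewrite lawP//; last exact: measurable_boxed.
  rewrite (_ : _ `&` _ = Om) ?Om1//; apply/seteqP; split => x; first by case.
  by move=> Ox; split => //; exact: (bG tT).2.
move=> e e0; have e2 : 0 < e / 2 by exact: divr_gt0.
have M1 : 0 < 2 * M + 1 by rewrite ltr_wpDl// mulr_ge0.
have [d d0 dP] := trj.2 _ (divr_gt0 (exprn_gt0 2 e2) M1).
exists d => // s sT /ltW sd; apply: (@le_lt_trans _ _ (e / 2)); last first.
  by rewrite ltr_pdivrMr// ltr_pMr// ltr1n.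
exact: (gdist_W2 (KP sT) (KP tT) (lawP sT) (lawP tT) e2 (dP _ _ sT tT sd)).
Qed.

(* The integrand of the weak formulation is split according to its dependence
   on the physical variable: [wk0] collects the terms without it. *)
Definition wk0 (f : pt R * R -> R) : pt R * R -> R := fun p =>
  'D_((0, 1) : pt R * R) f p - p.1.1.2 * 'D_((e1 R, 0) : pt R * R) f p
  + p.1.1.1 * 'D_((e2 R, 0) : pt R * R) f p.

Lemma wk0_cont f : test_fun f -> continuous (wk0 f).
Proof.
move=> tf p.
have c11 : continuous (fun p : pt R * R => p.1.1.1).
  by move=> r; apply: (@continuous_comp _ _ _ fst (fun x : pt R => x.1.1));
    [exact: cvg_fst|exact: cont_pt11].
have c12 : continuous (fun p : pt R * R => p.1.1.2).
  by move=> r; apply: (@continuous_comp _ _ _ fst (fun x : pt R => x.1.2));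
    [exact: cvg_fst|exact: cont_pt12].
apply: cvgD; [apply: cvgB|].
- exact: (test_Dcont tf).
- apply: cvgM; [exact: c12|exact: (test_Dcont tf)].
- apply: cvgM; [exact: c11|exact: (test_Dcont tf)].
Qed.

Definition wk (f : pt R * R -> R) phi (t : R) : R :=
  act (fun=> 1) (wk0 f) phi t -
  (act (fun x => x.1.1) ('D_((e2 R, 0) : pt R * R) f) phi t -
   act (fun x => x.1.2) ('D_((e1 R, 0) : pt R * R) f) phi t).

Let b1 : bmeas Om (fun=> 1 : R). Proof. exact: bmeas_cst. Qed.
Let b11 : bmeas Om (fun x => x.1.1). Proof. exact: (lip_bmeas oOm bOm (@lip_pt11 R)). Qed.
Let b12 : bmeas Om (fun x => x.1.2). Proof. exact: (lip_bmeas oOm bOm (@lip_pt12 R)). Qed.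

(** Integrals against [alpha t] are pulled back to [Om] and [Bren] is replaced by [Phi t]; there
    remains an identity between actions, shared by discrete flows and their limit. *)
Lemma traj_geo (abar : probability (pt R) R) :
  (forall f, test_fun f ->
    \int[@lebesgue_measure R]_(t in `[0, T]) wk f (Phi t) t =
    act (fun=> 1) f (Phi T) T - \int[abar]_(z in setT) f (z, 0)) ->
  geo_sol Om T alpha abar.
Proof.
move=> H; split; first exact: traj_W2.
move=> f tf.
have TT : 0 <= T <= T by rewrite lexx ltW.
have -> : \int[alpha T]_(z in setT) f (z, T) = act (fun=> 1) f (Phi T) T.
  rewrite (law_IO oOm (bG TT) (lawP TT) (h := fun z => f (z, T))).
    by congr (IO Om _); apply/funext => x; rewrite mul1r.
  exact: (continuous_pt_measurable (cont_pair (t := T) (test_cont tf))).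
rewrite -H//.
pose u t := act (fun=> 1) (wk0 f) (Phi t) t.
pose v t := act (fun x => x.1.1) ('D_((e2 R, 0) : pt R * R) f) (Phi t) t -
   act (fun x => x.1.2) ('D_((e1 R, 0) : pt R * R) f) (Phi t) t.
have cu : {within `[0, T], continuous u} by apply: act_cont trj => //; exact: wk0_cont.
have cv : {within `[0, T], continuous v}.
  move=> t; apply: cvgB.
    by apply: (act_cont b11 _ trj); exact: (test_Dcont tf).
  by apply: (act_cont b12 _ trj); exact: (test_Dcont tf).
have int g : {within `[0, T], continuous g} ->
    (@lebesgue_measure R).-integrable `[0, T] (EFin \o g).
  by move=> cg; apply: continuous_compact_integrable => //; exact: segment_compact.
rewrite [RHS](_ : _ = \int[@lebesgue_measure R]_(t in `[0, T]) u t -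
    \int[@lebesgue_measure R]_(t in `[0, T]) v t); last first.
  by rewrite -RintegralB//; exact: int.
have inner1 t : 0 <= t <= T -> \int[alpha t]_z (dt f z t + Jdot f z z t) = u t.
  move=> tT; rewrite (law_IO oOm (bG tT) (lawP tT) (h := fun z => dt f z t + Jdot f z z t)).
    congr (IO Om _); apply/funext => x; rewrite mul1r /wk0 /Jdot /dt /dz /=.
    by rewrite mulNr addrA.
  apply: (eq_measurable_fun (fun z => wk0 f (z, t))).
    by move=> z _; rewrite /wk0 /Jdot /dt /dz /= mulNr addrA.
  exact: (continuous_pt_measurable (cont_pair (t := t) (wk0_cont tf))).
have inner2 t : 0 <= t <= T ->
    \int[leb3 R]_(x in Om) Jdot f x (grad3 (Bren Om (alpha t)) x) t = v t.
  move=> tT; have [cp pM _] := KP tT; have t0 : 0 <= t by case/andP: tT.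
  have Bp := Bren_grad3 oOm bOm Om1 (KP tT) (lawP tT) cOm.
  rewrite /v /act -(IOB oOm Om1); last 2 first.
  - exact: (bmeas_act b11 (test_Dcont tf) t0 cp pM).
  - exact: (bmeas_act b12 (test_Dcont tf) t0 cp pM).
  apply: IO_ae_eq; apply: filterS Bp => x /[apply] ->.
  by rewrite /Jdot /dz mulNr addrC.
have E1 : \int[@leb1 R]_(t in `[0, T]) (\int[alpha t]_z (dt f z t + Jdot f z z t)) =
    \int[@leb1 R]_(t in `[0, T]) u t.
  by apply: eq_Rintegral => t; rewrite inE /= in_itv /=; exact: inner1.
have E2 : \int[@leb1 R]_(t in `[0, T])
    (\int[leb3 R]_(x in Om) Jdot f x (grad3 (Bren Om (alpha t)) x) t) =
    \int[@leb1 R]_(t in `[0, T]) v t.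
  by apply: eq_Rintegral => t; rewrite inE /= in_itv /=; exact: inner2.
by rewrite E1 E2 (leb1_int cu) (leb1_int cv).
Qed.

Definition en0 : pt R * R -> R := fun p => 2^-1 * (p.1.1.1 ^+ 2 + p.1.1.2 ^+ 2).

(* The energy with its squares expanded, as a sum of actions. *)
Definition enp phi : R :=
  act (fun=> 1) en0 phi 0 - act (fun x => x.1.1) (fun p => p.1.1.1) phi 0
  - act (fun x => x.1.2) (fun p => p.1.1.2) phi 0
  - act (fun x => x.2) (fun p => p.1.2) phi 0
  + IO Om (fun x => 2^-1 * (x.1.1 ^+ 2 + x.1.2 ^+ 2)).

Let c11 : continuous (fun p : pt R * R => p.1.1.1).
Proof.
by move=> r; apply: (@continuous_comp _ _ _ fst (fun x : pt R => x.1.1));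
  [exact: cvg_fst|exact: cont_pt11].
Qed.
Let c12 : continuous (fun p : pt R * R => p.1.1.2).
Proof.
by move=> r; apply: (@continuous_comp _ _ _ fst (fun x : pt R => x.1.2));
  [exact: cvg_fst|exact: cont_pt12].
Qed.
Let c2 : continuous (fun p : pt R * R => p.1.2).
Proof.
by move=> r; apply: (@continuous_comp _ _ _ fst (fun x : pt R => x.2));
  [exact: cvg_fst|exact: cont_pt2].
Qed.
Let b2 : bmeas Om (fun x => x.2). Proof. exact: (lip_bmeas oOm bOm (@lip_pt2 R)). Qed.

Lemma en0_cont : continuous en0.
Proof.
move=> p; apply: cvgMr; apply: cvgD; rewrite /=.
  by apply: (@cvgM _ _ _ _ (fun p : pt R * R => p.1.1.1)); exact: c11.
by apply: (@cvgM _ _ _ _ (fun p : pt R * R => p.1.1.2)); exact: c12.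
Qed.

Lemma energyE t : 0 <= t <= T -> energy Om (alpha t) = enp (Phi t).
Proof.
move=> tT; have [cp pM _] := KP tT.
have Bp := Bren_grad3 oOm bOm Om1 (KP tT) (lawP tT) cOm.
have z0 : 0 <= (0 : R) by [].
have h1 := bmeas_act b1 en0_cont z0 cp pM.
have h2 := bmeas_act b11 c11 z0 cp pM.
have h3 := bmeas_act b12 c12 z0 cp pM.
have h4 := bmeas_act b2 c2 z0 cp pM.
have h5 : bmeas Om (fun x => 2^-1 * (x.1.1 ^+ 2 + x.1.2 ^+ 2)).
  by apply: bmeasZ; apply: bmeasD; exact: bmeasM.
rewrite /enp /act -(IOB oOm Om1 h1 h2) -(IOB oOm Om1 (bmeasB h1 h2) h3).
rewrite -(IOB oOm Om1 (bmeasB (bmeasB h1 h2) h3) h4).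
rewrite -(IOD oOm Om1 (bmeasB (bmeasB (bmeasB h1 h2) h3) h4) h5).
apply: IO_ae_eq; apply: filterS Bp => x /[apply].
rewrite /grad3 => -[E1 E2 E3]; rewrite E1 E2 E3 /en0 /=.
move: ('D_(e1 R) (Phi t) x) ('D_(e2 R) (Phi t) x) ('D_(e3 R) (Phi t) x) => y1 y2 y3.
move: (y1 : R) (y2 : R) (y3 : R) => {E1 E2 E3} {}y1 {}y2 {}y3.
by move: x.1.1 x.1.2 x.2 => x1 x2 x3; field.
Qed.

Lemma enp_modulus (e : R) : 0 < e -> exists2 C : R, 0 <= C & forall phi psi,
  potential Om M phi -> potential Om M psi ->
  `|enp phi - enp psi| <= e + C * gdist Om phi psi.
Proof.
move=> e0; have rho0 := rho_ge0 bOm Om1.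
pose K := rho + 1; have K0 : 0 < K by rewrite ltr_wpDl.
have e4 : 0 < e / (4 * K) by rewrite divr_gt0// mulr_gt0.
have rK : rho <= K by rewrite lerDl.
have q1 (x : pt R) : Om x -> `|1 : R| <= K by rewrite normr1 lerDr.
have q11 (x : pt R) : Om x -> `|x.1.1| <= K by move=> /bOm[h _ _]; exact: le_trans h _.
have q12 (x : pt R) : Om x -> `|x.1.2| <= K by move=> /bOm[_ h _]; exact: le_trans h _.
have q2 (x : pt R) : Om x -> `|x.2| <= K by move=> /bOm[_ _ h]; exact: le_trans h _.
have [C1 C10 h1] := act_modulus M T b1 q1 en0_cont e4.
have [C2 C20 h2] := act_modulus M T b11 q11 c11 e4.
have [C3 C30 h3] := act_modulus M T b12 q12 c12 e4.
have [C4 C40 h4] := act_modulus M T b2 q2 c2 e4.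
exists (K * (C1 + C2 + C3 + C4)).
  by rewrite mulr_ge0 ?(ltW K0)// !addr_ge0.
move=> phi psi Kp Kp'; have tT : 0 <= (0 : R) <= T by rewrite lexx ltW.
have := h1 _ _ _ _ Kp Kp' tT tT; have := h2 _ _ _ _ Kp Kp' tT tT.
have := h3 _ _ _ _ Kp Kp' tT tT; have := h4 _ _ _ _ Kp Kp' tT tT.
have simp C : K * (e / (4 * K) + C * (gdist Om phi psi + `|0 - 0 : R|)) =
    e / 4 + K * C * gdist Om phi psi.
  by rewrite subrr normr0 addr0; field; rewrite gt_eqF.
rewrite !simp /enp.
move: (act _ _ phi _) (act _ _ phi _) (act _ _ phi _) (act _ _ phi _) => u4 u3 u2 u1.
move: (act _ _ psi _) (act _ _ psi _) (act _ _ psi _) (act _ _ psi _) => v4 v3 v2 v1.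
move=> k4 k3 k2 k1; apply: (le_trans (abs4 _ k1 k2 k3 k4)).
by rewrite le_eqVlt; apply/orP; left; apply/eqP; field.
Qed.

End trajectory.
End actions.

(** * Discrete flows are energy-conserving solutions *)

Lemma sub_le_norm (R : realDomainType) (a b d : R) : b + d - a <= `|a - b| + `|d|.
Proof.
rewrite addrAC distrC; apply: lerD; exact: ler_norm.
Qed.

Lemma vel_sub (R : realType) (x y p q : pt R) (c : R) :
  (- (p.1.2 - x.1.2 / c), p.1.1 - x.1.1 / c, 0) -
  (- (q.1.2 - y.1.2 / c), q.1.1 - y.1.1 / c, 0) =
  (- ((p - q).1.2 - (x - y).1.2 / c), (p - q).1.1 - (x - y).1.1 / c, 0) :> pt R.
Proof.
rewrite -[LHS]/(- (p.1.2 - x.1.2 / c) - - (q.1.2 - y.1.2 / c),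
  p.1.1 - x.1.1 / c - (q.1.1 - y.1.1 / c), 0 - 0).
by congr (_, _, _); rewrite /= ?subrr//; ring.
Qed.

Lemma dot_split (R : realType) (u v x y : pt R) :
  dot u x - (dot v (x - y) + dot (u - v) (x - y)) = dot u y.
Proof. by rewrite !dotBr !dotBl; ring. Qed.

Section flow_solution.
Variables (R : realType) (Om : set (pt R)) (rho : R).
Hypothesis oOm : open Om.
Hypothesis bOm : forall x, Om x -> boxed rho x.
Hypothesis Om1 : leb3 R Om = 1%E.
Hypothesis cOm : convex_set3 Om.

(** [d] is fixed before the seeds and their number: the gap is at most [2 * rho] times the
    displacement, and the displacement at most [2 * M] times the elapsed time. *)
Lemma flow_equi (M e : R) : 0 <= M -> 0 < e -> exists2 d : R, 0 < d &
  forall n (m : 'I_n -> R) T z Phi, (forall i, 0 < m i) -> \sum_i m i = 1 ->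
    flow Om m M T z Phi -> forall s t, 0 <= s <= T -> 0 <= t <= T ->
    `|s - t| <= d -> gdist Om (Phi s) (Phi t) <= e.
Proof.
move=> M0 e0; have rho0 := rho_ge0 bOm Om1.
have [d d0 dP] := gap_stability oOm bOm Om1 M e0.
have K0 : 0 < 4 * rho * M + 1 by rewrite ltr_wpDl// !mulr_ge0.
exists (d / (4 * rho * M + 1)); first exact: divr_gt0.
move=> n m T z Phi m0 m1 [zP _ zL _ _] s t sT tT std.
have [ds injs] := zP s sT; have [dt injt] := zP t tT.
have [Ks _ _] := ds; have [Kt _ _] := dt.
apply: (dP _ _ Ks Kt).
apply: (le_trans (disc_gap_le oOm bOm Om1 (fun i => ltW (m0 i)) m1 injs injt ds dt (fun i => zL i s t sT tT))).
move: std; rewrite ler_pdivlMr//; apply: le_trans.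
have -> : 2 * rho * (2 * M * `|s - t|) = `|s - t| * (4 * rho * M) by ring.
by rewrite ler_wpM2l// lerDl.
Qed.

Variables (n : nat) (m : 'I_n -> R) (M T : R) (z : 'I_n -> R -> pt R).
Variable Phi : R -> pt R -> R.
Hypotheses (m0 : forall i, 0 < m i) (m1 : \sum_i m i = 1) (T0 : 0 < T).
Hypothesis flw : flow Om m M T z Phi.

Let zP t : 0 <= t <= T -> disc Om (z^~ t) m M (Phi t) /\ injective (z^~ t).
Proof. by case: flw => h _ _ _ _; exact: h. Qed.
Let zB t i : 0 <= t <= T -> boxed M (z i t).
Proof. by case: flw => _ h _ _ _; exact: h. Qed.
Let zL i s t : 0 <= s <= T -> 0 <= t <= T -> n1 (z i s - z i t) <= 2 * M * `|s - t|.
Proof. by case: flw => _ _ h _ _; exact: h. Qed.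
Let zD i t : 0 <= t <= T -> derivable (z i) t 1 /\
  'D_1 (z i) t = vel Om m (Phi t) (z i t) i.
Proof. by case: flw => _ _ _ h _; exact: h. Qed.
Let b i t := bary Om (Phi t) (z i t).
Let bC i : {within `[0, T], continuous b i}.
Proof. by case: flw => _ _ _ _ h; exact: h. Qed.

Let Tz : 0 <= (0 : R) <= T. Proof. by rewrite lexx ltW. Qed.

Let Mge0 : 0 <= M.
Proof. by have [[[_ /lip_ge0 ]]] := zP Tz. Qed.

Lemma flow_ptraj : ptraj Om M T Phi.
Proof.
split=> [t tT|e e0]; first by have [[]] := zP tT.
have [d d0 dP] := flow_equi Mge0 e0.
by exists d => // s t; exact: (dP _ _ _ _ _ m0 m1 flw).
Qed.

Lemma flow_z_cont i : {within `[0, T], continuous (z i)}.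
Proof.
apply/within_n1 => t tT e e0.
have M1 : 0 < 2 * M + 1 by rewrite ltr_wpDl// mulr_ge0.
exists (e / (2 * M + 1)); first exact: divr_gt0.
move=> s sT /ltW; rewrite ler_pdivlMr// => h; apply: (le_trans (zL i tT sT)).
by apply: le_trans h; rewrite mulrC ler_wpM2l// lerDl.
Qed.

Let act_sum q a t : bmeas Om q -> 0 <= t <= T ->
  act Om q a (Phi t) t = \sum_i IO Om (fun x => chi (Phi t) (z i t) x * q x) * a (z i t, t).
Proof.
move=> bq tT; have [dp inj] := zP tT; have [[cp pM _] _ _] := dp.
rewrite /act (disc_decomp oOm Om1 (F := fun x y => q x * a (y, t)) inj dp); last first.
  by move=> i; apply: bmeasM => //; exact: bmeas_cst.
apply: eq_bigr => i _; have bc := bmeas_chi Om (z i t) cp pM.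
rewrite [RHS]mulrC -(IOZ oOm Om1 _ (bmeasM bc bq)).
by congr (IO Om _); apply/funext => x; ring.
Qed.

Lemma flow_act1 a t : 0 <= t <= T -> act Om (fun=> 1) a (Phi t) t = \sum_i m i * a (z i t, t).
Proof.
move=> tT; rewrite act_sum//; last exact: bmeas_cst.
have [[_ _ mE] _] := zP tT; apply: eq_bigr => i _; rewrite -mE; congr (IO Om _ * _).
by apply/funext => x; rewrite mulr1.
Qed.

Let b11 : bmeas Om (fun x => x.1.1). Proof. exact: (lip_bmeas oOm bOm (@lip_pt11 R)). Qed.
Let b12 : bmeas Om (fun x => x.1.2). Proof. exact: (lip_bmeas oOm bOm (@lip_pt12 R)). Qed.
Let b2 : bmeas Om (fun x => x.2). Proof. exact: (lip_bmeas oOm bOm (@lip_pt2 R)). Qed.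

(** The integrand is the time derivative of the sum of [m i * f (z i t, t)]: the term containing
    [x], integrated over a cell, produces the first moment in the velocity. *)
Let wk_sum f t : 0 <= t <= T ->
  wk Om f (Phi t) t = \sum_i m i * lin f (z i t, t) ('D_1 (z i) t) 1.
Proof.
move=> tT; rewrite /wk flow_act1// (act_sum _ b11 tT) (act_sum _ b12 tT) -!sumrB.
apply: eq_bigr => i _; have [_ ->] := zD i tT.
rewrite /vel /lin /wk0 /bary /dz /dt /= -/(b i t).
have mi : m i != 0 by rewrite gt_eqF.
move: ('D_(0, 1) f _) ('D_(e1 R, 0) f _) ('D_(e2 R, 0) f _) ('D_(e3 R, 0) f _).
move=> D1 D2 D3 D4; move: (D1 : R) (D2 : R) (D3 : R) (D4 : R) => {D1 D2 D3 D4} D1 D2 D3 D4.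
move: (IO _ _) (IO _ _) ((z i t).1.1) ((z i t).1.2) => x1 x2 y1 y2; field.
exact: mi.
Qed.

Lemma flow_weak f : test_fun f ->
  \int[@lebesgue_measure R]_(t in `[0, T]) wk Om f (Phi t) t =
  act Om (fun=> 1) f (Phi T) T - act Om (fun=> 1) f (Phi 0) 0.
Proof.
move=> tf; have TT : 0 <= T <= T by rewrite lexx ltW.
pose h i (s : R) : R := f (z i s, s).
pose g : R -> R := \sum_i m i *: h i.
have gE t : g t = \sum_i m i * f (z i t, t) by rewrite /g fct_sumE.
have dg t : 0 <= t <= T -> is_derive t 1 g (\sum_i m i * lin f (z i t, t) ('D_1 (z i) t) 1).
  move=> tT; apply: is_derive_sum => i; apply: is_deriveZ.
  have [d1 d2] := test_chain tf (zD i tT).1.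
  by split.
have gc t : 0 <= t <= T -> {for t, continuous g}.
  move=> /dg[d _]; apply: differentiable_continuous; exact/derivable1_diffP.
rewrite !flow_act1// -gE -gE /Rintegral.
rewrite (@continuous_FTC2 _ (fun t => wk Om f (Phi t) t) g 0 T T0).
- by [].
- have tr := flow_ptraj; move=> t; apply: cvgB; last apply: cvgB.
  + by apply: (act_cont oOm Om1 (bmeas_cst Om 1) _ tr); exact: wk0_cont.
  + by apply: (act_cont oOm Om1 b11 _ tr); exact: (test_Dcont tf).
  + by apply: (act_cont oOm Om1 b12 _ tr); exact: (test_Dcont tf).
- split.
  + move=> t; rewrite in_itv /= => /andP[t0 tT].
    have tT' : 0 <= t <= T by rewrite !ltW.
    by case: (dg t tT').
  + by apply: cvg_at_right_filter; exact: (gc 0 Tz).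
  + by apply: cvg_at_left_filter; exact: (gc T TT).
- move=> t; rewrite in_itv /= => /andP[t0 tT].
  have tT' : 0 <= t <= T by rewrite !ltW.
  by rewrite derive1E wk_sum//; case: (dg t tT').
Qed.

Let Q t := \sum_i dot (b i t) (z i t).
Let H t := 2^-1 * \sum_i m i * ((z i t).1.1 ^+ 2 + (z i t).1.2 ^+ 2) - Q t.

Let enpE t : 0 <= t <= T ->
  enp Om (Phi t) = H t + IO Om (fun x => 2^-1 * (x.1.1 ^+ 2 + x.1.2 ^+ 2)).
Proof.
move=> tT; have E q a : (forall (y : pt R) s s', a (y, s) = a (y, s') :> R) ->
    act Om q a (Phi t) 0 = act Om q a (Phi t) t.
  by move=> aE; rewrite /act; congr (IO Om _); apply/funext => x; rewrite (aE _ 0 t).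
rewrite /enp !E// flow_act1// (act_sum _ b11 tT) (act_sum _ b12 tT) (act_sum _ b2 tT).
congr (_ + _); rewrite /H /Q mulr_sumr -!sumrB; apply: eq_bigr => i _.
rewrite /en0 /dot /b /bary /=.
move: (IO _ _) (IO _ _) (IO _ _) (z i t).1.1 (z i t).1.2 (z i t).2 => x1 x2 x3 y1 y2 y3.
by ring.
Qed.

Let Q_ge s t : 0 <= s <= T -> 0 <= t <= T -> \sum_i dot (b i t) (z i s) <= Q s.
Proof.
move=> sT tT; have [ds injs] := zP sT; have [dt injt] := zP tT.
apply: (le_trans (disc_corr_le oOm bOm Om1 injt injs dt ds)).
by rewrite (disc_dot oOm bOm Om1 injs ds).
Qed.

(* The velocity is orthogonal to the gradient of the energy in the seeds, so
   the energy varies at second order only. *)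
Let flat t : 0 <= t <= T -> forall e : R, 0 < e -> exists2 d : R, 0 < d &
  forall s, 0 <= s <= T -> `|t - s| < d -> `|H s - H t| <= e * `|s - t|.
Proof.
move=> tT e e0.
(* The formal gradient of [H] in the [i]-th seed, with the cells held fixed. *)
pose c i : pt R := (m i * (z i t).1.1 - (b i t).1.1, m i * (z i t).1.2 - (b i t).1.2, - (b i t).2).
have [e' e'0 e'n] : exists2 e' : R, 0 < e' & e' * n%:R <= e.
  have n0 : 0 < n%:R + 1 :> R by rewrite ltr_wpDl.
  exists (e / (n%:R + 1)); first exact: divr_gt0.
  by rewrite mulrAC ler_pdivrMr// ler_pM2l// lerDl.
have loc i : \forall s \near t, 0 <= s <= T ->
    `|m i * (2^-1 * ((z i s).1.1 ^+ 2 + (z i s).1.2 ^+ 2 - ((z i t).1.1 ^+ 2 + (z i t).1.2 ^+ 2)))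
      - dot (b i t) (z i s - z i t)| + n1 (b i s - b i t) * n1 (z i s - z i t) <= e' * `|s - t|.
  have C0 : 0 < 3 * n1 (c i) + 1 by rewrite ltr_wpDl// mulr_ge0// n1_ge0.
  have M1 : 0 < 2 * M + 1 by rewrite ltr_wpDl// mulr_ge0.
  have [d1 d10 h1] := derivable_eps (zD i tT).1 (divr_gt0 (divr_gt0 e'0 (ltr0n _ 3)) C0).
  have [d2 d20 h2] := (within_n1 T (b i)).1 (@bC i) t tT _
    (divr_gt0 (divr_gt0 e'0 (ltr0n _ 3)) M1).
  have K0 : 0 < m i * (2 * M + 1) ^+ 2 by rewrite mulr_gt0// exprn_gt0.
  have d30 : 0 < e' / 3 / (m i * (2 * M + 1) ^+ 2) by rewrite !divr_gt0.
  pose d := Num.min d1 (Num.min d2 (e' / 3 / (m i * (2 * M + 1) ^+ 2))).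
  apply/nbhs_ballP; exists d => /=; first by rewrite !lt_min d10 d20.
  move=> s; rewrite /ball /= !lt_min => /and3P[ts1 ts2 ts3] sT.
  have [->|st] := eqVneq s t.
    by rewrite !n1_subrr !subrr dot0r !mulr0 subr0 addr0 !normr0 mulr0.
  have st0 : s - t != 0 by rewrite subr_eq0.
  have := h1 (s - t) st0; rewrite (distrC s) => /(_ ts1).
  rewrite scaler1 subrK (zD i tT).2; set v := vel _ _ _ _ _ => h3.
  set w := z i s - z i t.
  have hw : n1 w <= (2 * M + 1) * `|s - t|.
    by apply: (le_trans (zL i sT tT)); rewrite ler_wpM2r// lerDl.
  have hr : n1 (w - (s - t) *: v) * n1 (c i) <= e' / 3 * `|s - t|.
    apply: (@le_trans _ _ (3 * `|w - (s - t) *: v| * n1 (c i))).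
      by rewrite ler_wpM2r ?n1_ge0// n1_le_norm.
    rewrite mulrAC mulrC; apply: (le_trans (ler_wpM2r _ h3)).
      by rewrite mulr_ge0// n1_ge0.
    rewrite (distrC t) mulrAC ler_wpM2r// mulrAC ler_pdivrMr// ler_pM2l ?divr_gt0//.
    by rewrite lerDl.
  have hb : n1 (b i s - b i t) * n1 w <= e' / 3 * `|s - t|.
    apply: (le_trans (ler_pM (n1_ge0 _) (n1_ge0 _) _ hw)).
      by rewrite n1_sym; exact: h2.
    by rewrite mulrA divfK// gt_eqF.
  have hq : m i * (n1 w * n1 w) <= e' / 3 * `|s - t|.
    apply: (@le_trans _ _ (m i * (((2 * M + 1) * `|s - t|) * ((2 * M + 1) * `|s - t|)))).
      by rewrite ler_pM2l//; apply: ler_pM => //; exact: n1_ge0.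
    have -> : m i * (((2 * M + 1) * `|s - t|) * ((2 * M + 1) * `|s - t|)) =
        (`|s - t| * (m i * (2 * M + 1) ^+ 2)) * `|s - t| by ring.
    by rewrite ler_wpM2r// -ler_pdivlMr// distrC ltW.
  (* [v] is [J] applied to [c i], divided by [m i], and [J] is skew-symmetric. *)
  have ortho : dot (c i) v = 0.
    rewrite /dot /c /v /vel /= -/(b i t) mulr0 addr0.
    have mi : m i != 0 by rewrite gt_eqF.
    by move: (b i t).1.1 (b i t).1.2 (z i t).1.1 (z i t).1.2 => x1 x2 x3 x4; field.
  have -> : m i * (2^-1 * ((z i s).1.1 ^+ 2 + (z i s).1.2 ^+ 2 - ((z i t).1.1 ^+ 2 + (z i t).1.2 ^+ 2)))
      - dot (b i t) w = dot (c i) (w - (s - t) *: v) + m i * (2^-1 * (w.1.1 ^+ 2 + w.1.2 ^+ 2)).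
    rewrite [dot (c i) _]dotBr dotZr ortho mulr0 subr0 /dot /c /w /=.
    by move: (b i t).1.1 (b i t).1.2 (b i t).2 (z i t).1.1 (z i t).1.2 (z i t).2
      (z i s).1.1 (z i s).1.2 (z i s).2 => x1 x2 x3 x4 x5 x6 x7 x8 x9; field.
  have hc : `|dot (c i) (w - (s - t) *: v)| <= e' / 3 * `|s - t|.
    by apply: le_trans hr; rewrite mulrC; apply/dot_le/boxed_self.
  have hs : `|m i * (2^-1 * (w.1.1 ^+ 2 + w.1.2 ^+ 2))| <= e' / 3 * `|s - t|.
    apply: le_trans hq; rewrite normrM (gtr0_norm (m0 i)) ler_pM2l//.
    rewrite ger0_norm; last by rewrite mulr_ge0// ?addr_ge0// ?sqr_ge0// invr_ge0.
    have [w1 w2 _] := boxed_self w; have wn := n1_ge0 w.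
    have s1 : w.1.1 ^+ 2 <= n1 w * n1 w.
      by rewrite -real_normK ?num_real// expr2; apply: ler_pM.
    have s2 : w.1.2 ^+ 2 <= n1 w * n1 w.
      by rewrite -real_normK ?num_real// expr2; apply: ler_pM.
    by rewrite ler_pdivrMl// mulr_natl mulr2n; exact: lerD.
  apply: (le_trans (lerD (ler_normD _ _) (lexx _))).
  rewrite (distrC t s); apply: (le_trans (lerD (lerD hc hs) hb)).
  by rewrite -addrA -2!mulrDl thirds.
have : \forall s \near t, forall i, 0 <= s <= T ->
    `|m i * (2^-1 * ((z i s).1.1 ^+ 2 + (z i s).1.2 ^+ 2 - ((z i t).1.1 ^+ 2 + (z i t).1.2 ^+ 2)))
      - dot (b i t) (z i s - z i t)| + n1 (b i s - b i t) * n1 (z i s - z i t) <= e' * `|s - t|.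
  exact: (@filter_forall _ _ _ (nbhs t) _ loc).
move=> /nbhs_ballP[d /= d0 dP]; exists d => // s sT ts.
have {}dP i := dP s ts i sT.
(* [A] is the increment of the quadratic part, [B] the first-order term of both bounds on
   [Q s - Q t], and [D] the second-order discrepancy between these bounds. *)
pose A i := m i * (2^-1 * ((z i s).1.1 ^+ 2 + (z i s).1.2 ^+ 2 - ((z i t).1.1 ^+ 2 + (z i t).1.2 ^+ 2))).
pose B i := dot (b i t) (z i s - z i t).
pose D i := dot (b i s - b i t) (z i s - z i t).
have HE : H s - H t = \sum_i A i - (Q s - Q t).
  have -> : \sum_i A i = 2^-1 * \sum_i m i * ((z i s).1.1 ^+ 2 + (z i s).1.2 ^+ 2) -
      2^-1 * \sum_i m i * ((z i t).1.1 ^+ 2 + (z i t).1.2 ^+ 2).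
    by rewrite !mulr_sumr -sumrB; apply: eq_bigr => i _; rewrite /A; ring.
  by rewrite /H; move: (2^-1 * _) (2^-1 * _) (Q s) (Q t) => u1 u2 u3 u4; ring.
have q1 : \sum_i B i <= Q s - Q t.
  rewrite lerBrDr -[Q t]/(\sum_i dot (b i t) (z i t)) -big_split /=.
  rewrite (eq_bigr (fun i => dot (b i t) (z i s))); first exact: Q_ge.
  by move=> i _; rewrite /B dotBr subrK.
have q2 : Q s - Q t <= \sum_i (B i + D i).
  rewrite lerBlDr -lerBlDl -[Q s]/(\sum_i dot (b i s) (z i s)) -sumrB.
  rewrite (eq_bigr (fun i => dot (b i s) (z i t))); first exact: Q_ge.
  by move=> i _; exact: dot_split.
have sumle : \sum_i (`|A i - B i| + `|D i|) <= e * `|s - t|.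
  apply: (@le_trans _ _ (\sum_(i < n) e' * `|s - t|)).
    apply: ler_sum => i _; apply: le_trans (dP i); rewrite lerD2l.
    by apply: dot_le; exact: boxed_self.
  rewrite sumr_const card_ord -mulr_natr mulrAC ler_wpM2r//.
apply: le_trans sumle; rewrite HE ler_norml; apply/andP; split.
  rewrite lerNl opprB; apply: (@le_trans _ _ (\sum_i (B i + D i) - \sum_i A i)).
    by rewrite lerD2r; exact: q2.
  rewrite -sumrB; apply: ler_sum => i _.
  exact: sub_le_norm.
apply: (le_trans (lerB (lexx (\sum_i A i)) q1)).
rewrite -sumrB; apply: ler_sum => i _; apply: (le_trans (ler_norm _)).
by rewrite lerDl.
Qed.

Lemma flow_energy t : 0 <= t <= T -> enp Om (Phi t) = enp Om (Phi 0).
Proof.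
move=> tT; rewrite !enpE//; congr (_ + _).
have [t0 tT'] := andP tT.
have dH s : s \in `]0, t[%R -> is_derive s 1 H ((fun=> 0 : R) s).
  rewrite in_itv /= => /andP[s0 st].
  have sT : 0 <= s <= T by rewrite ltW// ltW// (lt_le_trans st).
  have [] : derivable H s 1 /\ 'D_1 H s = 0; last by split.
  apply: derivable_epsI => e e0; have [d d0 dP] := flat sT e0.
  exists (Num.min d (Num.min s (T - s))).
    by rewrite !lt_min d0 s0 subr_gt0 (lt_le_trans st).
  move=> a a0; rewrite !lt_min => /and3P[ad as_ aT]; rewrite scaler1 scaler0 subr0.
  have := dP (a + s); rewrite opprD addrCA subrr addr0 normrN addrK; apply => //.
  by move: as_ aT; rewrite !ltr_norml => /andP[? ?] /andP[? ?]; apply/andP; split; lra.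
have cH : {within `[0, t], continuous H}.
  apply/within_eps => u /andP[u0 ut] e e0.
  have uT : 0 <= u <= T by rewrite u0 (le_trans ut).
  have [d d0 dP] := flat uT ltr01.
  exists (Num.min d e); first by rewrite lt_min d0.
  move=> s /andP[s0 st]; rewrite lt_min => /andP[sd /ltW se].
  have sT : 0 <= s <= T by rewrite s0 (le_trans st).
  rewrite distrC; apply: (le_trans (dP s sT sd)).
  by rewrite mul1r distrC.
have [c _] := MVT_segment t0 dH cH; rewrite mul0r => /eqP.
by rewrite subr_eq0 => /eqP.
Qed.

Lemma flow_init (alpha : probability (pt R) R) (f : pt R * R -> R) :
  has_law Om (grad3 (Phi 0)) alpha -> continuous f ->
  act Om (fun=> 1) f (Phi 0) 0 = \int[alpha]_y f (y, 0).
Proof.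
move=> l0 cf; have [[[cp pM _] _ _] _] := zP Tz.
rewrite (law_IO oOm (bmap_grad3 cp pM) l0 (h := fun y => f (y, 0))).
  by congr (IO Om _); apply/funext => x; rewrite mul1r.
exact: (continuous_pt_measurable (cont_pair (t := 0) cf)).
Qed.

Let vel_cont i : {within `[0, T], continuous ('D_1 (z i))}.
Proof.
apply/within_n1 => t tT e e0; have mi := m0 i.
have [d1 d10 h1] := (within_n1 T (z i)).1 (@flow_z_cont i) t tT _ (divr_gt0 e0 (ltr0n _ 2)).
have [d2 d20 h2] := (within_n1 T (b i)).1 (@bC i) t tT _ (mulr_gt0 (divr_gt0 e0 (ltr0n _ 2)) mi).
exists (Num.min d1 d2); first by rewrite lt_min d10.
move=> s sT; rewrite lt_min => /andP[/(h1 s sT) {}h1 /(h2 s sT) {}h2].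
rewrite (zD i tT).2 (zD i sT).2.
set u := z i t - z i s in h1; set v := b i t - b i s in h2.
have -> : vel Om m (Phi t) (z i t) i - vel Om m (Phi s) (z i s) i =
    (- (u.1.2 - v.1.2 / m i), u.1.1 - v.1.1 / m i, 0).
  exact: vel_sub.
have ab (x y : R) : `|x - y / m i| <= `|x| + `|y| / m i.
  by apply: (le_trans (ler_normB _ _)); rewrite normrM normfV (gtr0_norm mi).
rewrite {1}/n1 /= normr0 addr0 normrN.
apply: (le_trans (lerD (ab _ _) (ab _ _))).
have : n1 v / m i <= e / 2 by rewrite ler_pdivrMr.
have k1 := normr_ge0 u.2; have k2 : 0 <= `|v.2| / m i by rewrite divr_ge0// ltW.
move: h1; rewrite /n1 !mulrDl.
by move: (`|v.1.1| / _) (`|v.1.2| / _) (`|v.2| / _) k2 => a1 a2 a3; lra.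
Qed.

Lemma flow_geo (alpha : R -> probability (pt R) R) :
  (forall t, 0 <= t <= T -> has_law Om (grad3 (Phi t)) (alpha t)) ->
  discrete_C1_geo_sol Om T alpha.
Proof.
move=> lawP; split.
  apply: (traj_geo oOm bOm Om1 T0 flow_ptraj lawP cOm) => f tf.
  by rewrite flow_weak// (flow_init (lawP 0 Tz))//; exact: test_cont.
exists n, m, z; split => //; split => //.
split; first by move=> i t tT; exact: (zD i tT).1.
split; first exact: vel_cont.
split; first by move=> t tT i j; have [_ inj] := zP tT; apply: contra_neq => /inj.
move=> t tT A mA; have [dp inj] := zP tT; have [[cp pM _] _ _] := dp.
have mG := grad3_measurable cp pM.
have mI : measurable_fun setT (\1_A : pt R -> R) by exact: measurable_indic.
transitivity (IO Om (fun x => \1_A (grad3 (Phi t) x)))%:E; last first.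
  rewrite (disc_int oOm Om1 (fun y => \1_A y) inj dp) -sumEFin.
  by apply: eq_bigr => i _; rewrite EFinM diracE indicE.
rewrite -(EFin_IO oOm Om1); last first.
  apply: (bmeas_bmap Om (bmap_grad3 cp pM) mI (C := 1)) => y _.
  by rewrite indicE; case: (_ \in _); rewrite ?normr1// normr0.
rewrite lawP//.
have -> : (fun x => (\1_A (grad3 (Phi t) x))%:E) = (fun x => (\1_(grad3 (Phi t) @^-1` A) x)%:E : \bar R).
  by apply/funext => x; rewrite !indicE.
rewrite integral_indic; first by rewrite setIC.
  exact: open_pt_measurable.
by rewrite -[X in measurable X]setTI; exact: mG.
Qed.

End flow_solution.

(** * Discrete approximation of the initial measure *)

(** Two shifted values can only collide when [t] is one of finitely many numbers [bad q]; any
    positive [t] below the positive ones will do. *)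
Lemma injective_shift (R : realType) n (v : 'I_n -> R) (e : R) : 0 < e ->
  exists t : R, injective (fun i : 'I_n => v i + t * i%:R) /\
    forall i : 'I_n, `|t * i%:R| <= e.
Proof.
move=> e0.
pose bad (q : 'I_n * 'I_n) := (v q.1 - v q.2) / (q.2%:R - q.1%:R).
pose s := [seq bad q | q : 'I_n * 'I_n <- enum {: 'I_n * 'I_n} & 0 < bad q].
have [x /mapP[q]|c c0 cs] := @seq_pos_lower_bound R s.
  by rewrite mem_filter => /andP[q0 _] ->.
have n0 : 0 < n%:R + 1 :> R by rewrite ltr_wpDl.
pose t := Num.min (c / 2) (e / (n%:R + 1)).
have t0 : 0 < t by rewrite lt_min !divr_gt0.
exists t; split=> [i j ij|i]; last first.
  rewrite ger0_norm; last by rewrite mulr_ge0// ltW.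
  have : t <= e / (n%:R + 1) by rewrite ge_min lexx orbT.
  rewrite ler_pdivlMr//; apply: le_trans; rewrite ler_pM2l//.
  by apply: (@le_trans _ _ n%:R); [rewrite ler_nat ltnW|rewrite lerDl].
apply/eqP; apply: contraT => nij.
have ji0 : j%:R - i%:R != 0 :> R by rewrite subr_eq0 eqr_nat eq_sym.
have tE : bad (i, j) = t.
  rewrite /bad /=; apply: (mulIf ji0); rewrite divfK//.
  by move: ij; lra.
have : c <= t.
  by apply: cs; apply/mapP; exists (i, j) => //; rewrite mem_filter tE t0 mem_enum.
have : t <= c / 2 by rewrite ge_min lexx.
by move: c0; lra.
Qed.

Section approximation.
Variables (R : realType) (abar : probability (pt R) R) (K : set (pt R)) (B : R).
Hypotheses (mK : measurable K) (K1 : abar K = 1%E) (KB : forall x, K x -> boxed B x).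

Let Kfin : (abar K < +oo)%E. Proof. by rewrite K1 ltry. Qed.
Local Notation IK f := (\int[abar]_(x in K) f x).

Let IK_cst (c : R) : IK (fun=> c) = c.
Proof.
by transitivity (c * fine (abar K)); [exact: Rintegral_cst|rewrite K1 mulr1].
Qed.

Let IKT (f : pt R -> R) : \int[abar]_x f x = IK f.
Proof.
rewrite [RHS]Rintegral_mkcond; apply: ae_Rintegral.
have KC : abar (~` K) = 0%E by rewrite probability_setC// K1 subee.
exists (~` K); split => //; first exact: measurableC.
move=> x /=; apply: contra_not => Kx; by rewrite patchE mem_set.
Qed.

(** * Disjoint cells around a finite net *)

Section cells.
Variables (s : seq (pt R)) (e : R).
Hypothesis e0 : 0 < e.

Let near k (x : pt R) : R := \1_[set y | n1 (y - nth 0 s k) <= e] x.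

(** The indicator of the points farther than [e] from the first [k] points of the net; consecutive
    differences are the indicators of the balls made disjoint. *)
Fixpoint avoid (k : nat) (x : pt R) : R :=
  if k is k'.+1 then avoid k' x * (1 - near k' x) else 1.

Let bnear k : bmeas K (near k).
Proof.
split; last by exists 1 => x _; rewrite /near indicE; case: (_ \in _); rewrite ?normr1// normr0.
apply: measurable_funTS; apply: measurable_indic; apply: closed_pt_measurable.
have /continuous_closedP : continuous (fun y : pt R => n1 (y - nth 0 s k)).
  apply: (@lip_continuous _ 1) => x y; rewrite mul1r.
  have h1 := n1_triangle x y (nth 0 s k); have h2 := n1_triangle y x (nth 0 s k).
  by rewrite (n1_sym y x) in h2; rewrite ler_norml; apply/andP; split; lra.
by move=> /(_ [set r | r <= e] (@closed_le _ e)).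
Qed.

Let bavoid k : bmeas K (avoid k).
Proof.
elim: k => [|k IH]; first exact: bmeas_cst.
by apply: bmeasM => //; apply: bmeasB; [exact: bmeas_cst|exact: bnear].
Qed.

Let near01 k x : near k x = 0 \/ near k x = 1.
Proof. by rewrite /near indicE; case: (_ \in _); [right|left]. Qed.

Let avoid01 k x : 0 <= avoid k x <= 1.
Proof.
elim: k => [|k IH] /=; first by rewrite ler01 lexx.
by case: (near01 k x) => ->; rewrite ?subr0 ?mulr1// subrr mulr0 lexx ler01.
Qed.

Definition cell k x : R := avoid k x - avoid k.+1 x.

Lemma cellE k x : cell k x = avoid k x * near k x.
Proof. by rewrite /cell /= mulrBr mulr1 opprB addrCA subrr addr0. Qed.

Lemma cell_ge0 k x : 0 <= cell k x.
Proof.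
by rewrite cellE mulr_ge0//; case/andP: (avoid01 k x).
Qed.

Lemma cell_near k x : cell k x != 0 -> n1 (x - nth 0 s k) <= e.
Proof.
rewrite cellE mulf_eq0 negb_or => /andP[_]; rewrite /near indicE.
by case: (boolP (_ \in _)); rewrite ?eqxx// inE.
Qed.

Lemma bmeas_cell k : bmeas K (cell k).
Proof. exact: (bmeasB (bavoid k) (bavoid k.+1)). Qed.

Lemma sum_cell x : (exists2 y, y \in s & n1 (x - y) <= e) ->
  \sum_(k < size s) cell k x = 1.
Proof.
move=> [y ys xy]; pose j := index y s.
have js : (j < size s)%N by rewrite index_mem.
have avoid0 k : (j < k)%N -> avoid k x = 0.
  elim: k => // k IH; rewrite ltnS leq_eqVlt => /predU1P[<-|/IH /= ->]; last by rewrite mul0r.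
  by rewrite /= /near indicE mem_set ?subrr ?mulr0//= nth_index.
have tel k : \sum_(i < k) cell i x = 1 - avoid k x.
  elim: k => [|k IH]; first by rewrite big_ord0 subrr.
  by rewrite big_ord_recr IH /cell /= addrA subrK.
by rewrite tel avoid0 ?subr0.
Qed.

End cells.

(** The initial measure enters only through the integral of [f (z, 0)]. Hence closeness is tested on
    functions with the affine modulus that [modulus] provides. *)
Lemma approx_law (e : R) : 0 < e -> e <= 1 ->
  exists n (m : 'I_n.+1 -> R) (z : 'I_n.+1 -> pt R),
  [/\ forall i, 0 < m i, \sum_i m i = 1, forall i, boxed (B + 2) (z i),
      injective (fun i => (z i).2) &
   forall (f : pt R -> R) (L a G : R), measurable_fun setT f -> 0 <= L -> 0 <= G ->
    (forall x y, boxed (B + 2) x -> boxed (B + 2) y -> `|f x - f y| <= a + L * n1 (x - y)) ->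
    (forall x, boxed (B + 2) x -> `|f x| <= G) ->
    `|\sum_i m i * f (z i) - \int[abar]_x f x| <= a + (2 * L + 2 * G) * e].
Proof.
move=> e0 e1; have [s0 s0P] := @net3 R B e e0.
(* Net points outside this box are farther than 1 from [K], so at scale [e] at most 1 they cover
   nothing. *)
pose s := [seq y <- s0 | `[< boxed (B + 1) y >] ].
have sP x : K x -> exists2 y, y \in s & n1 (x - y) <= e.
  move=> /KB bx; have [y ys xy] := s0P x bx; exists y => //.
  rewrite mem_filter ys andbT; apply/asboolP.
  have [h1 h2 h3] := boxed_self (x - y); have [b1 b2 b3] := bx.
  have tri (u v : R) : `|u| <= B -> `|u - v| <= n1 (x - y) -> `|v| <= B + 1.
    move=> uB uv; rewrite -[v](subrK u) addrC; apply: (le_trans (ler_normD _ _)).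
    by rewrite distrC; lra.
  by split; [exact: tri h1|exact: tri h2|exact: tri h3].
have sB y : y \in s -> boxed (B + 1) y by rewrite mem_filter => /andP[/asboolP].
have [x0 Kx0] : K !=set0.
  by apply/set0P/eqP => K0; move: K1; rewrite K0 measure0 => /eqP; rewrite eq_sym onee_eq0.
have : (0 < size s)%N by have [y ys _] := sP _ Kx0; case: s ys {sP sB}.
case Es : (size s) => [//|n] _.
pose p (k : 'I_n.+1) := IK (cell s e k).
have p0 k : 0 <= p k by apply: Rintegral_ge0 => x _; exact: cell_ge0.
have bc k : bmeas K (cell s e k) by exact: bmeas_cell.
have scell x : K x -> \sum_(k < n.+1) cell s e k x = 1.
  by move=> /sP /(sum_cell (s := s)); rewrite Es.
have psum : \sum_k p k = 1.
  rewrite /p -(bmeas_int_sum mK Kfin)// -[RHS]IK_cst.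
  by apply: eq_Rintegral => x; rewrite inE; exact: scell.
pose N1 : R := n.+1%:R; have N10 : 0 < N1 by [].
(* Some cells may be null; mixing with the uniform weights makes all masses positive and costs at
   most [2 * G * e]. *)
pose m k := (1 - e) * p k + e / N1.
have e01 : 0 <= 1 - e by rewrite subr_ge0.
have [t [tinj tle]] := injective_shift (fun k : 'I_n.+1 => (nth 0 s k).2) e0.
(* Distinct heights are what [flow_exists] requires. The shift is at most [e], and the box grows
   from [B + 1] to [B + 2]. *)
pose z (k : 'I_n.+1) : pt R := ((nth 0 s k).1, (nth 0 s k).2 + t * k%:R).
have sk (k : 'I_n.+1) : nth 0 s k \in s by rewrite mem_nth// Es.
have zs k : n1 (z k - nth 0 s k) <= e.
  rewrite /n1 /= !subrr !normr0 !add0r addrAC subrr add0r; exact: tle.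
have zB k : boxed (B + 2) (z k).
  have [h1 h2 h3] := sB _ (sk k); rewrite /z; split => /=.
  - by apply: (le_trans h1); rewrite lerD2l ler1n.
  - by apply: (le_trans h2); rewrite lerD2l ler1n.
  - by apply: (le_trans (ler_normD _ _)); have := tle k; lra.
exists n, m, z; split => //.
- by move=> k; rewrite /m ltr_wpDl ?divr_gt0// mulr_ge0.
- rewrite /m big_split /= -mulr_sumr psum mulr1 sumr_const card_ord -[_ *+ _]mulr_natr.
  by rewrite divfK ?gt_eqF// subrK.
move=> f L a G mf L0 G0 fL fG.
have bf : bmeas K f.
  split; first exact: measurable_funTS.
  exists G => x /KB[h1 h2 h3]; apply: fG.
  have le2 : B <= B + 2 by rewrite lerDl.
  by split; apply: le_trans le2.
have bB x : K x -> boxed (B + 2) x.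
  by move=> /KB[h1 h2 h3]; have le2 : B <= B + 2 by [rewrite lerDl]; split; apply: le_trans le2.
have h1 : `|\sum_k p k * f (z k) - IK f| <= a + L * (2 * e).
  have -> : \sum_k p k * f (z k) = IK (fun x => \sum_(k < n.+1) f (z k) * cell s e k x).
    rewrite (bmeas_int_sum mK Kfin); last by move=> k; exact: bmeasZ.
    by apply: eq_bigr => k _; rewrite (bmeas_intZ mK Kfin)// mulrC.
  rewrite -[leRHS]IK_cst; apply: (bmeas_int_dist mK Kfin) => //.
  - by apply: bmeas_sum => k; exact: bmeasZ.
  - exact: bmeas_cst.
  apply: aeW => x Kx; rewrite -[f x]mulr1 -[X in f x * X](scell x Kx) mulr_sumr -sumrB.
  apply: (le_trans (ler_norm_sum _ _ _)).
  rewrite -[leRHS]mulr1 -[X in _ <= _ * X](scell x Kx) mulr_sumr; apply: ler_sum => k _.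
  rewrite -mulrBl normrM (ger0_norm (cell_ge0 _ _ _ _)).
  have [->|ck] := eqVneq (cell s e k x) 0; first by rewrite !mulr0.
  rewrite ler_wpM2r ?cell_ge0// distrC; apply: (le_trans (fL _ _ (bB _ Kx) (zB k))).
  rewrite lerD2l ler_wpM2l//; have := n1_triangle x (nth 0 s k) (z k).
  by have h1 := cell_near ck; have h2 := zs k; rewrite n1_sym in h2; lra.
have h2 : `|\sum_k m k * f (z k) - \sum_k p k * f (z k)| <= 2 * G * e.
  have pG : `|\sum_k p k * f (z k)| <= G.
    apply: (le_trans (ler_norm_sum _ _ _)); rewrite -[G]mul1r -psum mulr_suml.
    by apply: ler_sum => k _; rewrite normrM ger0_norm// ler_wpM2l// fG.
  have uG : `|\sum_(k < n.+1) N1^-1 * f (z k)| <= G.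
    apply: (le_trans (ler_norm_sum _ _ _)).
    apply: (@le_trans _ _ (\sum_(k < n.+1) N1^-1 * G)).
      apply: ler_sum => k _; rewrite normrM ger0_norm ?invr_ge0 ?(ltW N10)//.
      by rewrite ler_wpM2l ?invr_ge0 ?(ltW N10)// fG.
    by rewrite sumr_const card_ord -mulr_natl mulrA divff ?mul1r// gt_eqF.
  have -> : \sum_k m k * f (z k) - \sum_k p k * f (z k) =
      e * (\sum_(k < n.+1) N1^-1 * f (z k) - \sum_k p k * f (z k)).
    rewrite mulrBr !mulr_sumr -!sumrB; apply: eq_bigr => k _; rewrite /m.
    by move: N1^-1 => u; ring.
  rewrite normrM gtr0_norm// mulrC ler_pM2r//.
  by apply: (le_trans (ler_normB _ _)); lra.
rewrite IKT; have := ler_distD (\sum_k p k * f (z k)) (\sum_i m i * f (z i)) (IK f).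
by move: h1 h2; lra.
Qed.

End approximation.

(** * Passage to the limit *)

Lemma bounded_boxed (R : realType) (A : set (pt R)) : bounded_set A ->
  exists r, forall x, A x -> boxed r x.
Proof.
move=> [r [_ rP]]; exists (r + 1) => x Ax.
have : `|x| <= r + 1 by apply: (rP (r + 1)) => //; rewrite ltrDl.
by rewrite prod_normE prod_normE !ge_max => /andP[/andP[? ?] ?].
Qed.

Lemma within_int_dist (R : realType) (T c : R) (u v : R -> R) : 0 < T ->
  {within `[0, T], continuous u} -> {within `[0, T], continuous v} ->
  (forall t, 0 <= t <= T -> `|u t - v t| <= c) ->
  `|\int[@lebesgue_measure R]_(t in `[0, T]) u t -
    \int[@lebesgue_measure R]_(t in `[0, T]) v t| <= c * T.
Proof.
move=> T0 cu cv uv.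
have int g : {within `[0, T], continuous g} ->
    (@lebesgue_measure R).-integrable `[0, T] (EFin \o g).
  by move=> cg; apply: continuous_compact_integrable => //; exact: segment_compact.
have ci (a : R) : \int[@lebesgue_measure R]_(t in `[0, T]) (fun=> a) t = a * T.
  transitivity (a * fine (@lebesgue_measure R `[0, T])).
    by apply: Rintegral_cst; exact: measurable_itv.
  by rewrite lebesgue_measure_itv /= lte_fin T0 /= subr0.
have cuv : {within `[0, T], continuous (fun t => u t - v t)}.
  by move=> t; apply: cvgB; [exact: cu|exact: cv].
have cc a : {within `[0, T], continuous (fun=> a : R)} by move=> t; exact: cvg_cst.
rewrite -RintegralB; [|exact: measurable_itv|exact: int|exact: int].
rewrite ler_norml -mulNr -!ci; apply/andP; split; apply: le_Rintegral;
  try exact: measurable_itv; try exact: int.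
- by move=> t; rewrite /= in_itv /= => /uv; rewrite ler_norml => /andP[].
- by move=> t; rewrite /= in_itv /= => /uv; rewrite ler_norml => /andP[].
Qed.

Lemma third_le (R : realFieldType) (e : R) : 0 < e -> e / 3 <= e.
Proof. by move=> e0; lra. Qed.

Section limit.
Variables (R : realType) (Om : set (pt R)) (rho : R).
Hypothesis oOm : open Om.
Hypothesis bOm : forall x, Om x -> boxed rho x.
Hypothesis Om1 : leb3 R Om = 1%E.

Let b1 : bmeas Om (fun=> 1 : R). Proof. exact: bmeas_cst. Qed.
Let b11 : bmeas Om (fun x => x.1.1). Proof. exact: (lip_bmeas oOm bOm (@lip_pt11 R)). Qed.
Let b12 : bmeas Om (fun x => x.1.2). Proof. exact: (lip_bmeas oOm bOm (@lip_pt12 R)). Qed.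

Lemma wk_cont f M T Phi : test_fun f -> ptraj Om M T Phi ->
  {within `[0, T], continuous (fun t => wk Om f (Phi t) t)}.
Proof.
move=> tf tr t; apply: cvgB; last apply: cvgB.
- by apply: (act_cont oOm Om1 b1 _ tr); exact: wk0_cont.
- by apply: (act_cont oOm Om1 b11 _ tr); exact: (test_Dcont tf).
- by apply: (act_cont oOm Om1 b12 _ tr); exact: (test_Dcont tf).
Qed.

Lemma act1_modulus a (M T e : R) : continuous a -> 0 < e ->
  exists2 C : R, 0 <= C & forall phi psi t, potential Om M phi -> potential Om M psi ->
    0 <= t <= T -> `|act Om (fun=> 1) a phi t - act Om (fun=> 1) a psi t| <=
      e + C * gdist Om phi psi.
Proof.
move=> ca e0; have [|C C0 CP] := act_modulus (K := 1) oOm Om1 M T b1 _ ca e0.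
  by move=> x _; rewrite normr1.
have simp (g u : R) : 1 * (e + C * (g + `|u - u|)) = e + C * g.
  by rewrite subrr normr0 addr0 mul1r.
by exists C => // phi psi t Kp Kp' tT; have := CP _ _ _ _ Kp Kp' tT tT; rewrite simp.
Qed.

Lemma wk_modulus f (M T e : R) : test_fun f -> 0 < e ->
  exists2 C : R, 0 <= C & forall phi psi t, potential Om M phi -> potential Om M psi ->
    0 <= t <= T -> `|wk Om f phi t - wk Om f psi t| <= e + C * gdist Om phi psi.
Proof.
move=> tf e0; have rho0 := rho_ge0 bOm Om1.
pose K := rho + 1; have K0 : 0 < K by rewrite ltr_wpDl.
have e3 : 0 < e / (3 * K) by rewrite divr_gt0// mulr_gt0.
have rK : rho <= K by rewrite lerDl.
have q1 (x : pt R) : Om x -> `|1 : R| <= K by rewrite normr1 lerDr.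
have q11 (x : pt R) : Om x -> `|x.1.1| <= K by move=> /bOm[h _ _]; exact: le_trans h _.
have q12 (x : pt R) : Om x -> `|x.1.2| <= K by move=> /bOm[_ h _]; exact: le_trans h _.
have [C1 C10 h1] := act_modulus oOm Om1 M T b1 q1 (wk0_cont tf) e3.
have [C2 C20 h2] := act_modulus oOm Om1 M T b11 q11 (test_Dcont (v := (e2 R, 0)) tf) e3.
have [C3 C30 h3] := act_modulus oOm Om1 M T b12 q12 (test_Dcont (v := (e1 R, 0)) tf) e3.
exists (K * (C1 + C2 + C3)); first by rewrite mulr_ge0 ?(ltW K0)// !addr_ge0.
move=> phi psi t Kp Kp' tT.
have := h1 _ _ _ _ Kp Kp' tT tT; have := h2 _ _ _ _ Kp Kp' tT tT.
have := h3 _ _ _ _ Kp Kp' tT tT.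
have simp C : K * (e / (3 * K) + C * (gdist Om phi psi + `|t - t|)) =
    e / 3 + K * C * gdist Om phi psi.
  by rewrite subrr normr0 addr0; field; rewrite gt_eqF.
rewrite !simp /wk.
move: (act _ _ _ phi _) (act _ _ _ phi _) (act _ _ _ phi _) => u1 u2 u3.
move: (act _ _ _ psi _) (act _ _ _ psi _) (act _ _ _ psi _) => v1 v2 v3.
move=> k3 k2 k1.
have -> : u1 - (u2 - u3) - (v1 - (v2 - v3)) = (u1 - v1) - (u2 - v2) + (u3 - v3) by ring.
apply: (le_trans (ler_normD _ _)).
apply: (le_trans (lerD (ler_normB _ _) k3)).
apply: (le_trans (lerD (lerD k1 k2) (lexx _))).
by rewrite le_eqVlt; apply/orP; left; apply/eqP; field.
Qed.

Variables (M T : R) (Phi : nat -> R -> pt R -> R) (U : set_system nat).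
Hypothesis UU : UltraFilter U.
Hypothesis T0 : 0 < T.
Hypothesis KP : forall N t, 0 <= t <= T -> potential Om M (Phi N t).
Hypothesis equi : forall e : R, 0 < e -> exists2 d : R, 0 < d & forall N s t,
  0 <= s <= T -> 0 <= t <= T -> `|s - t| <= d ->
  gdist Om (Phi N s) (Phi N t) <= e.

Definition lim_traj t x := ulim U (fun N => Phi N t x).

Let limP t : 0 <= t <= T -> potential Om M (lim_traj t).
Proof. by move=> tT; have [] := ulim_potential oOm bOm Om1 UU (fun N => KP N tT). Qed.

Let lim_near t : 0 <= t <= T -> forall e : R, 0 < e ->
  U [set N | gdist Om (lim_traj t) (Phi N t) <= e].
Proof.
move=> tT e e0; have [_ cl] := ulim_potential oOm bOm Om1 UU (fun N => KP N tT).
have [eta eta0 etaP] := gdist_continuous oOm Om1 (limP tT) e0.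
by apply: filterS (cl eta eta0) => N /= h; apply: etaP => //; exact: KP.
Qed.

Let lim_equi (e : R) : 0 < e -> exists2 d : R, 0 < d & forall s t,
  0 <= s <= T -> 0 <= t <= T -> `|s - t| <= d ->
  gdist Om (lim_traj s) (lim_traj t) <= e /\
  forall N, gdist Om (Phi N s) (Phi N t) <= e.
Proof.
move=> e0; have e3 : 0 < e / 3 by exact: divr_gt0.
have [d d0 dP] := equi e3; exists d => // s t sT tT st.
have [N /= [h1 h2]] := filter_ex (filterI (lim_near sT e3) (lim_near tT e3)).
have k1 := gdist_triangle oOm Om1 (limP sT) (KP N sT) (limP tT).
have k2 := gdist_triangle oOm Om1 (KP N sT) (KP N tT) (limP tT).
have k3 := dP N s t sT tT st.
rewrite (gdist_sym Om (Phi N t) (lim_traj t)) in k2.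
split; last by move=> N'; apply: (le_trans (dP N' s t sT tT st)); exact: third_le.
by apply: (le_trans k1); rewrite -(thirds e); exact: (lerD h1 (le_trans k2 (lerD k3 h2))).
Qed.

Lemma lim_ptraj : ptraj Om M T lim_traj.
Proof.
split; first exact: limP.
move=> e e0; have [d d0 dP] := lim_equi e0.
by exists d => // s t sT tT st; have [] := dP s t sT tT st.
Qed.

(** Convergence at finitely many times suffices, by an equicontinuity in time common to all
    approximants and the limit. *)
Lemma lim_unif (e : R) : 0 < e ->
  U [set N | forall t, 0 <= t <= T -> gdist Om (Phi N t) (lim_traj t) <= e].
Proof.
move=> e0; have e3 : 0 < e / 3 by exact: divr_gt0.
have [d d0 dP] := lim_equi e3; have [s sP] := net1 T d0.
(* The net covers a symmetric interval and may leave [[0, T]]; projecting onto [[0, T]] does not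
   increase distances to its points. *)
pose cl (v : R) := Num.max 0 (Num.min v T).
have clT v : 0 <= cl v <= T.
  by rewrite /cl le_max lexx /= ge_max ltW//= ge_min lexx orbT.
have : U [set N | forall v, v \in s -> gdist Om (lim_traj (cl v)) (Phi N (cl v)) <= e / 3].
  by apply: (ultra_seq UU (P := fun v => [set N | gdist Om (lim_traj (cl v)) (Phi N (cl v)) <= e / 3])) => v _; exact: lim_near.
apply: filterS => N /= h t tT.
have tT' : `|t| <= T by case/andP: tT => t0 ?; rewrite ger0_norm.
have [v vs tv] := sP t tT'.
have tcv : `|t - cl v| <= d.
  case/andP: tT => t0 tT; move: tv; rewrite /cl !ler_norml => /andP[h1 h2].
  by case: (leP v T) => h3; [case: (leP 0 v) => h4|case: (leP 0 T) => h4];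
    apply/andP; split; move: t0 tT h1 h2 h3 h4; lra.
have [k1 k2] := dP t (cl v) tT (clT v) tcv.
have h1 := h v vs.
have g1 := gdist_triangle oOm Om1 (KP N tT) (KP N (clT v)) (limP tT).
have g2 := gdist_triangle oOm Om1 (KP N (clT v)) (limP (clT v)) (limP tT).
rewrite (gdist_sym Om (lim_traj (cl v)) (Phi N (cl v))) in h1.
rewrite (gdist_sym Om (lim_traj t) (lim_traj (cl v))) in k1.
by apply: (le_trans g1); rewrite -(thirds e); exact: (lerD (k2 N) (le_trans g2 (lerD h1 k1))).
Qed.

End limit.

Theorem theorem3p6 (R : realType) (Omega : set (pt R)) (T : R)
    (abar : probability (pt R) R) :
  open Omega -> bounded_set Omega -> convex_set3 Omega ->
  leb3 R Omega = 1%E ->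
  0 < T ->
  compactly_supported abar ->
  exists (alpha : R -> probability (pt R) R)
         (alphaN : nat -> R -> probability (pt R) R),
    [/\ geo_sol Omega T alpha abar,
        energy_conserving Omega T alpha,
        (forall N : nat, discrete_C1_geo_sol Omega T (alphaN N))
      & forall eps : R, 0 < eps -> exists N0 : nat, forall N : nat,
          (N0 <= N)%N -> forall t : R, 0 <= t <= T ->
            W2 (alphaN N t) (alpha t) <= eps].
Proof.
move=> oOm bdOm cOm Om1 T0 [K [cK mK K1]].
have [rho bOm] := bounded_boxed bdOm.
have [B KB] := bounded_boxed (compact_bounded cK).
have rho0 := rho_ge0 bOm Om1.
(* The Gronwall bound for seeds starting in the box of radius [B + 2]; it does not involve [N]. *)
pose M := expR (T + 1) * (B + 2 + rho).
have /choice[Phi PhiP] : forall N : nat, exists Phi : R -> pt R -> R,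
    exists n (m : 'I_n.+1 -> R) (z : 'I_n.+1 -> R -> pt R),
    [/\ forall i, 0 < m i, \sum_i m i = 1, flow Omega m M T z Phi &
     forall (f : pt R -> R) (L a G : R), measurable_fun setT f -> 0 <= L -> 0 <= G ->
      (forall x y, boxed (B + 2) x -> boxed (B + 2) y -> `|f x - f y| <= a + L * n1 (x - y)) ->
      (forall x, boxed (B + 2) x -> `|f x| <= G) ->
      `|\sum_i m i * f (z i 0) - \int[abar]_x f x| <= a + (2 * L + 2 * G) * N.+1%:R^-1].
  move=> N; have e0 : 0 < N.+1%:R^-1 :> R by [].
  have e1 : N.+1%:R^-1 <= 1 :> R by rewrite invf_le1// ler1n.
  have [n [m [z0 [m0 m1 z0B z0inj app]]]] := approx_law mK K1 KB e0 e1.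
  have [z [Phi [flw z00]]] := flow_exists oOm bOm Om1 m0 m1 z0B z0inj T0 (erefl M).
  exists Phi, n, m, z; split => // f L a G mf L0 G0 fL fG.
  have -> : \sum_i m i * f (z i 0) = \sum_i m i * f (z0 i).
    by apply: eq_bigr => i _; rewrite z00.
  exact: app.
have Tz : 0 <= (0 : R) <= T by rewrite lexx ltW.
have TT : 0 <= T <= T by rewrite lexx ltW.
have trN N : ptraj Omega M T (Phi N).
  by have [n [m [z [m0 m1 flw _]]]] := PhiP N; exact: (flow_ptraj oOm bOm Om1 m0 m1 T0 flw).
have KP N t : 0 <= t <= T -> potential Omega M (Phi N t) by exact: (trN N).1.
have M0 : 0 <= M by have [_ /lip_ge0] := KP 0%N 0 Tz.
have equi (e : R) : 0 < e -> exists2 d : R, 0 < d & forall N s t,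
    0 <= s <= T -> 0 <= t <= T -> `|s - t| <= d ->
    gdist Omega (Phi N s) (Phi N t) <= e.
  move=> e0; have [d d0 dP] := flow_equi oOm bOm Om1 M0 e0; exists d => // N s t.
  by have [n [m [z [m0 m1 flw _]]]] := PhiP N; exact: (dP _ _ _ _ _ m0 m1 flw).
have [U [UU Uoo]] := @exists_ultra.
pose Lim := lim_traj Phi U.
have trL : ptraj Omega M T Lim := lim_ptraj oOm bOm Om1 UU KP equi.
have unif := lim_unif oOm bOm Om1 UU T0 KP equi.
(* Sets of the ultrafilter are nonempty, so each accuracy is reached by some index. The [g k] need
   not increase: convergence of the selected flows is all that is asked. *)
have /choice[g gP] : forall k : nat, exists N, forall t, 0 <= t <= T ->
    gdist Omega (Phi N t) (Lim t) <= k.+1%:R^-1.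
  by move=> k; have [|N NP] := filter_ex (unif k.+1%:R^-1 _) => //; exists N.
have [alpha lawL] := traj_law oOm Om1 trL.
have /choice[beta lawN] : forall N, exists beta : R -> probability (pt R) R,
    forall t, 0 <= t <= T -> has_law Omega (grad3 (Phi N t)) (beta t).
  by move=> N; exact: (traj_law oOm Om1 (trN N)).
exists alpha, (fun k => beta (g k)); split.
- apply: (traj_geo oOm bOm Om1 T0 trL lawL cOm) => f tf.
  have cf := test_cont tf.
  (* The error is [2 * e] per unit of time in the integrand, plus [2 * e] for the final term and
     [2 * e] for the initial one. *)
  apply/eqP; rewrite -subr_eq0 -normr_le0; apply: (@le_small _ _ _ (2 * T + 4)) => e e0 e1.
  have [C1 C10 h1] := wk_modulus oOm bOm Om1 M T tf e0.
  have [C2 C20 h2] := act1_modulus oOm Om1 M T cf e0.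
  have [L L0 hL] := modulus (B + 2) 0 cf e0.
  have z00 : 0 <= (0 : R) <= 0 by rewrite lexx.
  have fL x y : boxed (B + 2) x -> boxed (B + 2) y ->
      `|f (x, 0) - f (y, 0)| <= e + L * n1 (x - y).
    by move=> bx by_; have := hL x y 0 0 bx by_ z00 z00; rewrite /nt /= subrr normr0 addr0.
  pose G := `|f (0, 0)| + (e + L * (3 * `|B + 2|)).
  have G0 : 0 <= G by rewrite addr_ge0// addr_ge0 ?(ltW e0)// !mulr_ge0.
  have fG x : boxed (B + 2) x -> `|f (x, 0)| <= G.
    move=> bx; have B2 := boxed_ge0 bx.
    have b0 : boxed (B + 2) (0 : pt R) by split; rewrite normr0.
    rewrite -[f (x, 0)](subrK (f (0, 0))) addrC.
    apply: (le_trans (ler_normD _ _)); rewrite lerD2l; apply: (le_trans (fL _ _ bx b0)).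
    by rewrite lerD2l ler_wpM2l// subr0 (ger0_norm B2); exact: boxed_n1.
  pose A := 2 * L + 2 * G.
  have C12 : 0 < C1 + C2 + 1 by rewrite ltr_wpDl// addr_ge0.
  have [N /= [N1 N2]] := filter_ex (filterI (unif _ (divr_gt0 e0 C12))
    (ultra_ge Uoo (Num.truncn (A / e)))).
  have AN : A * N.+1%:R^-1 <= e.
    rewrite ler_pdivrMr// mulrC -ler_pdivrMr//; apply: (le_trans (ltW (truncnS_gt _))).
    by rewrite ler_nat ltnS.
  have Cle C t : 0 <= C -> C <= C1 + C2 -> 0 <= t <= T ->
      C * gdist Omega (Phi N t) (Lim t) <= e.
    move=> C0 Cl tT; apply: (le_trans (ler_wpM2l C0 (N1 t tT))).
    by rewrite mulrA ler_pdivrMr// mulrC ler_pM2l// (le_trans Cl)// lerDl.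
  have [n [m [z [m0 m1 flw app]]]] := PhiP N.
  have i1 : `|act Omega (fun=> 1) f (Phi N T) T - act Omega (fun=> 1) f (Phi N 0) 0 -
      \int[@lebesgue_measure R]_(t in `[0, T]) wk Omega f (Lim t) t| <= (e + e) * T.
    rewrite -(flow_weak oOm bOm Om1 m0 m1 T0 flw tf).
    apply: (within_int_dist T0 (wk_cont oOm bOm Om1 tf (trN N)) (wk_cont oOm bOm Om1 tf trL)).
    move=> t tT; apply: (le_trans (h1 _ _ _ (KP N t tT) (trL.1 t tT) tT)).
    by rewrite lerD2l Cle// lerDl.
  have i2 := le_trans (h2 _ _ _ (KP N T TT) (trL.1 T TT) TT)
    (lerD (lexx e) (Cle C2 T C20 _ TT)).
  have {}i2 := i2 (ler_wpDl C10 (lexx C2)).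
  have mf : measurable_fun setT (fun x => f (x, 0)).
    exact: (continuous_pt_measurable (cont_pair (t := 0) cf)).
  have i3 := le_trans (app _ L e G mf L0 G0 fL fG) (lerD (lexx e) AN).
  rewrite -(flow_act1 oOm Om1 flw f Tz) in i3.
  move: i1 i2 i3; move: (act _ _ _ (Phi N T) _) (act _ _ _ (Phi N 0) _)
    (act _ _ _ (Lim T) _) (\int[_]_(t in _) _) (\int[_]_x _) => a1 a2 a3 a4 a5.
  clear - a1 a2 a3 a4 a5 e e0 T T0; rewrite !ler_norml => /andP[? ?] /andP[? ?] /andP[? ?].
  by apply/andP; split; lra.
- move=> s t sT tT.
  rewrite (energyE oOm bOm Om1 trL lawL cOm sT) (energyE oOm bOm Om1 trL lawL cOm tT).
  (* The energy of the [N]-th flow is constant, and the limit is within [2 * e] of it at both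
     times. *)
  apply/eqP; rewrite -subr_eq0 -normr_le0; apply: (@le_small _ _ _ 4) => e e0 _.
  have [C C0 CP] := enp_modulus oOm bOm Om1 M T0 e0.
  have C1 : 0 < C + 1 by rewrite ltr_wpDl.
  have [N /= N1] := filter_ex (unif _ (divr_gt0 e0 C1)).
  have close u : 0 <= u <= T -> `|enp Omega (Phi N u) - enp Omega (Lim u)| <= e + e.
    move=> uT; apply: (le_trans (CP _ _ (KP N u uT) (trL.1 u uT))); rewrite lerD2l.
    apply: (le_trans (ler_wpM2l C0 (N1 u uT))).
    by rewrite mulrA ler_pdivrMr// mulrC ler_pM2l// lerDl.
  have [n [m [z [m0 m1 flw _]]]] := PhiP N.
  have := close s sT; have := close t tT.
  rewrite (flow_energy oOm bOm Om1 m0 T0 flw sT) (flow_energy oOm bOm Om1 m0 T0 flw tT).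
  move: (enp _ _) (enp _ _) (enp _ _) => a b c; clear - a b c e.
  by rewrite !ler_norml => /andP[? ?] /andP[? ?]; apply/andP; split; lra.
- move=> k; have [n [m [z [m0 m1 flw _]]]] := PhiP (g k).
  exact: (flow_geo oOm bOm Om1 cOm m0 m1 T0 flw (lawN (g k))).
- move=> eps eps0; have M1 : 0 < 2 * M + 1 by rewrite ltr_wpDl// mulr_ge0.
  have d0 : 0 < eps ^+ 2 / (2 * M + 1) by rewrite divr_gt0// exprn_gt0.
  have [k0 _ k0P] := near_infty_natSinv_lt (PosNum d0).
  exists k0 => k kk0 t tT.
  apply: (gdist_W2 oOm Om1 (KP (g k) t tT) (trL.1 t tT) (lawN _ t tT) (lawL t tT) eps0).
  by apply: (le_trans (gP k t tT)); have /ltW := k0P k kk0.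
Qed.
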